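(* Let $A=kQ/I$ be a $1$-cycle gentle algebra over a field $k$ (of arbitrary global dimension). Then the Euler form $q_A$ is non-negative of corank $\mathrm{crk}(q_A)=\nabla_A\in\{0,1\}$.
   Context: $k$ is an arbitrary field. Paths in a finite quiver $Q=(Q_0,Q_1,s,t)$ are written from right to left, i.e. $\alpha_1\cdots\alpha_\ell$ is a path when $s(\alpha_r)=t(\alpha_{r+1})$. A gentle bound quiver $(Q,I)$ consists of a connected quiver $Q$ with at least one arrow and an admissible ideal $I$ of $kQ$ generated by paths of length two such that: each vertex is the source of at most two arrows and the target of at most two arrows; for each arrow $\beta$ there is at most one arrow $\alpha$ with $\alpha\beta\notin I$ and at most one arrow $\gamma$ with $\beta\gamma\notin I$; for each arrow $\beta$ there is at most one arrow $\alpha$ with $0\neq\alpha\beta\in I$ and at most one arrow $\gamma$ with $0\neq\beta\gamma\in I$. $A=kQ/I$ is then a gentle algebra; it is $1$-cycle if $|Q_1|-|Q_0|+1=1$. Multi-clock condition. A walk in $Q$ is $\omega=\xi_1\cdots\xi_\ell$ with $\xi_t\in Q_1\cup Q_1^{-1}$, $s(\xi_t)=t(\xi_{t+1})$ (where $s(\alpha^{-1})=t(\alpha)$, $t(\alpha^{-1})=s(\alpha)$); closed if $s(\xi_\ell)=t(\xi_1)$; without repeated edges if $\xi_a\neq\xi_b^{\pm1}$ for $a\neq b$. For a closed walk with $\ell\geq1$ without repeated edges, $\mathrm{nr}(\omega)$ is the number of paths of length two $\rho\in I$ that are a subpath of $\omega$ or of the form $\xi_\ell\xi_1$ with $\xi_1,\xi_\ell\in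 Q_1$, plus the number of paths of length two $\rho\in I$ that are a subpath of $\omega^{-1}$ or of the form $\xi_1^{-1}\xi_\ell^{-1}$ with $\xi_1^{-1},\xi_\ell^{-1}\in Q_1$. $(Q,I)$ satisfies the multi-clock condition if $\mathrm{nr}(\omega)$ is even for all such $\omega$; $\nabla_A:=1$ if it does and $\nabla_A:=0$ otherwise. Euler form. On the Grothendieck group $K_0(\mathrm{per}\,A)$ of the category of perfect complexes, $\langle[X],[Y]\rangle_A=\sum_{i\in\mathbb{Z}}(-1)^i\dim_k\mathrm{Hom}_{D^b(A)}(X,Y[i])$ and $q_A(x)=\langle x,x\rangle_A$. It is non-negative if $q_A(x)\geq0$ for all $x$. Its corank is the corank (rank of the null space) of the Gram matrix of the symmetric bilinear form $q_A(x,y)=q_A(x+y)-q_A(x)-q_A(y)$. *)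

(* Defs.v *)
From HB Require Import structures.
From mathcomp Require Import all_boot all_order all_algebra.
From mathcomp Require Import zify finmap monalg.
From mathcomp Require Import boolp classical_sets fsbigop.

Set Implicit Arguments.
Unset Strict Implicit.
Unset Printing Implicit Defensive.

Import GRing.Theory.

Local Open Scope ring_scope.

Record quiver := Quiver {
  Q0 : finType;
  Q1 : finType;
  qs : Q1 -> Q0;
  qt : Q1 -> Q0 }.

Section Paths.
Variable Q : quiver.

(* Paths are written from right to left.  The path a_1 ... a_l is encoded by
   the pair (t(a_1), [:: a_1; ...; a_l]) and the trivial path at v by
   (v, [::]). *)
Fixpoint composable (v : Q0 Q) (p : seq (Q1 Q)) : bool :=
  if p is a :: p' then (qt a == v) && composable (qs a) p' else true.

Definition is_path (x : Q0 Q * seq (Q1 Q)) : bool := composable x.1 x.2.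

Record qpath := QPath { pdata :> Q0 Q * seq (Q1 Q); _ : is_path pdata }.
HB.instance Definition _ := [isSub for pdata].
HB.instance Definition _ := [Choice of qpath by <:].

Definition ptgt (p : qpath) : Q0 Q := (val p).1.
Definition parr (p : qpath) : seq (Q1 Q) := (val p).2.
Definition psrc (p : qpath) : Q0 Q := last (ptgt p) [seq qs a | a <- parr p].

Definition pathv (v : Q0 Q) : qpath := @QPath (v, [::]) isT.

Lemma is_path_arrow (a : Q1 Q) : is_path (qt a, [:: a]).
Proof. by rewrite /is_path /= eqxx. Qed.

Definition patha (a : Q1 Q) : qpath := QPath (is_path_arrow a).

Lemma composable_cat v p p' :
  composable v (p ++ p') =
  composable v p && composable (last v [seq qs a | a <- p]) p'.
Proof. by elim: p v => //= a p IHp v; rewrite IHp andbA. Qed.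

Definition pcat (p q : qpath) : option qpath :=
  if psrc p == ptgt q then insub (ptgt p, parr p ++ parr q) else None.

Variant pcat_spec (p q : qpath) : option qpath -> Prop :=
| PcatSome r of psrc p = ptgt q & ptgt r = ptgt p & psrc r = psrc q
    & parr r = parr p ++ parr q : pcat_spec p q (Some r)
| PcatNone of psrc p <> ptgt q : pcat_spec p q None.

Lemma pcatP p q : pcat_spec p q (pcat p q).
Proof.
rewrite /pcat; case: eqP => [e|]; last by right.
have H : is_path (ptgt p, parr p ++ parr q).
  have Hp : composable (ptgt p) (parr p) := valP p.
  rewrite /is_path /= composable_cat Hp -/(psrc p) e.
  exact: (valP q).
rewrite insubT; left => //.
by rewrite /psrc /ptgt /parr /= map_cat last_cat -/(psrc p) e.
Qed.

Lemma qpath_eq (p q : qpath) : ptgt p = ptgt q -> parr p = parr q -> p = q.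
Proof.
by rewrite /ptgt /parr => e1 e2; apply: val_inj; apply/pair_eqP/andP;
   rewrite e1 e2.
Qed.

Lemma pcatA p q r :
  obind (fun u => pcat p u) (pcat q r) = obind (fun u => pcat u r) (pcat p q).
Proof.
case: (pcatP q r) => [u e1 t1 s1 a1|n1] /=; last first.
  case: (pcatP p q) => [w e2 t2 s2 a2|//] /=.
  by case: (pcatP w r) => // z; rewrite s2.
case: (pcatP p u) => [z e3 t3 s3 a3|n3]; case: (pcatP p q) => [w e2 t2 s2 a2|n2] //=.
- case: (pcatP w r) => [z' e4 t4 s4 a4|]; last by rewrite s2.
  congr Some; apply: qpath_eq; first by rewrite t3 t4 t2.
  by rewrite a3 a4 a1 a2 catA.
- by case: n2; rewrite e3.
- by case: n3; rewrite e2.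
Qed.

Lemma pcat1p p v : pcat (pathv v) p = if v == ptgt p then Some p else None.
Proof.
case: pcatP => [r|]; rewrite -[psrc (pathv v)]/v => e; last by case: eqP.
by move=> tr _ ar; rewrite e eqxx; congr Some; apply: qpath_eq; rewrite ?tr.
Qed.

Lemma pcatp1 p v : pcat p (pathv v) = if psrc p == v then Some p else None.
Proof.
case: pcatP => [r|]; rewrite -[ptgt (pathv v)]/v => e; last by case: eqP.
move=> tr _ ar; rewrite e eqxx; congr Some; apply: qpath_eq => //.
by rewrite ar cats0.
Qed.

End Paths.

Section PathAlgebra.
Variables (k : fieldType) (Q : quiver).

Definition pathalg : Type := {malg k[qpath Q]}.
HB.instance Definition _ := GRing.Lmodule.on pathalg.

Definition pbase (p : qpath Q) : pathalg := << p >>.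

Definition pbase_opt (o : option (qpath Q)) : pathalg := oapp pbase 0 o.

Definition pext (V : lmodType k) (h : qpath Q -> V) (f : pathalg) : V :=
  \sum_(p <- msupp f) f@_p *: h p.

Lemma pextEw (V : lmodType k) (h : qpath Q -> V) (d : {fset qpath Q}) f :
  (msupp f `<=` d)%fset -> pext h f = \sum_(p <- d) f@_p *: h p.
Proof.
move=> le; apply: (big_fset_incl _ le) => p _ /mcoeff_outdom ->.
by rewrite scale0r.
Qed.

Lemma pext_linear (V : lmodType k) (h : qpath Q -> V) c f g :
  pext h (c *: f + g) = c *: pext h f + pext h g.
Proof.
pose d := (msupp f `|` msupp g)%fset.
rewrite (@pextEw _ _ d (c *: f + g)); last first.
  apply: (fsubset_trans (msuppD_le _ _)); apply: fsetSU; exact: msuppZ_le.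
rewrite (@pextEw _ _ d f) ?fsubsetUl // (@pextEw _ _ d g) ?fsubsetUr //.
rewrite scaler_sumr -big_split; apply: eq_bigr => p _ /=.
by rewrite mcoeffD mcoeffZ scalerDl scalerA.
Qed.

HB.instance Definition _ (V : lmodType k) (h : qpath Q -> V) :=
  GRing.isLinear.Build k pathalg V _ (pext h) (pext_linear h).

Lemma pextU (V : lmodType k) (h : qpath Q -> V) p : pext h (pbase p) = h p.
Proof.
rewrite (@pextEw _ _ [fset p]%fset); last exact: msuppU_le.
by rewrite big_seq_fset1 mcoeffUU scale1r.
Qed.

Lemma pathalg_ind (V : lmodType k) (F G : pathalg -> V) :
  linear F -> linear G -> (forall p, F (pbase p) = G (pbase p)) -> F =1 G.
Proof.
move=> lF lG eFG f.
pose F' : {linear pathalg -> V} := HB.pack F (GRing.isLinear.Build _ _ _ _ F lF).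
pose G' : {linear pathalg -> V} := HB.pack G (GRing.isLinear.Build _ _ _ _ G lG).
rewrite -[F f]/(F' f) -[G f]/(G' f) (monalgE f) !raddf_sum /=.
apply: eq_bigr => p _.
have -> : << f@_p *g p >> = f@_p *: pbase p.
  apply/malgP => q; rewrite mcoeffZ !mcoeffU; case: (p == q) => /=.
    by rewrite !mulr1n mulr1.
  by rewrite !mulr0n mulr0.
by rewrite -[LHS]/(F' _) -[RHS]/(G' _) !linearZ /= eFG.
Qed.

Definition pmul (f g : pathalg) : pathalg :=
  pext (fun p => pext (fun q => pbase_opt (pcat p q)) g) f.

Definition pone : pathalg := \sum_(v : Q0 Q) pbase (pathv v).

Lemma pmulUU p q : pmul (pbase p) (pbase q) = pbase_opt (pcat p q).
Proof. by rewrite /pmul !pextU. Qed.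

Lemma pmul_linearl g : linear (pmul^~ g).
Proof. by move=> c f f'; rewrite /pmul linearP. Qed.

Lemma pmul_linearr f : linear (pmul f).
Proof.
move=> c g g'; rewrite /pmul /pext scaler_sumr -big_split /=.
apply: eq_bigr => p _.
by rewrite -!/(pext _ _) linearP /= scalerDr !scalerA mulrC.
Qed.

Let pmul_opt (o o' : option (qpath Q)) :
  pmul (pbase_opt o) (pbase_opt o') =
  pbase_opt (obind (fun p => obind (fun q => pcat p q) o') o).
Proof.
have m0 f : pmul f 0 = 0.
  by have := pmul_linearr f (-1) 0 0; rewrite scaler0 addr0 scaleN1r addNr.
have m0' f : pmul 0 f = 0.
  by have := pmul_linearl f (-1) 0 0; rewrite scaler0 addr0 scaleN1r addNr.
by case: o o' => [p|] [q|] /=; rewrite ?m0 ?m0' ?pmulUU.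
Qed.

Lemma pmulA : associative pmul.
Proof.
move=> f g h.
apply: (pathalg_ind (F := fun f => pmul f (pmul g h))
                    (G := fun f => pmul (pmul f g) h)) f.
- exact: pmul_linearl.
- by move=> c f f'; rewrite !pmul_linearl.
move=> p; apply: (pathalg_ind (F := fun g => pmul (pbase p) (pmul g h))
                              (G := fun g => pmul (pmul (pbase p) g) h)) g.
- by move=> c f f'; rewrite pmul_linearl pmul_linearr.
- by move=> c f f'; rewrite pmul_linearr pmul_linearl.
move=> q; apply: (pathalg_ind (F := fun h => pmul (pbase p) (pmul (pbase q) h))
                    (G := fun h => pmul (pmul (pbase p) (pbase q)) h)) h.
- by move=> c f f'; rewrite !pmul_linearr.
- exact: pmul_linearr.
move=> r; rewrite !pmulUU.
rewrite (pmul_opt (Some p)) (pmul_opt _ (Some r)) /=.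
by congr pbase_opt; exact: pcatA.
Qed.

Lemma pmul1f : left_id pone pmul.
Proof.
move=> f; apply: (pathalg_ind (F := pmul pone) (G := id)) f => //.
  exact: pmul_linearr.
move=> p; rewrite /pone.
pose L : {linear pathalg -> pathalg} :=
  HB.pack (pmul^~ (pbase p)) (GRing.isLinear.Build _ _ _ _ _ (pmul_linearl (pbase p))).
rewrite -[LHS]/(L _) raddf_sum (bigD1 (ptgt p)) //= pmulUU pcat1p eqxx.
rewrite big1 ?addr0 // => v nv.
by rewrite pmulUU pcat1p (negPf nv).
Qed.

Lemma pmulf1 : right_id pone pmul.
Proof.
move=> f; apply: (pathalg_ind (F := pmul^~ pone) (G := id)) f => //.
  exact: pmul_linearl.
move=> p; rewrite /pone.
pose L : {linear pathalg -> pathalg} :=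
  HB.pack (pmul (pbase p)) (GRing.isLinear.Build _ _ _ _ _ (pmul_linearr (pbase p))).
rewrite -[LHS]/(L _) raddf_sum (bigD1 (psrc p)) //= pmulUU pcatp1 eqxx.
rewrite big1 ?addr0 // => v nv.
by rewrite pmulUU pcatp1 eq_sym (negPf nv).
Qed.

Lemma pmulDl : left_distributive pmul +%R.
Proof.
by move=> f g h; have := pmul_linearl h 1 f g; rewrite !scale1r.
Qed.

Lemma pmulDr : right_distributive pmul +%R.
Proof.
by move=> h f g; have := pmul_linearr h 1 f g; rewrite !scale1r.
Qed.

HB.instance Definition _ := GRing.Zmodule_isPzRing.Build pathalg
  pmulA pmul1f pmulf1 pmulDl pmulDr.

Definition arr (a : Q1 Q) : pathalg := pbase (patha a).

End PathAlgebra.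

Section BoundQuiver.
Variables (k : fieldType) (Q : quiver).
Implicit Types I J S : set (pathalg k Q).

Definition is_ideal I : Prop :=
  [/\ I 0, forall x y, I x -> I y -> I (x + y)
    & forall x y, I x -> I (y * x) /\ I (x * y)].

Definition ideal_gen S : set (pathalg k Q) :=
  [set x | forall J, is_ideal J -> (S `<=` J)%classic -> J x]%classic.

(* the m-th power of the arrow ideal *)
Definition arrow_ideal_pow (m : nat) : set (pathalg k Q) :=
  ideal_gen [set pbase k p | p in [set p : qpath Q | size (parr p) = m]]%classic.

Definition admissible I : Prop :=
  is_ideal I /\
  exists2 m, (2 <= m)%N &
    (arrow_ideal_pow m `<=` I)%classic /\ (I `<=` arrow_ideal_pow 2)%classic.

Definition gen_by_length_two I : Prop :=
  exists2 R : set (qpath Q), (forall p, R p -> size (parr p) = 2%N) &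
    I = ideal_gen [set pbase k p | p in R]%classic.

Definition adjacent : rel (Q0 Q) :=
  fun i j => [exists a, ((qs a == i) && (qt a == j)) || ((qs a == j) && (qt a == i))].

Definition connected_quiver : Prop := forall i j : Q0 Q, connect adjacent i j.

(* In the clauses below arr a * arr b is the product in kQ; it vanishes, hence
   belongs to I, when a and b are not composable. *)
Definition gentle I : Prop :=
  (connected_quiver /\ (0 < #|Q1 Q|)%N) /\
  (admissible I /\ gen_by_length_two I) /\
  (forall v : Q0 Q, (#|[set a : Q1 Q | qs a == v]| <= 2)%N /\
                    (#|[set a : Q1 Q | qt a == v]| <= 2)%N) /\
  (forall b a a' : Q1 Q,
     ~ I (arr k a * arr k b) -> ~ I (arr k a' * arr k b) -> a = a') /\
  (forall b c c' : Q1 Q,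
     ~ I (arr k b * arr k c) -> ~ I (arr k b * arr k c') -> c = c') /\
  (forall b a a' : Q1 Q,
     arr k a * arr k b <> 0 -> I (arr k a * arr k b) ->
     arr k a' * arr k b <> 0 -> I (arr k a' * arr k b) -> a = a') /\
  (forall b c c' : Q1 Q,
     arr k b * arr k c <> 0 -> I (arr k b * arr k c) ->
     arr k b * arr k c' <> 0 -> I (arr k b * arr k c') -> c = c').

Definition one_cycle : Prop := #|Q1 Q|%:Z - #|Q0 Q|%:Z + 1 = 1.

(* (a, false) is the letter a and (a, true) is the letter a^-1. *)
Definition letter : Type := (Q1 Q * bool)%type.
Definition letter_src (x : letter) : Q0 Q := if x.2 then qt x.1 else qs x.1.
Definition letter_tgt (x : letter) : Q0 Q := if x.2 then qs x.1 else qt x.1.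
Definition letter_inv (x : letter) : letter := (x.1, ~~ x.2).

Definition walk_inv (w : seq letter) : seq letter := rev (map letter_inv w).

Definition closed_walk (w : seq letter) : bool :=
  cycle (fun x y => letter_src x == letter_tgt y) w.

Definition no_repeated_edge (w : seq letter) : bool := uniq [seq x.1 | x <- w].

(* zip w (rot 1 w) lists the pairs of consecutive letters of w = x_1 ... x_l
   together with the pair (x_l, x_1). *)
Definition nr_direct I (w : seq letter) : nat :=
  #|[set p : Q1 Q * Q1 Q |
      [&& qs p.1 == qt p.2, `[< I (arr k p.1 * arr k p.2) >] &
          ((p.1, false), (p.2, false)) \in zip w (rot 1 w)]]|.

Definition nr I (w : seq letter) : nat :=
  (nr_direct I w + nr_direct I (walk_inv w))%N.

Definition multi_clock I : Prop :=
  forall w : seq letter, w <> [::] -> closed_walk w -> no_repeated_edge w ->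
    ~~ odd (nr I w).

Definition nabla I : nat := if `[< multi_clock I >] then 1%N else 0%N.

(* pi induces an isomorphism of k-algebras kQ/I -> A. *)
Definition presents I (A : algType k) (pi : {rmorphism pathalg k Q -> A}) : Prop :=
  [/\ scalable pi, forall a, exists x, pi x = a & forall x, pi x = 0 <-> I x].

End BoundQuiver.

Section Perfect.
Variables (k : fieldType) (A : algType k).

(* Finite-dimensional right A-modules: row spaces k^n on which a acts by
   v |-> v *m mact a. *)
Record fdmod := Fdmod {
  mdim :> nat;
  mact : A -> 'M[k]_mdim;
  mact_linear : linear mact;
  mact1 : mact 1 = 1%:M;
  mactM : forall a b, mact (a * b) = mact a *m mact b }.

Definition is_hom (M N : fdmod) (F : 'M[k]_(M, N)) : Prop :=
  forall a, mact M a *m F = F *m mact N a.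

Definition projective (P : fdmod) : Prop :=
  forall (M N : fdmod) (g : 'M[k]_(M, N)) (f : 'M[k]_(P, N)),
    is_hom g -> is_hom f -> row_full g ->
    exists2 h : 'M[k]_(P, M), is_hom h & h *m g = f.

(* Bounded cochain complexes.  Graded maps are given by all their components
   X i -> Y j, those outside the prescribed degree being zero. *)
Record cplx := Cplx {
  cobj :> int -> fdmod;
  cdiff : forall i j, 'M[k]_(cobj i, cobj j);
  cdiff_hom : forall i j, is_hom (cdiff i j);
  cdiff_deg : forall i j, j != i + 1 -> cdiff i j = 0;
  cdiff_sq : forall i j l, cdiff i j *m cdiff j l = 0;
  cbounded : exists N : nat, forall i, (N < `|i|)%N -> cobj i = 0%N :> nat }.

Record chmap (X Y : cplx) := Chmap {
  cmor :> forall i j, 'M[k]_(X i, Y j);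
  cmor_hom : forall i j, is_hom (cmor i j);
  cmor_deg : forall i j, j != i -> cmor i j = 0;
  cmor_comm : forall i j, cdiff X i j *m cmor j j = cmor i i *m cdiff Y i j }.

Lemma is_hom0 (M N : fdmod) : is_hom (0 : 'M[k]_(M, N)).
Proof. by move=> a; rewrite mulmx0 mul0mx. Qed.

Lemma is_homZD (M N : fdmod) c (F G : 'M[k]_(M, N)) :
  is_hom F -> is_hom G -> is_hom (c *: F + G).
Proof.
by move=> hF hG a; rewrite mulmxDr mulmxDl -scalemxAr -scalemxAl hF hG.
Qed.

Lemma is_homZ (M N : fdmod) c (F : 'M[k]_(M, N)) : is_hom F -> is_hom (c *: F).
Proof. by move=> hF; rewrite -[_ *: F]addr0; apply: is_homZD; last exact: is_hom0. Qed.

Lemma is_hom_sum (T : Type) (r : seq T) (M N : fdmod) (F : T -> 'M[k]_(M, N)) :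
  (forall i, is_hom (F i)) -> is_hom (\sum_(i <- r) F i).
Proof.
by move=> hF a; rewrite mulmx_sumr mulmx_suml; apply: eq_bigr => i _; exact: hF.
Qed.

Lemma is_homM (M N P : fdmod) (F : 'M[k]_(M, N)) (G : 'M[k]_(N, P)) :
  is_hom F -> is_hom G -> is_hom (F *m G).
Proof. by move=> hF hG a; rewrite mulmxA hF -mulmxA hG mulmxA. Qed.

Section Comp.
Variables (X Y Z : cplx) (f : chmap X Y) (g : chmap Y Z).

Definition chcomp_mor i j : 'M[k]_(X i, Z j) := f i i *m g i j.

Lemma chcomp_hom i j : is_hom (chcomp_mor i j).
Proof. by apply: is_homM; exact: cmor_hom. Qed.

Lemma chcomp_deg i j : j != i -> chcomp_mor i j = 0.
Proof. by move=> ij; rewrite /chcomp_mor (cmor_deg g ij) mulmx0. Qed.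

Lemma chcomp_comm i j :
  cdiff X i j *m chcomp_mor j j = chcomp_mor i i *m cdiff Z i j.
Proof. by rewrite /chcomp_mor mulmxA cmor_comm -!mulmxA cmor_comm. Qed.

Definition chcomp : chmap X Z := Chmap chcomp_hom chcomp_deg chcomp_comm.
End Comp.

Section Lin.
Variables (X Y : cplx) (n : nat) (c : 'rV[k]_n) (f : 'I_n -> chmap X Y).

Definition chlin_mor i j : 'M[k]_(X i, Y j) := \sum_(l < n) c 0 l *: f l i j.

Lemma chlin_hom i j : is_hom (chlin_mor i j).
Proof. by apply: is_hom_sum => l; apply: is_homZ; exact: cmor_hom. Qed.

Lemma chlin_deg i j : j != i -> chlin_mor i j = 0.
Proof.
by move=> ij; apply: big1 => l _; rewrite (cmor_deg (f l) ij) scaler0.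
Qed.

Lemma chlin_comm i j :
  cdiff X i j *m chlin_mor j j = chlin_mor i i *m cdiff Y i j.
Proof.
rewrite /chlin_mor mulmx_sumr mulmx_suml; apply: eq_bigr => l _.
by rewrite -scalemxAr -scalemxAl cmor_comm.
Qed.

Definition chlin : chmap X Y := Chmap chlin_hom chlin_deg chlin_comm.
End Lin.

Section Shift.
Variables (X : cplx) (n : int).

Definition shift_diff (i j : int) : 'M[k]_(X (i + n), X (j + n)) :=
  (-1) ^+ `|n|%N *: cdiff X (i + n) (j + n).

Lemma shift_hom i j : is_hom (shift_diff i j).
Proof. by apply: is_homZ; exact: cdiff_hom. Qed.

Lemma shift_deg i j : j != i + 1 -> shift_diff i j = 0.
Proof.
move=> ij; rewrite /shift_diff cdiff_deg ?scaler0 //.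
by apply: contraNneq ij; rewrite addrAC => /addIr ->.
Qed.

Lemma shift_sq i j l : shift_diff i j *m shift_diff j l = 0.
Proof. by rewrite -scalemxAl -scalemxAr cdiff_sq !scaler0. Qed.

Lemma shift_bounded :
  exists N : nat, forall i, (N < `|i|)%N -> X (i + n) = 0%N :> nat.
Proof.
have [N HN] := cbounded X; by exists (N + `|n|)%N => i lt; apply: HN; lia.
Qed.

Definition shift : cplx := Cplx shift_hom shift_deg shift_sq shift_bounded.
End Shift.

Section DirectSum.
Variables M N : fdmod.

Definition dsum_act (a : A) : 'M[k]_(M + N) :=
  block_mx (mact M a) 0 0 (mact N a).

Lemma dsum_linear : linear dsum_act.
Proof.
move=> c a b; rewrite /dsum_act !mact_linear scale_block_mx add_block_mx.
by rewrite !scaler0 !addr0.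
Qed.

Lemma dsum1 : dsum_act 1 = 1%:M.
Proof. by rewrite /dsum_act !mact1 -scalar_mx_block. Qed.

Lemma dsumM a b : dsum_act (a * b) = dsum_act a *m dsum_act b.
Proof.
by rewrite /dsum_act mulmx_block !mactM !mulmx0 !mul0mx !addr0 !add0r.
Qed.

Definition dsum : fdmod := Fdmod dsum_linear dsum1 dsumM.
End DirectSum.

(* In degree i the cone of f : X -> Y is X^(i+1) (+) Y^i with differential
   (x, y) |-> (- d x, f x + d y). *)
Section Cone.
Variables (X Y : cplx) (f : chmap X Y).

Definition cone_obj (i : int) : fdmod := dsum (X (i + 1)) (Y i).

Definition cone_diff (i j : int) : 'M[k]_(cone_obj i, cone_obj j) :=
  block_mx (- cdiff X (i + 1) (j + 1)) (f (i + 1) j) 0 (cdiff Y i j).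

Lemma cone_hom i j : is_hom (cone_diff i j).
Proof.
move=> a; rewrite /= /dsum_act /cone_diff !mulmx_block.
rewrite !mulmx0 !mul0mx !addr0 !add0r mulmxN mulNmx.
by rewrite (cdiff_hom X) (cmor_hom f) (cdiff_hom Y).
Qed.

Lemma cone_deg i j : j != i + 1 -> cone_diff i j = 0.
Proof.
move=> ij; rewrite /cone_diff (cdiff_deg Y ij) (cmor_deg f ij) cdiff_deg.
  by rewrite oppr0 block_mx0.
by apply: contraNneq ij => /addIr ->.
Qed.

Lemma cone_sq i j l : cone_diff i j *m cone_diff j l = 0.
Proof.
rewrite /cone_diff mulmx_block mulNmx mulmxN !mul0mx !mulmx0.
rewrite !cdiff_sq !addr0 !oppr0 ?add0r.
suff -> : - cdiff X (i + 1) (j + 1) *m f (j + 1) l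
          + f (i + 1) j *m cdiff Y j l = 0 by rewrite block_mx0.
have [-> | ij] := eqVneq j (i + 1); last first.
  rewrite (cmor_deg f ij) mul0mx addr0 cdiff_deg ?oppr0 ?mul0mx //.
  by apply: contraNneq ij => /addIr ->.
have [-> | jl] := eqVneq l (i + 1 + 1); last first.
  by rewrite (cmor_deg f jl) (cdiff_deg Y jl) !mulmx0 addr0.
by rewrite mulNmx cmor_comm addNr.
Qed.

Lemma cone_bounded :
  exists N : nat, forall i, (N < `|i|)%N -> cone_obj i = 0%N :> nat.
Proof.
have [N HN] := shift_bounded X 1; have [N' HN'] := cbounded Y.
exists (maxn N N') => i; rewrite gtn_max => /andP[lt lt'].
by rewrite /= HN ?HN'.
Qed.

Definition cone : cplx := Cplx cone_hom cone_deg cone_sq cone_bounded.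
End Cone.

Definition homotopic (X Y : cplx) (f g : chmap X Y) : Prop :=
  exists2 h : forall i j, 'M[k]_(X i, Y j), (forall i j, is_hom (h i j)) &
    forall i, f i i - g i i =
      cdiff X i (i + 1) *m h (i + 1) i + h i (i - 1) *m cdiff Y (i - 1) i.

(* Isomorphism on cohomology: the two clauses are injectivity and surjectivity
   of H^i(f). *)
Definition quasi_iso (X Y : cplx) (f : chmap X Y) : Prop :=
  forall i,
    (forall v : 'rV[k]_(X i), v *m cdiff X i (i + 1) = 0 ->
       (v *m f i i <= cdiff Y (i - 1) i)%MS -> (v <= cdiff X (i - 1) i)%MS) /\
    (forall w : 'rV[k]_(Y i), w *m cdiff Y i (i + 1) = 0 ->
       exists2 v : 'rV[k]_(X i), v *m cdiff X i (i + 1) = 0 &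
         (w - v *m f i i <= cdiff Y (i - 1) i)%MS).

(* Morphisms X -> Y of the bounded derived category are classes of roofs
   X <-s- W -f-> Y with s a quasi-isomorphism; roof_eq s f s' f' says that the
   two roofs define the same morphism f s^-1 = f' s'^-1. *)
Definition roof_eq (X Y W W' : cplx) (s : chmap W X) (f : chmap W Y)
    (s' : chmap W' X) (f' : chmap W' Y) : Prop :=
  exists (V : cplx) (u : chmap V W) (u' : chmap V W'),
    [/\ quasi_iso (chcomp u s), homotopic (chcomp u s) (chcomp u' s')
      & homotopic (chcomp u f) (chcomp u' f')].

(* dim_k Hom_{D^b(A)}(X, Y) = n.  Finitely many morphisms have a common
   denominator s, so a basis may be taken of the form f_l s^-1. *)
Definition derived_hom_has_dim (X Y : cplx) (n : nat) : Prop :=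
  exists (W : cplx) (s : chmap W X) (f : 'I_n -> chmap W Y),
    quasi_iso s /\
    forall (W' : cplx) (s' : chmap W' X) (g : chmap W' Y), quasi_iso s' ->
      exists! c : 'rV[k]_n, roof_eq s' g s (chlin c f).

Definition derived_hom_dim (X Y : cplx) : nat :=
  xget 0%N [set n | derived_hom_has_dim X Y n]%classic.

Definition derived_iso (X Y : cplx) : Prop :=
  exists (W : cplx) (s : chmap W X) (t : chmap W Y), quasi_iso s /\ quasi_iso t.

(* X, Y, Z are the objects of a distinguished triangle X -> Y -> Z -> X[1]. *)
Definition triangle (X Y Z : cplx) : Prop :=
  exists (X' Y' : cplx) (f : chmap X' Y'),
    [/\ derived_iso X X', derived_iso Y Y' & derived_iso Z (cone f)].

Definition perfect (X : cplx) : Prop :=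
  exists2 P : cplx, (forall i, projective (P i)) & derived_iso X P.

Record perf := Perf { perf_cplx :> cplx; perfP : perfect perf_cplx }.

HB.instance Definition _ := gen_eqMixin perf.
HB.instance Definition _ := gen_choiceMixin perf.

(* K_0(per A): the free abelian group on perfect complexes modulo the subgroup
   generated by [Y] - [X] - [Z] for the distinguished triangles. *)
Definition K0_relations : pred {malg int[perf]} := fun x =>
  `[< forall S : pred {malg int[perf]}, zmod_closed S ->
        (forall X Y Z : perf, triangle X Y Z -> S (<< Y >> - << X >> - << Z >>)) ->
        S x >].

Lemma K0_relations_closed : zmod_closed K0_relations.
Proof.
split=> [|x y /asboolP Hx /asboolP Hy]; apply/asboolP => S zS HS.
  by case: zS.
by case: (zS) => _; apply; [exact: Hx | exact: Hy].
Qed.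

HB.instance Definition _ :=
  GRing.isZmodClosed.Build {malg int[perf]} K0_relations K0_relations_closed.

Definition K0 : zmodType :=
  Quotient.quot (GRing.ZmodClosed.clone {malg int[perf]} K0_relations _).

Definition euler_perf (X Y : perf) : int :=
  (\sum_(i \in [set: int]) (-1) ^+ `|i|%N * (derived_hom_dim X (shift Y i))%:Z)%R.

Definition euler_free (x y : {malg int[perf]}) : int :=
  \sum_(X <- msupp x) \sum_(Y <- msupp y) x@_X * y@_Y * euler_perf X Y.

(* Computed on representatives: euler_free is biadditive and vanishes as soon as
   one argument lies in K0_relations. *)
Definition euler_form (x y : K0) : int := euler_free (repr x) (repr y).

Definition q_form (x : K0) : int := euler_form x x.

Definition polar (x y : K0) : int := q_form (x + y) - q_form x - q_form y.

Definition K0_basis (n : nat) (b : 'I_n -> K0) : Prop :=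
  forall x, exists! c : 'rV[int]_n, x = \sum_(i < n) b i *~ c 0 i.

Definition gram (n : nat) (b : 'I_n -> K0) : 'M[rat]_n :=
  \matrix_(i, j) (polar (b i) (b j))%:~R.

(* Bases exist, and the Gram matrix in any of them has null space of rank c. *)
Definition corank_eq (c : nat) : Prop :=
  (exists (n : nat) (b : 'I_n -> K0), K0_basis b) /\
  forall (n : nat) (b : 'I_n -> K0), K0_basis b -> \rank (kermx (gram b)) = c.

End Perfect.

(* Main.v *)
(** The classes of the indecomposable projectives P_v form a basis of K_0(per A):
    they generate it, because a bounded complex of projectives can be peeled off one
    summand P_v at a time, and they are independent, because pairing with the
    simple modules gives dual coordinates.  As Hom(P_v, P_w) has the nonzero paths
    from v to w as a basis, the Euler form becomes the Cartan form, for any global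
    dimension.

    In a gentle quiver the arrow ends at each vertex fall into two classes
    (passages) such that two composable arrows have a nonzero product iff they meet
    in the same class.  For x : Q_0 -> rat let y_b be the sum of x over the sources
    of the nonzero paths ending with b; then y_b = x_v + y_a, where v is the
    source of b and a the arrow (if any) entering the passage which b leaves.
    Telescoping these equations gives

      2 q(x) = sum of (x_v + y_a)^2 over the passages that no arrow leaves,

    whence nonnegativity.  The kernel consists of the x for which all these terms
    vanish, and x |-> y identifies it with the kernel of the incidence
    matrix of the graph Q signed by the passages.  When |Q_0| = |Q_1| this matrix is
    square, so the corank is the dimension of the space of potentials
    (s_v = +-s_w along each edge), which for connected Q is 1 if the signed graph is
    balanced and 0 otherwise; and a signed graph is balanced iff every closed
    walk has positive sign, which is the multi-clock condition. *)

Require Import Defs.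
From HB Require Import structures.
From mathcomp Require Import all_boot all_order all_algebra.
From mathcomp Require Import zify ring lra.
From mathcomp Require Import generic_quotient ring_quotient finmap monalg boolp classical_sets fsbigop.

Set Implicit Arguments.
Unset Strict Implicit.
Unset Printing Implicit Defensive.

Import Order.TTheory GRing.Theory Num.Theory.
Local Open Scope ring_scope.

(** * Dimensions of subquotients *)

(** The number [derived_hom_dim] is singled out by a property of roofs, so nothing can be computed
    from it before existence and uniqueness are known. Replacing the first argument by a bounded
    complex P of projectives removes the roofs: maps out of P lift through quasi-isomorphisms,
    uniquely up to homotopy, so derived morphisms become homotopy classes of chain maps. These are
    the cohomology of the Hom complex, whose alternating dimension depends only on the terms of the
    two complexes. That makes the form additive on triangles in both arguments, hence well defined
    on K_0. On the combinatorial side the Cartan matrix need not be invertible when the global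
    dimension is infinite. Its inverse is replaced by the recursion for y: admissibility bounds the
    length of nonzero paths, so the recursion determines y from x, and on the kernel x is recovered
    from y as a net outflow. *)

Section RelativeDimension.
Variable k : fieldType.
Implicit Types V W : lmodType k.

Definition is_subspace V (S : V -> Prop) : Prop :=
  S 0 /\ forall c x y, S x -> S y -> S (c *: x + y).

Definition lincomb V n (c : 'rV[k]_n) (f : 'I_n -> V) : V :=
  \sum_(i < n) c 0 i *: f i.

(* Z/(B :&: Z) has dimension n: dimensions are handled as relations, since the
   spaces involved are not known in advance to be finite dimensional. *)
Definition reldim V (Z B : V -> Prop) (n : nat) : Prop :=
  exists f : 'I_n -> V,
    [/\ forall i, Z (f i),
        forall z, Z z -> exists c, B (z - lincomb c f)
      & forall c, B (lincomb c f) -> c = 0].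

Section Subspace.
Variables (V : lmodType k) (S : V -> Prop).
Hypothesis hS : is_subspace S.

Lemma subspace0 : S 0. Proof. by case: hS. Qed.

Lemma subspaceZ c x : S x -> S (c *: x).
Proof. by case: hS => s0 sl sx; rewrite -[_ *: _]addr0; apply: sl. Qed.

Lemma subspaceD x y : S x -> S y -> S (x + y).
Proof. by case: hS => s0 sl sx sy; rewrite -[x]scale1r; apply: sl. Qed.

Lemma subspaceN x : S x -> S (- x).
Proof. by move=> sx; rewrite -scaleN1r; apply: subspaceZ. Qed.

Lemma subspaceB x y : S x -> S y -> S (x - y).
Proof. by move=> sx sy; apply: subspaceD => //; apply: subspaceN. Qed.

Lemma subspace_sum (J : Type) (r : seq J) (F : J -> V) :
  (forall i, S (F i)) -> S (\sum_(i <- r) F i).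
Proof.
move=> h; elim/big_rec: _ => [|i x _ sx]; first exact: subspace0.
exact: subspaceD.
Qed.

Lemma subspace_lincomb n (c : 'rV_n) f : (forall i, S (f i)) -> S (lincomb c f).
Proof. by move=> h; apply: subspace_sum => i; apply: subspaceZ. Qed.

End Subspace.

Lemma lincombP V n a (c d : 'rV_n) (f : 'I_n -> V) :
  lincomb (a *: c + d) f = a *: lincomb c f + lincomb d f.
Proof.
rewrite /lincomb scaler_sumr -big_split; apply: eq_bigr => i _ /=.
by rewrite !mxE scalerDl scalerA.
Qed.

Lemma lincombB V n (c d : 'rV_n) (f : 'I_n -> V) :
  lincomb (c - d) f = lincomb c f - lincomb d f.
Proof. by rewrite addrC -(scaleN1r d) lincombP scaleN1r addrC. Qed.

Lemma lincomb0 V n (f : 'I_n -> V) : lincomb 0 f = 0.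
Proof. by apply: big1 => i _; rewrite mxE scale0r. Qed.

Lemma lincomb_mul V n m (c : 'rV_n) (N : 'M_(n, m)) (g : 'I_m -> V) :
  lincomb (c *m N) g = lincomb c (fun i => lincomb (row i N) g).
Proof.
rewrite /lincomb; under [RHS]eq_bigr do rewrite scaler_sumr.
rewrite exchange_big /=; apply: eq_bigr => j _.
rewrite mxE scaler_suml; apply: eq_bigr => i _.
by rewrite !mxE scalerA.
Qed.

Lemma lincomb_row V n m (c : 'rV_n) (d : 'rV_m) (f : 'I_n -> V) (g : 'I_m -> V) :
  lincomb (row_mx c d) (fun i => match split i with inl a => f a | inr b => g b end)
  = lincomb c f + lincomb d g.
Proof.
rewrite /lincomb big_split_ord /=; congr (_ + _); apply: eq_bigr => i _.
  by rewrite row_mxEl (unsplitK (inl i)).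
by rewrite row_mxEr (unsplitK (inr i)).
Qed.

Lemma subspace_lincombB V (B : V -> Prop) n (c : 'rV_n) f g :
  is_subspace B -> (forall i, B (f i - g i)) -> B (lincomb c f - lincomb c g).
Proof.
move=> hB h; rewrite /lincomb -sumrB; apply: (subspace_sum hB) => i.
by rewrite -scalerBr; apply: (subspaceZ hB).
Qed.

(** A row in the left kernel of the coefficient matrix of f over g yields a combination of f lying
    in B, hence is zero; so this matrix is row free and has at least n columns. *)
Lemma indep_le_span V (B : V -> Prop) n m (f : 'I_n -> V) (g : 'I_m -> V) :
  is_subspace B -> (forall c, B (lincomb c f) -> c = 0) ->
  (forall i, exists c, B (f i - lincomb c g)) -> (n <= m)%N.
Proof.
move=> hB indep /choice[N hN].
pose M := \matrix_i N i.
suff : row_free M by move=> /eqP <-; apply: rank_leq_col.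
rewrite -kermx_eq0; apply/eqP/row_matrixP => i; rewrite row0.
apply: indep; rewrite -[lincomb _ _](subrK (lincomb (row i (kermx M) *m M) g)).
apply: (subspaceD hB); last by rewrite -row_mul mulmx_ker row0 lincomb0; case: hB.
rewrite lincomb_mul; apply: subspace_lincombB => // j.
by rewrite rowK.
Qed.

Lemma reldim_unique V (Z B : V -> Prop) n m :
  is_subspace B -> reldim Z B n -> reldim Z B m -> n = m.
Proof.
move=> hB [f [zf sf uf]] [g [zg sg ug]]; apply/eqP; rewrite eqn_leq.
apply/andP; split.
  by apply: (indep_le_span (g := g) hB uf) => i; apply: sg.
by apply: (indep_le_span (g := f) hB ug) => i; apply: sf.
Qed.

(** A longest family in Z that is independent modulo B spans Z modulo B, since any vector outside
    its span could be added to it. *)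
Lemma reldim_ex V (Z B : V -> Prop) (m : nat) :
  is_subspace Z -> is_subspace B ->
  (forall n (f : 'I_n -> V), (forall i, Z (f i)) ->
     (forall c, B (lincomb c f) -> c = 0) -> (n <= m)%N) ->
  exists n, reldim Z B n.
Proof.
move=> hZ hB bnd.
pose P n := `[< exists f : 'I_n -> V, (forall i, Z (f i)) /\
                 (forall c, B (lincomb c f) -> c = 0) >].
have exP : exists n, P n.
  exists 0%N; apply/asboolP; exists (fun _ => 0); split=> [i|c _].
    by case: hZ.
  by apply/rowP; case.
have bP n : P n -> (n <= m)%N by move=> /asboolP[f [zf uf]]; apply: (bnd _ f).
case: (ex_maxnP exP bP) => n /asboolP[f [zf uf]] maxn.
exists n, f; split=> // z zz; apply: contrapT => nspan.
have : P (1 + n)%N; last by move/maxn; rewrite add1n ltnn.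
apply/asboolP; exists (fun i => match split i with inl a => z | inr b => f b end).
split=> [i|c]; first by case: split.
rewrite -[c]hsubmxK; move: (lsubmx c) (rsubmx c) => a d {c}.
rewrite (lincomb_row a d (fun=> z) f) => Bc.
have a0 : a = 0.
  apply/rowP => i; rewrite mxE ord1; apply: contrapT => /eqP na.
  (* The relation saying that a z + d f lies in B is solved for z. *)
  apply: nspan; exists (- (a 0 0)^-1 *: d).
  rewrite -[_ *: d]addr0 lincombP lincomb0 addr0 scaleNr opprK.
  move: Bc; rewrite {1}/lincomb big_ord1 => /(subspaceZ hB (a 0 0)^-1).
  by rewrite scalerDr scalerA mulVf // scale1r.
move: Bc; rewrite a0 lincomb0 add0r => /uf ->.
by rewrite row_mx0.
Qed.

Lemma reldim_sub V (Z Y B : V -> Prop) n :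
  is_subspace Y -> is_subspace B -> (forall x, Y x -> Z x) ->
  reldim Z B n -> exists m, reldim Y B m.
Proof.
move=> hY hB YZ [g [_ sg _]]; apply: (reldim_ex (m := n)) => // l f yf uf.
by apply: (indep_le_span (g := g) hB uf) => i; apply/sg/YZ.
Qed.

Lemma reldim_quo V (Z Y B : V -> Prop) n :
  is_subspace Z -> is_subspace Y -> is_subspace B -> (forall x, B x -> Y x) ->
  reldim Z B n -> exists m, reldim Z Y m.
Proof.
move=> hZ hY hB BY [g [_ sg _]]; apply: (reldim_ex (m := n)) => // l f zf uf.
apply: (indep_le_span (g := g) hY uf) => i.
by have [c hc] := sg _ (zf i); exists c; apply: BY.
Qed.

Lemma reldim_add V (Z Y B : V -> Prop) n m :
  is_subspace Y -> is_subspace B -> (forall x, B x -> Y x) ->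
  (forall x, Y x -> Z x) ->
  reldim Z Y n -> reldim Y B m -> reldim Z B (n + m).
Proof.
move=> hY hB BY YZ [f [zf sf uf]] [g [yg sg ug]].
exists (fun i => match split i with inl a => f a | inr b => g b end); split.
- by move=> i; case: split => // j; apply: YZ.
- move=> z /sf[c /sg[d]]; exists (row_mx c d).
  by rewrite lincomb_row opprD addrA.
- move=> c; rewrite -[c]hsubmxK; move: (lsubmx c) (rsubmx c) => a d {c}.
  rewrite lincomb_row => h.
  have a0 : a = 0.
    apply: uf; rewrite -[lincomb a f](addrK (lincomb d g)).
    by apply: (subspaceB hY); [exact: BY | exact: subspace_lincomb].
  by move: h; rewrite a0 lincomb0 add0r => /ug ->; rewrite row_mx0.
Qed.

Lemma linear_lincomb V W (F : {linear V -> W}) n (c : 'rV_n) f :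
  F (lincomb c f) = lincomb c (fun i => F (f i)).
Proof. by rewrite /lincomb linear_sum; apply: eq_bigr => i _; rewrite linearZ_LR. Qed.

(** The hypotheses say that F induces an isomorphism from Z modulo B onto Z' modulo B': the
    equivalence gives well-definedness and injectivity, the last clause surjectivity. Most
    comparisons of dimensions below have this form. *)
Lemma reldim_transfer V W (F : {linear V -> W}) (Z B : V -> Prop)
    (Z' B' : W -> Prop) n :
  is_subspace Z -> is_subspace B' ->
  (forall z, Z z -> Z' (F z)) ->
  (forall z, Z z -> B z <-> B' (F z)) ->
  (forall w, Z' w -> exists2 z, Z z & B' (w - F z)) ->
  reldim Z B n -> reldim Z' B' n.
Proof.
move=> hZ hB' ZZ' BB' sF [f [zf sf uf]].
exists (fun i => F (f i)); split=> [i|w /sF[z zz Bz]|c].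
- exact: ZZ'.
- have [c Bc] := sf _ zz; exists c.
  rewrite -linear_lincomb -[w](subrK (F z)) -addrA -raddfB.
  apply: (subspaceD hB') => //; apply/BB' => //.
  by apply: (subspaceB hZ) => //; apply: subspace_lincomb.
- rewrite -linear_lincomb => h; apply: uf; apply/BB' => //.
  exact: subspace_lincomb.
Qed.

Lemma reldim_ext V (Z B Z' B' : V -> Prop) n :
  (forall z, Z z <-> Z' z) -> (forall z, B z <-> B' z) ->
  reldim Z B n -> reldim Z' B' n.
Proof.
move=> hz hb [f [zf sf uf]]; exists f; split=> [i|z /hz/sf[c /hb]|c /hb] //.
- exact/hz.
- by exists c.
- exact: uf.
Qed.

Lemma reldim_refl V (Z B : V -> Prop) :
  (forall z, Z z -> B z) -> reldim Z B 0.
Proof.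
move=> h; exists (fun _ => 0); split=> [[]//|z zz|c _]; last by apply/rowP; case.
by exists 0; rewrite lincomb0 subr0; apply: h.
Qed.

Lemma subspace_eq0 V : is_subspace (fun x : V => x = 0).
Proof. by split=> // c x y -> ->; rewrite scaler0 addr0. Qed.

Lemma reldim_rV n : reldim (fun _ : 'rV[k]_n => True) (fun x => x = 0) n.
Proof.
exists (fun i => delta_mx 0 i); have e (c : 'rV_n) : lincomb c (fun i => delta_mx 0 i) = c.
  by rewrite /lincomb -row_sum_delta.
by split=> // [z _|c]; [exists z; rewrite e subrr | rewrite e].
Qed.

Lemma reldim_rowspace n m (B : 'M[k]_(m, n)) :
  reldim (fun x : 'rV_n => (x <= B)%MS) (fun x => x = 0) (\rank B).
Proof.
pose F (x : 'rV[k]_(\rank B)) := x *m row_base B.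
have lF : linear F by move=> c x y; rewrite /F mulmxDl scalemxAl.
pose F' : {linear _ -> _} := HB.pack F (GRing.isLinear.Build _ _ _ _ F lF).
apply: (reldim_transfer (F := F')) (reldim_rV _) => //.
- exact: subspace_eq0.
- by move=> z _; rewrite /= /F (submx_trans (submxMl _ _)) ?eq_row_base.
- move=> z _; split=> [->|]; first by rewrite linear0.
  by rewrite /= /F => /eqP; rewrite mulmx_free_eq0 ?row_base_free // => /eqP.
- move=> w; rewrite -(eq_row_base B) => /submxP[z ->].
  by exists z => //; rewrite /= /F subrr.
Qed.

Lemma reldim_kermx n m (A : 'M[k]_(n, m)) :
  reldim (fun x : 'rV_n => x *m A = 0) (fun x => x = 0) (\rank (kermx A)).
Proof.
apply: reldim_ext (reldim_rowspace (kermx A)) => // x.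
by split=> [/sub_kermxP|h] //; apply/sub_kermxP.
Qed.

Lemma reldim_fin (n m : nat) (Z : 'M[k]_(n, m) -> Prop) :
  is_subspace Z -> exists d, reldim Z (fun x => x = 0) d.
Proof.
move=> hZ; apply: (reldim_sub (Z := fun=> True) (n := (n * m)%N)) => //.
  exact: subspace_eq0.
apply: (reldim_transfer (F := @vec_mx k n m)) (reldim_rV _) => //.
- exact: subspace_eq0.
- move=> z _; split=> [->|]; first by rewrite linear0.
  by move=> h; apply: (can_inj (@vec_mxK _ _ _)); rewrite h linear0.
- by move=> w _; exists (mxvec w) => //; rewrite /= mxvecK subrr.
Qed.

Lemma reldim_prod V W (Z : V -> Prop) (Y : W -> Prop) n m :
  Z 0 -> Y 0 -> reldim Z (fun x => x = 0) n -> reldim Y (fun y => y = 0) m ->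
  reldim (fun x : V * W => Z x.1 /\ Y x.2) (fun x => x = 0) (n + m).
Proof.
move=> Z0 Y0 [f [zf sf uf]] [g [yg sg ug]].
pose h i : V * W := match split i with inl a => (f a, 0) | inr b => (0, g b) end.
have e c d : lincomb (row_mx c d) h = (lincomb c f, lincomb d g).
  rewrite /h lincomb_row /lincomb; have z (U : lmodType k) l (u : 'rV[k]_l) : \sum_i u 0 i *: (0 : U) = 0.
    by apply: big1 => i _; rewrite scaler0.
  by congr pair; rewrite !raddf_sum /= z ?addr0 ?add0r.
exists h; split=> [i|[v w] [/= /sf[c /subr0_eq ->] /sg[d /subr0_eq ->]]|c].
- by rewrite /h; case: split => j; split=> /=.
- by exists (row_mx c d); rewrite e subrr.
- by rewrite -[c]hsubmxK e => -[/uf -> /ug ->]; rewrite row_mx0.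
Qed.

End RelativeDimension.

(** * Products of vector spaces and families of finite support *)

Section DependentProduct.
Variables (k : fieldType) (J : Type) (T : J -> lmodType k).

(** Dependent, because the components of a graded map are matrices whose sizes vary with the index;
    functions on a finite set are the constant case [fspace]. *)
Definition dprod : Type := forall j, T j.

Lemma dprod_ext (f g : dprod) : (forall j, f j = g j) -> f = g.
Proof. exact: functional_extensionality_dep. Qed.

HB.instance Definition _ := gen_eqMixin dprod.
HB.instance Definition _ := gen_choiceMixin dprod.

Let add (f g : dprod) : dprod := fun j => f j + g j.
Let opp (f : dprod) : dprod := fun j => - f j.
Let zero : dprod := fun _ => 0.
Let scale (c : k) (f : dprod) : dprod := fun j => c *: f j.

Let addA : associative add.
Proof. by move=> f g h; apply: dprod_ext => j; rewrite /add addrA. Qed.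
Let addC : commutative add.
Proof. by move=> f g; apply: dprod_ext => j; rewrite /add addrC. Qed.
Let add0 : left_id zero add.
Proof. by move=> f; apply: dprod_ext => j; rewrite /add add0r. Qed.
Let addN : left_inverse zero opp add.
Proof. by move=> f; apply: dprod_ext => j; rewrite /add /opp addNr. Qed.

HB.instance Definition _ := GRing.isZmodule.Build dprod addA addC add0 addN.

Let scaleA a b (f : dprod) : scale a (scale b f) = scale (a * b) f.
Proof. by apply: dprod_ext => j; rewrite /scale scalerA. Qed.
Let scale1 : left_id 1 scale.
Proof. by move=> f; apply: dprod_ext => j; rewrite /scale scale1r. Qed.
Let scaleDr : right_distributive scale +%R.
Proof. by move=> c f g; apply: dprod_ext => j; apply: scalerDr. Qed.
Let scaleDl (f : dprod) : {morph scale^~ f : a b / a + b}.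
Proof. by move=> a b; apply: dprod_ext => j; apply: scalerDl. Qed.

HB.instance Definition _ :=
  GRing.Zmodule_isLmodule.Build k dprod scaleA scale1 scaleDr scaleDl.

Lemma dprodP c (f g : dprod) j : (c *: f + g) j = c *: f j + g j.
Proof. by []. Qed.

Lemma dprodB (f g : dprod) j : (f - g) j = f j - g j.
Proof. by []. Qed.

Lemma dprod0 j : (0 : dprod) j = 0.
Proof. by []. Qed.

Lemma dprod_lincomb n (c : 'rV_n) (f : 'I_n -> dprod) j :
  lincomb c f j = lincomb c (fun i => f i j).
Proof.
rewrite /lincomb.
have h : {morph (fun x : dprod => x j) : x y / x + y} by [].
by rewrite (big_morph (fun x : dprod => x j) h (erefl : (0 : dprod) j = 0)).
Qed.

End DependentProduct.

Section DependentProductDim.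
Variables (k : fieldType) (J : eqType) (T : J -> lmodType k).
Variable W : forall j, T j -> Prop.
Hypothesis hW : forall j, is_subspace (@W j).
Variable d : J -> nat.
Hypothesis hd : forall j, reldim (@W j) (fun x => x = 0) (d j).

(** The subspaces [W j] will be the module homomorphisms among all matrices. *)
Definition supported (S : seq J) (f : dprod T) : Prop :=
  forall j, W (f j) /\ (j \notin S -> f j = 0).

Lemma supported_subspace S : is_subspace (supported S).
Proof.
split=> [j|c f g hf hg j]; first by split=> //; apply: subspace0.
have [wf f0] := hf j; have [wg g0] := hg j; split=> [|nj].
  by rewrite dprodP; case: (hW j) => _; apply.
by rewrite dprodP f0 // g0 // scaler0 addr0.
Qed.

(** Induction on S: modulo the families supported on the tail, evaluation at the head j is an
    isomorphism onto [W j], with inverse putting a vector at j and 0 elsewhere. *)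
Lemma reldim_supported S : uniq S ->
  reldim (supported S) (fun x => x = 0) (\sum_(j <- S) d j)%N.
Proof.
elim: S => [_|j S IHS /= /andP[njS uS]].
  rewrite big_nil; apply: reldim_refl => f hf; apply: dprod_ext => j.
  by have [_ ->] := hf j.
rewrite big_cons; apply: (reldim_add (Y := supported S)); last exact: IHS.
- exact: supported_subspace.
- exact: subspace_eq0.
- by move=> f ->; case: (supported_subspace S).
- move=> f hf i; have [wf f0] := hf i; split=> //.
  by rewrite inE negb_or => /andP[_]; apply: f0.
pose F : T j -> dprod T := @dfwith J T (fun _ => 0) j.
have Fj x : F x j = x by rewrite /F dfwith_in.
have Fi x i : j != i -> F x i = 0 by move=> h; rewrite /F dfwith_out.
have lF : linear F.
  move=> c x y; apply: dprod_ext => i; rewrite dprodP.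
  have [<-|ji] := eqVneq j i; first by rewrite !Fj.
  by rewrite !Fi // scaler0 addr0.
pose F' : {linear T j -> dprod T} := HB.pack F (GRing.isLinear.Build _ _ _ _ F lF).
have sF x : W x -> supported (j :: S) (F x).
  move=> wx i; have [<-|ji] := eqVneq j i; first by rewrite Fj inE eqxx.
  by rewrite Fi //; split=> //; apply: subspace0.
apply: (reldim_transfer (F := F')) (hd j) => //.
- exact: supported_subspace.
- move=> x wx; split=> [->|h]; first by rewrite linear0; case: (supported_subspace S).
  by have [_ /(_ njS)] := h j; rewrite /= Fj.
- move=> f hf; exists (f j); first by have [] := hf j.
  move=> i; have [wf f0] := hf i; rewrite dprodB.
  have [e|ji] := eqVneq j i.
    by move: wf f0; rewrite -e /= Fj subrr => *; split=> //; apply: subspace0.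
  by rewrite /= Fi // subr0; split=> // ni; apply: f0; rewrite inE negb_or eq_sym ji.
Qed.

End DependentProductDim.

(** * Modules and complexes *)

Section Modules.
Variables (k : fieldType) (A : algType k).
Implicit Types M N L P : fdmod A.

Lemma is_hom1 M : @is_hom k A M M 1%:M.
Proof. by move=> a; rewrite mulmx1 mul1mx. Qed.

Lemma is_homD M N (F G : 'M[k]_(M, N)) : is_hom F -> is_hom G -> is_hom (F + G).
Proof. by move=> hF hG; rewrite -[F]scale1r; apply: is_homZD. Qed.

Lemma is_homN M N (F : 'M[k]_(M, N)) : is_hom F -> is_hom (- F).
Proof. by move=> hF; rewrite -scaleN1r; apply: is_homZ. Qed.

Lemma is_homB M N (F G : 'M[k]_(M, N)) : is_hom F -> is_hom G -> is_hom (F - G).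
Proof. by move=> hF hG; apply: is_homD => //; apply: is_homN. Qed.

Lemma is_hom_subspace M N : is_subspace (fun F : 'M[k]_(M, N) => is_hom F).
Proof. by split=> [|c F G]; [exact: is_hom0 | exact: is_homZD]. Qed.

Section Submodule.
Variables (M : fdmod A) (r : nat) (B : 'M[k]_(r, M)).
Hypothesis fB : row_free B.
Hypothesis sB : forall a, (B *m mact M a <= B)%MS.

(** The action on the row space of B in coordinates with respect to its rows: [pinvmx B] solves for
    the coordinates, which exist because the row space is stable and are unique because B is row
    free. *)
Definition sub_act a := B *m mact M a *m pinvmx B.

Lemma sub_actK a : sub_act a *m B = B *m mact M a.
Proof. exact: mulmxKpV. Qed.

Lemma sub_act_linear : linear sub_act.
Proof.
by move=> c a b; rewrite /sub_act mact_linear mulmxDr mulmxDl -!(scalemxAr, scalemxAl).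
Qed.

Lemma sub_act1 : sub_act 1 = 1%:M.
Proof. by rewrite /sub_act mact1 mulmx1 mulmxVp. Qed.

Lemma sub_actM a b : sub_act (a * b) = sub_act a *m sub_act b.
Proof. by rewrite {3}/sub_act !mulmxA sub_actK /sub_act mactM !mulmxA. Qed.

Definition submodule : fdmod A := Fdmod sub_act_linear sub_act1 sub_actM.

Lemma submodule_incl : @is_hom k A submodule M B.
Proof. exact: sub_actK. Qed.

Lemma submodule_corestr N (F : 'M[k]_(N, M)) :
  is_hom F -> (F <= B)%MS -> @is_hom k A N submodule (F *m pinvmx B).
Proof.
move=> hF sF a; apply: (row_free_inj fB).
rewrite /= -[LHS]mulmxA mulmxKpV // -[RHS]mulmxA sub_actK mulmxA mulmxKpV //.
Qed.

End Submodule.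

(** [projective] speaks of surjections only, so f and g are first corestricted to the image of g,
    with basis [row_base g]. *)
Lemma projective_lift P M N (g : 'M[k]_(M, N)) (f : 'M[k]_(P, N)) :
  projective P -> is_hom g -> is_hom f -> (f <= g)%MS ->
  exists2 h : 'M[k]_(P, M), is_hom h & h *m g = f.
Proof.
move=> pP hg hf fg; pose B := row_base g.
have fB : row_free B := row_base_free g.
have gB : (g <= B)%MS by rewrite eq_row_base.
have Bg : (B <= g)%MS by rewrite eq_row_base.
have sB a : (B *m mact N a <= B)%MS.
  apply: (submx_trans (submxMr _ Bg)); rewrite -hg.
  exact: (submx_trans (submxMl _ _) gB).
have fB' : (f <= B)%MS := submx_trans fg gB.
have full : row_full (g *m pinvmx B).
  rewrite -col_leq_rank.
  by rewrite -(mxrankMfree (g *m pinvmx B) fB) mulmxKpV.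
have [h hh e] := pP M (submodule fB sB) _ _
   (submodule_corestr fB sB hg gB) (submodule_corestr fB sB hf fB') full.
by exists h => //; rewrite -[f](mulmxKpV fB') -e -mulmxA mulmxKpV.
Qed.

Lemma projective_retract P M (i : 'M[k]_(M, P)) (r : 'M[k]_(P, M)) :
  is_hom i -> is_hom r -> i *m r = 1%:M -> projective P -> projective M.
Proof.
move=> hi hr ir pP N L g f hg hf fg.
have [h hh e] := pP N L g (r *m f) hg (is_homM hr hf) fg.
exists (i *m h); first exact: is_homM.
by rewrite -mulmxA e mulmxA ir mul1mx.
Qed.

Lemma projective_dsum P P' : projective P -> projective P' -> projective (dsum P P').
Proof.
move=> pP pP' M N g f hg hf full.
have hl : is_hom (usubmx f : 'M[k]_(P, N)).
  by move=> a; have := congr1 usubmx (hf a); rewrite /= /dsum_act -[f in LHS]vsubmxK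
    mul_block_col !mul0mx addr0 add0r col_mxKu -mul_usub_mx.
have hr : is_hom (dsubmx f : 'M[k]_(P', N)).
  by move=> a; have := congr1 dsubmx (hf a); rewrite /= /dsum_act -[f in LHS]vsubmxK
    mul_block_col !mul0mx addr0 add0r col_mxKd -mul_dsub_mx.
have [h1 hh1 e1] := pP _ _ _ _ hg hl full.
have [h2 hh2 e2] := pP' _ _ _ _ hg hr full.
exists (col_mx h1 h2); last by rewrite mul_col_mx e1 e2 vsubmxK.
move=> a; rewrite /= /dsum_act mul_block_col !mul0mx addr0 add0r mul_col_mx.
by rewrite hh1 hh2.
Qed.

Lemma is_hom_row M N L (F : 'M[k]_(L, M)) (G : 'M[k]_(L, N)) :
  is_hom F -> is_hom G -> @is_hom k A L (dsum M N) (row_mx F G).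
Proof.
move=> hF hG a; rewrite /= /dsum_act mul_row_block !mulmx0 addr0 add0r mul_mx_row.
by rewrite hF hG.
Qed.

Lemma is_hom_col M N L (F : 'M[k]_(M, L)) (G : 'M[k]_(N, L)) :
  is_hom F -> is_hom G -> @is_hom k A (dsum M N) L (col_mx F G).
Proof.
move=> hF hG a; rewrite /= /dsum_act mul_block_col !mul0mx addr0 add0r mul_col_mx.
by rewrite hF hG.
Qed.

Lemma is_hom_lsub M N L (F : 'M[k]_(L, M + N)) :
  @is_hom k A L (dsum M N) F -> is_hom (lsubmx F : 'M_(L, M)).
Proof.
move=> hF a; have := congr1 lsubmx (hF a); rewrite /= /dsum_act -[F in RHS]hsubmxK.
by rewrite mul_row_block !mulmx0 addr0 row_mxKl mulmx_lsub.
Qed.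

Lemma is_hom_rsub M N L (F : 'M[k]_(L, M + N)) :
  @is_hom k A L (dsum M N) F -> is_hom (rsubmx F : 'M_(L, N)).
Proof.
move=> hF a; have := congr1 rsubmx (hF a); rewrite /= /dsum_act -[F in RHS]hsubmxK.
by rewrite mul_row_block !mulmx0 add0r row_mxKr ?mulmx_rsub.
Qed.

Lemma mx_dim0 m n (F G : 'M[k]_(m, n)) : (m = 0%N \/ n = 0%N) -> F = G.
Proof.
by case=> e; move: F G; rewrite e => F G; rewrite ?(flatmx0 F) ?(flatmx0 G) ?(thinmx0 F) ?(thinmx0 G).
Qed.

End Modules.

Section Complexes.
Variables (k : fieldType) (A : algType k).
Implicit Types P V W X Y Z : cplx A.

(** Stated for a bare family of matrices, so that sums and differences need not be packed as chain
    maps. *)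
Definition nullh X Y (u : forall i, 'M[k]_(X i, Y i)) : Prop :=
  exists2 h : forall i j, 'M[k]_(X i, Y j), (forall i j, is_hom (h i j)) &
    forall i, u i =
      cdiff X i (i + 1) *m h (i + 1) i + h i (i - 1) *m cdiff Y (i - 1) i.

Lemma nullh_ext X Y (u v : forall i, 'M[k]_(X i, Y i)) :
  (forall i, u i = v i) -> nullh u -> nullh v.
Proof. by move=> e [h hh eh]; exists h => // i; rewrite -e. Qed.

Lemma nullh0 X Y : @nullh X Y (fun _ => 0).
Proof.
exists (fun _ _ => 0) => [i j|i]; first exact: is_hom0.
by rewrite mulmx0 mul0mx addr0.
Qed.

Lemma nullhZD X Y c (u v : forall i, 'M[k]_(X i, Y i)) :
  nullh u -> nullh v -> nullh (fun i => c *: u i + v i).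
Proof.
move=> [h hh eh] [g hg eg]; exists (fun i j => c *: h i j + g i j) => [i j|i].
  exact: is_homZD.
rewrite eh eg mulmxDr mulmxDl -!scalemxAr -!scalemxAl scalerDr !addrA.
by congr (_ + _); rewrite -!addrA; congr (_ + _); rewrite addrC.
Qed.

Lemma nullhD X Y (u v : forall i, 'M[k]_(X i, Y i)) :
  nullh u -> nullh v -> nullh (fun i => u i + v i).
Proof. by move=> hu hv; apply: nullh_ext (nullhZD 1 hu hv) => i; rewrite scale1r. Qed.

Lemma nullhN X Y (u : forall i, 'M[k]_(X i, Y i)) :
  nullh u -> nullh (fun i => - u i).
Proof.
move=> hu; apply: nullh_ext (nullhZD (-1) hu (nullh0 X Y)) => i.
by rewrite scaleN1r addr0.
Qed.

Lemma nullh_compl W X Y (g : chmap W X) (u : forall i, 'M[k]_(X i, Y i)) :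
  nullh u -> nullh (fun i => g i i *m u i).
Proof.
move=> [h hh eh]; exists (fun i j => g i i *m h i j) => [i j|i].
  by apply: is_homM => //; apply: cmor_hom.
by rewrite eh mulmxDr !mulmxA cmor_comm.
Qed.

Lemma nullh_compr X Y Z (g : chmap Y Z) (u : forall i, 'M[k]_(X i, Y i)) :
  nullh u -> nullh (fun i => u i *m g i i).
Proof.
move=> [h hh eh]; exists (fun i j => h i j *m g j j) => [i j|i].
  by apply: is_homM => //; apply: cmor_hom.
by rewrite eh mulmxDl -!mulmxA cmor_comm.
Qed.

Lemma homotopic_refl X Y (f : chmap X Y) : homotopic f f.
Proof. by apply: nullh_ext (nullh0 X Y) => i; rewrite subrr. Qed.

Lemma homotopic_sym X Y (f g : chmap X Y) : homotopic f g -> homotopic g f.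
Proof. by move=> h; apply: nullh_ext (nullhN h) => i; rewrite opprB. Qed.

Lemma homotopic_trans X Y (f g h : chmap X Y) :
  homotopic f g -> homotopic g h -> homotopic f h.
Proof.
by move=> h1 h2; apply: nullh_ext (nullhD h1 h2) => i; rewrite addrA subrK.
Qed.

Lemma homotopic_compl W X Y (e : chmap W X) (f g : chmap X Y) :
  homotopic f g -> homotopic (chcomp e f) (chcomp e g).
Proof. by move=> h; apply: nullh_ext (nullh_compl e h) => i; rewrite mulmxBr. Qed.

Lemma homotopic_compr X Y Z (e : chmap Y Z) (f g : chmap X Y) :
  homotopic f g -> homotopic (chcomp f e) (chcomp g e).
Proof. by move=> h; apply: nullh_ext (nullh_compr e h) => i; rewrite mulmxBl. Qed.

Lemma homotopic_ext X Y (f g : chmap X Y) :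
  (forall i, f i i = g i i) -> homotopic f g.
Proof. by move=> e; apply: nullh_ext (nullh0 X Y) => i; rewrite e subrr. Qed.

Lemma homotopic_compA W X Y Z (f : chmap W X) (g : chmap X Y) (h : chmap Y Z) :
  homotopic (chcomp f (chcomp g h)) (chcomp (chcomp f g) h).
Proof. by apply: homotopic_ext => i; rewrite /= /chcomp_mor mulmxA. Qed.

Section DiagonalChainMap.
Variables (X Y : cplx A) (f : forall i j, 'M[k]_(X i, Y j)).
Hypothesis hf : forall i j, is_hom (f i j).
Hypothesis df : forall i j, j != i -> f i j = 0.
Hypothesis cf : forall i,
  cdiff X i (i + 1) *m f (i + 1) (i + 1) = f i i *m cdiff Y i (i + 1).

Lemma chmap_comm i j : cdiff X i j *m f j j = f i i *m cdiff Y i j.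
Proof.
have [->|ij] := eqVneq j (i + 1); first exact: cf.
by rewrite !cdiff_deg // mulmx0 mul0mx.
Qed.

Definition diag_chmap : chmap X Y := Chmap hf df chmap_comm.
End DiagonalChainMap.

(** The matrix types at (i, i) and (i, j) agree only up to a proof of i = j; [dfwith] inserts the
    identity without a visible cast. *)
Definition diag_mx1 (T : int -> fdmod A) i j : 'M[k]_(T i, T j) :=
  @dfwith _ (fun j => 'M[k]_(T i, T j)) (fun _ => 0) i 1%:M j.

Lemma diag_mx1_in (T : int -> fdmod A) i : diag_mx1 T i i = 1%:M.
Proof. by rewrite /diag_mx1 dfwith_in. Qed.

Lemma diag_mx1_out (T : int -> fdmod A) i j : j != i -> diag_mx1 T i j = 0.
Proof. by move=> ij; rewrite /diag_mx1 dfwith_out // eq_sym. Qed.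

Lemma diag_mx1_hom (T : int -> fdmod A) i j :
  @is_hom k A (T i) (T j) (diag_mx1 T i j).
Proof.
have [->|ij] := eqVneq j i; first by rewrite diag_mx1_in; apply: is_hom1.
by rewrite diag_mx1_out //; apply: is_hom0.
Qed.

Lemma chid_comm X i :
  cdiff X i (i + 1) *m diag_mx1 X (i + 1) (i + 1) = diag_mx1 X i i *m cdiff X i (i + 1).
Proof. by rewrite !diag_mx1_in mulmx1 mul1mx. Qed.

Definition chid X : chmap X X :=
  diag_chmap (@diag_mx1_hom X) (@diag_mx1_out X) (chid_comm X).

Lemma chidE X i : chid X i i = 1%:M.
Proof. exact: diag_mx1_in. Qed.

Lemma bnd_chmap X Y (f : chmap X Y) i n (v : 'M[k]_(n, X i)) :
  (v <= cdiff X (i - 1) i)%MS -> (v *m f i i <= cdiff Y (i - 1) i)%MS.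
Proof.
by move=> /submxP[u ->]; rewrite -mulmxA cmor_comm mulmxA submxMl.
Qed.

Lemma cyc_chmap X Y (f : chmap X Y) i n (v : 'M[k]_(n, X i)) :
  v *m cdiff X i (i + 1) = 0 -> v *m f i i *m cdiff Y i (i + 1) = 0.
Proof. by move=> h; rewrite -mulmxA -cmor_comm mulmxA h mul0mx. Qed.

Lemma quasi_iso_id X : quasi_iso (chid X).
Proof.
move=> i; rewrite chidE; split=> [v _|w hw]; first by rewrite mulmx1.
by exists w => //; rewrite mulmx1 subrr sub0mx.
Qed.

Lemma quasi_iso_comp X Y Z (f : chmap X Y) (g : chmap Y Z) :
  quasi_iso f -> quasi_iso g -> quasi_iso (chcomp f g).
Proof.
move=> qf qg i; have [if_ sf] := qf i; have [ig sg] := qg i.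
rewrite /= /chcomp_mor; split=> [v hv|w hw].
  by rewrite mulmxA => /(ig _ (cyc_chmap f hv)) /(if_ _ hv).
have [y hy ey] := sg w hw; have [x hx ex] := sf y hy.
exists x => //; rewrite -[w](subrK (y *m g i i)) -addrA mulmxA -mulmxBl.
by apply: addmx_sub => //; apply: bnd_chmap.
Qed.

Lemma quasi_iso_cancel X Y Z (f : chmap X Y) (g : chmap Y Z) :
  quasi_iso (chcomp f g) -> quasi_iso g -> quasi_iso f.
Proof.
move=> qfg qg i; have [ifg sfg] := qfg i; have [ig sg] := qg i.
rewrite /= /chcomp_mor in ifg sfg; split=> [v hv bv|w hw].
  by apply: ifg => //; rewrite mulmxA; apply: bnd_chmap.
have [v hv] := sfg _ (cyc_chmap g hw); rewrite mulmxA -mulmxBl => bv.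
exists v => //; apply: ig => //.
by rewrite mulmxBl hw sub0r cyc_chmap // oppr0.
Qed.

(** On cocycles the two maps differ by a boundary, because the homotopy term that begins with the
    differential of X vanishes. *)
Lemma quasi_iso_homotopic X Y (f g : chmap X Y) :
  homotopic f g -> quasi_iso f -> quasi_iso g.
Proof.
move=> [h _ eh] qf i; have [if_ sf] := qf i.
have b n (v : 'M[k]_(n, X i)) : v *m cdiff X i (i + 1) = 0 ->
    (v *m f i i - v *m g i i <= cdiff Y (i - 1) i)%MS.
  move=> hv; rewrite -mulmxBr eh mulmxDr !mulmxA hv mul0mx add0r.
  exact: submxMl.
split=> [v hv bv|w hw].
  apply: if_ => //; rewrite -[v *m _](subrK (v *m g i i)).
  by apply: addmx_sub => //; apply: b.
have [v hv bv] := sf w hw; exists v => //.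
rewrite -[w](subrK (v *m f i i)) -addrA; apply: addmx_sub => //.
exact: b.
Qed.

(* Exactness of the mapping cone of s, in the form in which it is lifted
   through projectives. *)
Lemma quasi_iso_block V X (s : chmap V X) i n
    (a : 'M[k]_(n, V i)) (b : 'M[k]_(n, X (i - 1))) :
  quasi_iso s -> a *m cdiff V i (i + 1) = 0 ->
  a *m s i i = b *m cdiff X (i - 1) i ->
  (row_mx a b <= block_mx (cdiff V (i - 1) i) (s (i - 1) (i - 1))
                          0 (cdiff X (i - 1 - 1) (i - 1)))%MS.
Proof.
move=> qs ha hab; apply/row_subP => l; rewrite row_row_mx.
have {ha} := congr1 (row l) ha; have {hab} := congr1 (row l) hab.
rewrite !row_mul row0; move: (row l a) (row l b) => {}a {}b hab ha.
have [is_ _] := qs i; have [_ ss] := qs (i - 1).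
have /submxP[v0 e0] : (a <= cdiff V (i - 1) i)%MS.
  by apply: is_ => //; rewrite hab submxMl.
(* The difference b - v0 s is a cocycle, so up to a boundary it comes from a cocycle v1 of V; adding
   v1 to v0 does not change a. *)
have [v1 hv1 /submxP[x ex]] : exists2 v1, v1 *m cdiff V (i - 1) i = 0 &
    (b - v0 *m s (i - 1) (i - 1) - v1 *m s (i - 1) (i - 1)
      <= cdiff X (i - 1 - 1) (i - 1))%MS.
  have := ss (b - v0 *m s (i - 1) (i - 1)); rewrite subrK; apply.
  by rewrite mulmxBl -mulmxA -cmor_comm mulmxA -e0 hab subrr.
apply/submxP; exists (row_mx (v0 + v1) x).
rewrite mul_row_block mulmx0 addr0 -ex mulmxDl hv1 addr0 -e0; congr row_mx.
by rewrite mulmxDl [RHS]addrC -[b - _ - _]addrA -opprD subrK.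
Qed.

Lemma quasi_iso_block1 V X (s : chmap V X) i n
    (a : 'M[k]_(n, V (i + 1))) (b : 'M[k]_(n, X i)) :
  quasi_iso s -> a *m cdiff V (i + 1) (i + 1 + 1) = 0 ->
  a *m s (i + 1) (i + 1) = b *m cdiff X i (i + 1) ->
  (row_mx a b <= block_mx (cdiff V i (i + 1)) (s i i)
                          0 (cdiff X (i - 1) i))%MS.
Proof.
move=> qs; have := @quasi_iso_block V X s (i + 1) n a; rewrite addrK.
by move=> h ha hb; apply: h.
Qed.

Lemma block_hom V X (s : chmap V X) i j :
  @is_hom k A (dsum (V i) (X j)) (dsum (V (i + 1)) (X i))
    (block_mx (cdiff V i (i + 1)) (s i i) 0 (cdiff X j i)).
Proof.
move=> a; rewrite /= /dsum_act !mulmx_block !(mulmx0, mul0mx, addr0, add0r).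
by rewrite (cdiff_hom V) (cdiff_hom X) (cmor_hom s).
Qed.

(* The recursion runs downwards from N and m bounds its length, which suffices for
   bounded complexes. *)
Lemma descending_choice (T : int -> Type) (G : forall i, T i -> Prop)
    (R : forall i, T i -> T (i + 1) -> Prop) (t0 : forall i, T i) (N : int) :
  (forall i, (N < i)%R -> G i (t0 i) /\ R i (t0 i) (t0 (i + 1))) ->
  (forall i t', G (i + 1) t' -> exists t, G i t /\ R i t t') ->
  forall m : nat, exists t : forall i, T i,
    forall i, (N - m%:Z < i)%R -> G i (t i) /\ R i (t i) (t (i + 1)).
Proof.
move=> h0 step; elim=> [|m [t ht]]; first by exists t0; rewrite subr0.
pose i0 := (N - m%:Z)%R.
have [|x [gx rx]] := step i0 (t (i0 + 1)); first by apply: (ht _ _).1; rewrite /i0; lia.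
exists (dfwith t x) => i hi; have [e|ne] := eqVneq i0 i.
  case: _ / e; rewrite dfwith_in dfwith_out //; rewrite /i0; lia.
have hi' : (i0 < i)%R by rewrite /i0 in ne *; lia.
rewrite !dfwith_out //; first exact: ht.
by rewrite /i0 in hi' *; lia.
Qed.

End Complexes.

(** * Lifting through quasi-isomorphisms from complexes of projectives *)

Section Lifting.
Variables (k : fieldType) (A : algType k).
Implicit Types P V W X Y Z : cplx A.

Definition projective_cplx P := forall i, projective (P i).

Variables (P V X : cplx A) (s : chmap V X).
Hypotheses (pP : projective_cplx P) (qs : quasi_iso s).

Definition row_update (Y : cplx A) i j (F : 'M[k]_(P i, Y j)) l : 'M[k]_(P i, Y l) :=
  @dfwith _ (fun l => 'M[k]_(P i, Y l)) (fun _ => 0) j F l.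

Lemma row_update_in Y i j (F : 'M[k]_(P i, Y j)) : row_update F j = F.
Proof. exact: dfwith_in. Qed.

Lemma row_update_out Y i j (F : 'M[k]_(P i, Y j)) l : l != j -> row_update F l = 0.
Proof. by move=> h; apply: dfwith_out; rewrite eq_sym. Qed.

Lemma row_update_hom Y i j (F : 'M[k]_(P i, Y j)) l :
  is_hom F -> is_hom (row_update F l).
Proof.
move=> hF; have [->|ne] := eqVneq l j; first by rewrite row_update_in.
by rewrite row_update_out //; apply: is_hom0.
Qed.

(** The data chosen in degree i: for [quasi_iso_lift] a component of the lift and one of the
    homotopy, for [quasi_iso_nullh] a component of the homotopy and one of a second order homotopy.
    All target degrees j are carried so that no index has to be transported. *)
Let T i : Type := ((forall j, 'M[k]_(P i, V j)) * (forall j, 'M[k]_(P i, X j)))%type.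
Let t0 i : T i := (fun _ => 0, fun _ => 0).

Let homs i (t : T i) : Prop :=
  (forall j, is_hom (t.1 j)) /\ (forall j, is_hom (t.2 j)).

Let homs0 i : homs (t0 i).
Proof. by split=> j; apply: is_hom0. Qed.

(** The descent starts above degree N, where P vanishes and zero data work. After 2N + 1 steps it
    has reached degree -N, below which P vanishes again and zero data are put back. *)
Let extend (T' : forall i, T i -> Prop) (R : forall i, T i -> T (i + 1) -> Prop) :
  (forall i t t', P i = 0%N :> nat -> R i t t') ->
  (forall i, P i = 0%N :> nat -> T' i (t0 i)) ->
  (forall i (t' : T (i + 1)), homs t' -> T' (i + 1) t' ->
      exists t : T i, (homs t /\ T' i t) /\ R i t t') ->
  exists t : forall i, T i, (forall i, homs (t i)) /\ forall i, R i (t i) (t (i + 1)).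
Proof.
move=> R0 T0 step; have [N HN] := cbounded P.
have [||t ht] := @descending_choice T (fun i t => homs t /\ T' i t) R t0 N _ _ (2 * N + 1)%N.
- move=> i lt; have P0 : P i = 0%N :> nat by apply: HN; lia.
  by split; [split; [exact: homs0 | exact: T0] | exact: R0].
- by move=> i t' [h1 h2]; apply: step.
have far i : (i <= N%:Z - (2 * N + 1)%N%:Z)%R -> P i = 0%N :> nat.
  by move=> le; apply: HN; lia.
pose u i : T i := if (i <= N%:Z - (2 * N + 1)%N%:Z)%R then t0 i else t i.
exists u; split=> i.
  by rewrite /u; case: leP => h; [exact: homs0 | by have [[]] := ht i h].
have [h|h] := leP i (N%:Z - (2 * N + 1)%N%:Z)%R; first by apply: R0; apply: far.
have h' : (N%:Z - (2 * N + 1)%N%:Z < i + 1)%R by lia.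
by rewrite /u !leNgt h h' /=; case: (ht i h).
Qed.

(** One step of the descent: up to sign, (F, H) satisfies the cocycle conditions of the cone of s,
    so by exactness it lies in the image of the block differential, and projectivity of [P i] lifts
    it. *)
Let lift_row i (F : 'M[k]_(P i, V (i + 1))) (H : 'M[k]_(P i, X i)) :
  is_hom F -> is_hom H -> F *m cdiff V (i + 1) (i + 1 + 1) = 0 ->
  F *m s (i + 1) (i + 1) = H *m cdiff X i (i + 1) ->
  exists a : 'M[k]_(P i, V i), exists b : 'M[k]_(P i, X (i - 1)),
    [/\ is_hom a, is_hom b, a *m cdiff V i (i + 1) = F
      & a *m s i i + b *m cdiff X (i - 1) i = H].
Proof.
move=> hF hH F0 FH; have le := quasi_iso_block1 qs F0 FH.
have [h hh] := projective_lift (@pP i) (@block_hom k A V X s i (i - 1)) (is_hom_row hF hH) le.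
rewrite -[h]hsubmxK mul_row_block mulmx0 addr0 => /eq_row_mx[e1 e2].
by exists (lsubmx h), (rsubmx h); split=> //; [exact: is_hom_lsub hh | exact: is_hom_rsub hh].
Qed.

(** Lift and homotopy are built together, from high degrees downwards. The invariant says that the
    choices in degree i turn the data needed in degree i - 1 into what [lift_row] accepts. *)
Lemma quasi_iso_lift (f : chmap P X) :
  exists g : chmap P V, homotopic f (chcomp g s).
Proof.
have [|||] := @extend
  (fun i t => [/\ forall j, j != i -> t.1 j = 0,
     cdiff P (i - 1) i *m t.1 i *m cdiff V i (i + 1) = 0 &
     cdiff P (i - 1) i *m t.1 i *m s i i =
     (f (i - 1) (i - 1) - cdiff P (i - 1) i *m t.2 (i - 1)) *m cdiff X (i - 1) i])
  (fun i t t' =>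
     cdiff P i (i + 1) *m t'.1 (i + 1) = t.1 i *m cdiff V i (i + 1) /\
     f i i = t.1 i *m s i i + cdiff P i (i + 1) *m t'.2 i + t.2 (i - 1) *m cdiff X (i - 1) i).
- by move=> i t t' P0; split; apply: mx_dim0; left.
- move=> i P0; split=> //=; first by rewrite mulmx0 mul0mx.
  by rewrite !mulmx0 subr0 mul0mx -cmor_comm; apply: esym; have -> : f i i = 0 by [apply: mx_dim0; left]; rewrite mulmx0.
- move=> i t' [ht1 ht2] [dt]; rewrite addrK => e1 e2.
  have [||a [b [ha hb ea eb]]] := lift_row _ _ e1 e2.
  + by apply: is_homM; [exact: cdiff_hom | exact: ht1].
  + by apply: is_homB; [exact: cmor_hom | apply: is_homM; [exact: cdiff_hom | exact: ht2]].
  exists (row_update a, row_update b); rewrite /= !row_update_in; split; last first.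
    by split; rewrite ?ea // addrAC eb subrK.
  split; first by split=> j /=; apply: row_update_hom.
  split=> [j|/=|/=]; first exact: row_update_out.
    by rewrite -mulmxA ea mulmxA cdiff_sq mul0mx.
  rewrite -[LHS]mulmxA -[a *m _](addrK (b *m cdiff X (i - 1) i)) eb.
  by rewrite mulmxBl !mulmxBr !mulmxA cdiff_sq mul0mx subr0 cmor_comm.
move=> t [ht et].
pose g i j := (t i).1 j.
pose g' i j : 'M[k]_(P i, V j) := if j == i then g i j else 0.
have hg i j : is_hom (g' i j).
  by rewrite /g'; case: eqP => _; [case: (ht i) => + _; apply | exact: is_hom0].
have dg i j : j != i -> g' i j = 0 by rewrite /g' => /negPf ->.
have cg i : cdiff P i (i + 1) *m g' (i + 1) (i + 1) = g' i i *m cdiff V i (i + 1).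
  by rewrite /g' !eqxx; case: (et i).
exists (diag_chmap hg dg cg); exists (fun i j => (t i).2 j) => [i j|i].
  by case: (ht i) => _; apply.
rewrite /= /chcomp_mor /= /g' eqxx; case: (et i) => _ ->.
by rewrite -[X in X - _]addrA [_ + (_ + _)]addrC addrK.
Qed.

(** The same descent builds a null-homotopy a of u together with a second order homotopy b comparing
    a s with the given null-homotopy h of u s. *)
Lemma quasi_iso_nullh (u : forall i, 'M[k]_(P i, V i)) :
  (forall i, is_hom (u i)) ->
  (forall i, cdiff P (i - 1) i *m u i = u (i - 1) *m cdiff V (i - 1) i) ->
  nullh (fun i => u i *m s i i) -> nullh u.
Proof.
move=> hu cu [h hh eh].
have cu' i : cdiff P i (i + 1) *m u (i + 1) = u i *m cdiff V i (i + 1).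
  by have := cu (i + 1); rewrite addrK.
pose F i (t : T i) : 'M_(P (i - 1), V (i - 1)) := u (i - 1) - cdiff P (i - 1) i *m t.1 (i - 1).
pose H i (t : T i) : 'M_(P (i - 1), X (i - 1 - 1)) :=
  h (i - 1) (i - 1 - 1) + cdiff P (i - 1) i *m t.2 (i - 1 - 1).
have [|||] := @extend
  (fun i t => F i t *m cdiff V (i - 1) i = 0 /\
     F i t *m s (i - 1) (i - 1) = H i t *m cdiff X (i - 1 - 1) (i - 1))
  (fun i t t' => u i = cdiff P i (i + 1) *m t'.1 i + t.1 (i - 1) *m cdiff V (i - 1) i).
- by move=> i t t' P0; apply: mx_dim0; left.
- move=> i P0; rewrite /F /H /= !mulmx0 subr0 addr0; split.
    by rewrite -cu (mx_dim0 (u i) 0 (or_introl P0)) mulmx0.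
  rewrite eh subrK; have -> : h i (i - 1) = 0 by apply: mx_dim0; left.
  by rewrite mulmx0 add0r.
- move=> i t' [ht1 ht2]; rewrite /F /H addrK => -[e1 e2].
  pose f := u i - cdiff P i (i + 1) *m t'.1 i.
  pose g := h i (i - 1) + cdiff P i (i + 1) *m t'.2 (i - 1).
  have hf : is_hom f.
    by apply: is_homB => //; apply: is_homM; [exact: cdiff_hom | exact: ht1].
  have hg : is_hom g.
    by apply: is_homD => //; apply: is_homM; [exact: cdiff_hom | exact: ht2].
  have le := quasi_iso_block qs e1 e2.
  have hb := @block_hom k A V X s (i - 1) (i - 1 - 1).
  rewrite subrK in hb.
  have [x hx] := projective_lift (@pP i) hb (is_hom_row hf hg) le.
  rewrite -[x]hsubmxK mul_row_block mulmx0 addr0 => /eq_row_mx[ea eb].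
  move: (lsubmx x) (rsubmx x) (is_hom_lsub hx) (is_hom_rsub hx) ea eb => a b ha hb' ea eb.
  exists (row_update a, row_update b); rewrite /= !row_update_in; split; last first.
    by rewrite ea /f addrC subrK.
  split; first by split=> j /=; apply: row_update_hom.
  split.
    by rewrite mulmxBl -cu -mulmxA ea /f mulmxBr [_ *m (_ *m t'.1 i)]mulmxA cdiff_sq mul0mx subr0 subrr.
  rewrite mulmxBl eh subrK -[_ *m a *m _]mulmxA -[a *m _](addrK (b *m cdiff X (i - 1 - 1) (i - 1))) eb.
  rewrite /g mulmxBr mulmxDr [_ *m (_ *m t'.2 _)]mulmxA cdiff_sq mul0mx addr0.
  by rewrite mulmxDl mulmxA opprB [LHS]addrC addrA subrK addrC.
move=> t [ht et]; exists (fun i j => (t i).1 j) => [i j|i]; first by case: (ht i) => + _; apply.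
exact: et.
Qed.

Lemma quasi_iso_inj (f g : chmap P V) :
  homotopic (chcomp f s) (chcomp g s) -> homotopic f g.
Proof.
move=> h; apply: quasi_iso_nullh => [i|i|].
- by apply: is_homB; apply: cmor_hom.
- by rewrite mulmxBr mulmxBl !cmor_comm.
- by apply: nullh_ext h => i; rewrite mulmxBl.
Qed.

End Lifting.

(** * Morphisms in the derived category *)

Section DerivedHom.
Variables (k : fieldType) (A : algType k).
Implicit Types P V W X Y Z : cplx A.

(** Components in all bidegrees are kept, so that the whole Hom complex lives in one vector space,
    to whose subspaces [reldim] applies. *)
Definition gmap X Y : lmodType k :=
  @dprod k (int * int)%type (fun p => ('M[k]_(X p.1, Y p.2) : lmodType k)).

Definition gmap_of X Y (f : chmap X Y) : gmap X Y := fun p => f p.1 p.2.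

Definition is_chmap X Y (u : gmap X Y) : Prop :=
  exists f : chmap X Y, forall i j, u (i, j) = f i j.

Definition null_gmap X Y (u : gmap X Y) : Prop := nullh (fun i => u (i, i)).

Lemma is_chmapP X Y (u : gmap X Y) :
  is_chmap u <-> [/\ forall i j, is_hom (u (i, j)), forall i j, j != i -> u (i, j) = 0
    & forall i, cdiff X i (i + 1) *m u (i + 1, i + 1) = u (i, i) *m cdiff Y i (i + 1)].
Proof.
split=> [[f e]|[h d c]].
  split=> *; rewrite ?e; [exact: cmor_hom | exact: cmor_deg | exact: cmor_comm].
by exists (diag_chmap h d c).
Qed.

Lemma is_chmap_subspace X Y : is_subspace (@is_chmap X Y).
Proof.
split=> [|c u v /is_chmapP[h1 d1 c1] /is_chmapP[h2 d2 c2]]; apply/is_chmapP; split=> *.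
- exact: is_hom0.
- by [].
- by rewrite mulmx0 mul0mx.
- by rewrite dprodP; apply: is_homZD.
- by rewrite dprodP d1 // d2 // scaler0 addr0.
- by rewrite !dprodP mulmxDr mulmxDl -scalemxAr -scalemxAl c1 c2.
Qed.

Lemma null_gmap_subspace X Y : is_subspace (@null_gmap X Y).
Proof. by split=> [|c u v hu hv]; [exact: nullh0 | exact: nullhZD]. Qed.

Lemma chlinE X Y n (c : 'rV_n) (f : 'I_n -> chmap X Y) i :
  chlin c f i i = lincomb c (fun l => gmap_of (f l)) (i, i).
Proof. by rewrite dprod_lincomb. Qed.

Lemma null_gmap_chlin X Y n (c : 'rV_n) (f : 'I_n -> chmap X Y) (g : chmap X Y) :
  homotopic g (chlin c f) <-> null_gmap (gmap_of g - lincomb c (fun l => gmap_of (f l))).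
Proof. by split; apply: nullh_ext => i; rewrite chlinE. Qed.

Section Resolution.
Variables (P X : cplx A) (p : chmap P X).
Hypotheses (pP : projective_cplx P) (qp : quasi_iso p).

(** Maps out of P lift through the denominators, uniquely up to homotopy, so equal roofs have
    homotopic pullbacks to P; conversely P itself serves as the common refinement. *)
Lemma roof_eqP Y W1 W2 (s1 : chmap W1 X) (g1 : chmap W1 Y) (s2 : chmap W2 X)
    (g2 : chmap W2 Y) (u1 : chmap P W1) (u2 : chmap P W2) :
  quasi_iso s1 -> quasi_iso s2 ->
  homotopic p (chcomp u1 s1) -> homotopic p (chcomp u2 s2) ->
  roof_eq s1 g1 s2 g2 <-> homotopic (chcomp u1 g1) (chcomp u2 g2).
Proof.
move=> q1 q2 h1 h2; split=> [[V [a [a' [qa e1 e2]]]]|h]; last first.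
  exists P, u1, u2; split=> //; first exact: quasi_iso_homotopic h1 qp.
  exact: homotopic_trans (homotopic_sym h1) h2.
have [w hw] := quasi_iso_lift pP qa p.
have hwa : homotopic (chcomp w a) u1.
  apply: (quasi_iso_inj pP q1).
  apply: homotopic_trans (homotopic_sym (homotopic_compA w a s1)) _.
  exact: homotopic_trans (homotopic_sym hw) h1.
have hwa' : homotopic (chcomp w a') u2.
  apply: (quasi_iso_inj pP q2).
  apply: homotopic_trans (homotopic_sym (homotopic_compA w a' s2)) _.
  apply: homotopic_trans (homotopic_compl w (homotopic_sym e1)) _.
  exact: homotopic_trans (homotopic_sym hw) h2.
apply: homotopic_trans (homotopic_compr g1 (homotopic_sym hwa)) _.
apply: homotopic_trans (homotopic_compr g2 hwa').
apply: homotopic_trans (homotopic_sym (homotopic_compA w a g1)) _.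
by apply: homotopic_trans (homotopic_compA w a' g2); apply: homotopic_compl.
Qed.

Lemma chcomp1l Y (f : chmap P Y) : homotopic f (chcomp (chid P) f).
Proof. by apply: homotopic_ext => i; rewrite /= /chcomp_mor chidE mul1mx. Qed.

Lemma chcomp_chlin W Y n (u : chmap P W) (c : 'rV_n) (f : 'I_n -> chmap W Y) :
  homotopic (chcomp u (chlin c f)) (chlin c (fun l => chcomp u (f l))).
Proof.
apply: homotopic_ext => i; rewrite /= /chcomp_mor /chlin_mor mulmx_sumr.
by apply: eq_bigr => l _; rewrite scalemxAr.
Qed.

(** Pulling roofs back to P turns their coordinates into coordinates of homotopy classes; in the
    converse direction p is the common denominator. *)
Lemma derived_hom_has_dimP Y n :
  derived_hom_has_dim X Y n <-> reldim (@is_chmap P Y) (@null_gmap P Y) n.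
Proof.
split=> [[W [s [f [qs hf]]]]|[f [zf sf uf]]].
  have [u hu] := quasi_iso_lift pP qs p.
  have roofP (g : chmap P Y) c : roof_eq p g s (chlin c f) <->
      null_gmap (gmap_of g - lincomb c (fun l => gmap_of (chcomp u (f l)))).
    apply: (iff_trans (roof_eqP _ _ qp qs (chcomp1l p) hu)).
    rewrite -null_gmap_chlin; split=> h.
      apply: homotopic_trans (chcomp1l g) (homotopic_trans h _).
      exact: chcomp_chlin.
    apply: homotopic_trans (homotopic_sym (chcomp1l g)) (homotopic_trans h _).
    exact/homotopic_sym/chcomp_chlin.
  exists (fun l => gmap_of (chcomp u (f l))); split=> [l|z [g eg]|c hc].
  - by exists (chcomp u (f l)).
  - have [c [/roofP hc _]] := hf P p g qp; exists c.
    by have -> : z = gmap_of g by apply: dprod_ext => -[i j]; rewrite eg.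
  (* Both c and 0 are coordinates of the class of z, so their uniqueness forces c = 0. *)
  - pose z := chlin c (fun l => chcomp u (f l)).
    have [c' [_ uc]] := hf P p z qp.
    have ec : c' = c.
      by apply: uc; apply/roofP/null_gmap_chlin; apply: homotopic_refl.
    have e0 : c' = 0.
      apply: uc; apply/roofP; rewrite lincomb0 subr0.
      by apply: nullh_ext hc => i; rewrite -chlinE.
    by rewrite -ec e0.
have [g eg] := choice zf.
have ef : f = (fun l => gmap_of (g l)).
  by apply: functional_extensionality_dep => l; apply: dprod_ext => -[i j]; rewrite eg.
exists P, p, g; split=> // W s h qs; have [u hu] := quasi_iso_lift pP qs p.
have roofP c : roof_eq s h p (chlin c g) <-> null_gmap (gmap_of (chcomp u h) - lincomb c f).
  apply: (iff_trans (roof_eqP _ _ qs qp hu (chcomp1l p))).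
  rewrite ef -null_gmap_chlin; split=> e; apply: homotopic_trans e _.
    exact/homotopic_sym/chcomp1l.
  exact: chcomp1l.
have [|c hc] := sf (gmap_of (chcomp u h)); first by exists (chcomp u h).
exists c; split; first exact/roofP.
move=> c' /roofP hc'; apply/eqP; rewrite -subr_eq0; apply/eqP; apply: uf.
rewrite lincombB; apply: nullh_ext (subspaceB (null_gmap_subspace _ _) hc' hc) => i.
by rewrite !dprodB opprB addrC addrA subrK.
Qed.

Lemma derived_hom_dimE Y n :
  reldim (@is_chmap P Y) (@null_gmap P Y) n -> derived_hom_dim X Y = n.
Proof.
move=> h; apply: xget_unique; first exact/derived_hom_has_dimP.
move=> m /derived_hom_has_dimP hm.
exact: reldim_unique (null_gmap_subspace _ _) hm h.
Qed.

End Resolution.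
End DerivedHom.

(** * The Euler characteristic of the Hom complex *)

Section IntegerSums.

Definition isum (F : int -> int) : int := \sum_(i \in [set: int]%classic) F i.

Definition finsupp_bound (F : int -> int) (N : nat) : Prop :=
  forall i, (N < `|i|)%N -> F i = 0.

Definition window (N : nat) : seq int := [seq (m%:Z - N%:Z)%R | m <- iota 0 (2 * N + 1)].

Lemma window_uniq N : uniq (window N).
Proof. by rewrite map_inj_uniq ?iota_uniq // => m n /addIr[]. Qed.

Lemma mem_window N i : (i \in window N) = (`|i| <= N)%N.
Proof.
apply/mapP/idP => [[m]|h]; first by rewrite mem_iota => /andP[_ lt] ->; lia.
by exists `|(i + N%:Z)%R|%N; [rewrite mem_iota; lia | lia].
Qed.

Lemma isumE F N : finsupp_bound F N -> isum F = \sum_(i <- window N) F i.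
Proof.
move=> h; rewrite [RHS](@bigfs _ _ _ _ (window N) xpredT F); first last.
- by move=> i _; rewrite mem_window -ltnNge => /h.
- exact: window_uniq.
by congr (\big[_/_]_(_ \in _) _); apply/seteqP; split.
Qed.

Lemma finsupp_boundW F N M : (N <= M)%N -> finsupp_bound F N -> finsupp_bound F M.
Proof. by move=> le h i lt; apply: h; lia. Qed.

Lemma isumD F G : (exists N, finsupp_bound F N) -> (exists N, finsupp_bound G N) ->
  isum (fun i => F i + G i) = isum F + isum G.
Proof.
move=> [N hF] [M hG]; have {}hF := finsupp_boundW (leq_maxl N M) hF.
have {}hG := finsupp_boundW (leq_maxr N M) hG.
rewrite (isumE hF) (isumE hG) (isumE (N := maxn N M)) ?big_split //.
by move=> i lt; rewrite hF // hG.
Qed.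

Lemma isumZ c F : isum (fun i => c * F i) = c * isum F.
Proof.
have [->|c0] := eqVneq c 0.
  by rewrite mul0r /isum fsbig1 // => i _; rewrite mul0r.
by rewrite /isum mulr_fsumr.
Qed.

Lemma eq_isum F G : (forall i, F i = G i) -> isum F = isum G.
Proof. by move=> e; congr isum; apply: funext. Qed.

Lemma isum_shift n F : isum (fun i => F (i + n)) = isum F.
Proof.
rewrite /isum [RHS](reindex_fsbigT (fun i => i + n)) //.
by exists (fun i => i - n) => i; rewrite ?addrK ?subrK.
Qed.

Lemma isum_exchange (F : int -> int -> int) N :
  (forall i j, (N < `|i|)%N \/ (N < `|j|)%N -> F i j = 0) ->
  isum (fun i => isum (fun j => F i j)) = isum (fun j => isum (fun i => F i j)).
Proof.
move=> h.
have b1 i : finsupp_bound (fun j => F i j) N by move=> j hj; apply: h; right.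
have b2 j : finsupp_bound (fun i => F i j) N by move=> i hi; apply: h; left.
have e1 i : isum (fun j => F i j) = \sum_(j <- window N) F i j by apply: isumE.
have e2 j : isum (fun i => F i j) = \sum_(i <- window N) F i j by apply: isumE.
rewrite (eq_isum e1) (eq_isum e2).
have b3 : finsupp_bound (fun i => \sum_(j <- window N) F i j) N.
  by move=> i hi; apply: big1 => j _; apply: b2.
have b4 : finsupp_bound (fun j => \sum_(i <- window N) F i j) N.
  by move=> j hj; apply: big1 => i _; apply: b1.
by rewrite (isumE b3) (isumE b4) exchange_big.
Qed.

Definition sgz_parity (n : int) : int := (-1) ^+ `|n|%N.

Lemma sgz_parityD n m : sgz_parity (n + m) = sgz_parity n * sgz_parity m.
Proof.
rewrite /sgz_parity -exprD -[LHS]signr_odd -[RHS]signr_odd; congr (_ ^+ nat_of_bool _); lia.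
Qed.

Lemma sgz_parityN n : sgz_parity (- n) = sgz_parity n.
Proof. by rewrite /sgz_parity abszN. Qed.

Lemma sgz_parityS n : sgz_parity (n + 1) = - sgz_parity n.
Proof. by rewrite sgz_parityD /sgz_parity /= expr1 mulrN1. Qed.

(** Reindexing the second summand by one reverses its sign. With r the ranks of the differentials,
    this is their cancellation in the Euler characteristic. *)
Lemma isum_telescope (r : int -> int) : (exists N, finsupp_bound r N) ->
  isum (fun n => sgz_parity n * (r n + r (n - 1))) = 0.
Proof.
move=> [N hN]; rewrite (@eq_isum _ (fun n => sgz_parity n * r n + sgz_parity n * r (n - 1))).
  rewrite isumD.
  - rewrite -(isum_shift 1 (fun n => _ * r (n - 1))) -isumD.
    + rewrite /isum fsbig1 // => i _; rewrite addrK sgz_parityS; ring.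
    + by exists N => i hi; rewrite hN // mulr0.
    + by exists N => i hi; rewrite addrK hN // mulr0.
  - by exists N => i hi; rewrite hN // mulr0.
  - by exists N.+1 => i hi; rewrite hN ?mulr0 //; lia.
by move=> i; rewrite mulrDr.
Qed.

End IntegerSums.

Section HomDimension.
Variables (k : fieldType) (A : algType k).
Implicit Types M N L : fdmod A.

Definition homdim M N : nat := projT1 (cid (reldim_fin (is_hom_subspace M N))).

Lemma homdimP M N :
  reldim (fun F : 'M[k]_(M, N) => is_hom F) (fun F => F = 0) (homdim M N).
Proof. by rewrite /homdim; case: cid. Qed.

Lemma homdim_unique M N n :
  reldim (fun F : 'M[k]_(M, N) => is_hom F) (fun F => F = 0) n -> homdim M N = n.
Proof.
by move=> h; apply: reldim_unique (homdimP M N) h; apply: subspace_eq0.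
Qed.

Lemma homdim0 M N : (M = 0%N :> nat \/ N = 0%N :> nat) -> homdim M N = 0%N.
Proof.
move=> e; apply: homdim_unique; apply: reldim_refl => F _; exact: mx_dim0.
Qed.

End HomDimension.

Section EulerCharacteristic.
Variables (k : fieldType) (A : algType k) (X Y : cplx A).

Definition graded (n : int) (u : gmap X Y) : Prop :=
  forall p, is_hom (u p) /\ (p.2 != p.1 + n -> u p = 0).

(* The differential of the Hom complex in degree n, where s is the sign (-1)^n. *)
Definition hom_diff (s : int) (u : gmap X Y) : gmap X Y := fun p =>
  u (p.1, p.2 - 1) *m cdiff Y (p.2 - 1) p.2
  - s%:~R *: (cdiff X p.1 (p.1 + 1) *m u (p.1 + 1, p.2)).

Lemma hom_diff_linear s : linear (hom_diff s).
Proof.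
move=> c u v; apply: dprod_ext => -[i j]; rewrite /hom_diff !dprodP /=.
rewrite mulmxDl mulmxDr -scalemxAl -scalemxAr !scalerDr !scalerA mulrC !opprD.
by rewrite scalerN scalerA !addrA; congr (_ + _); rewrite -!addrA; congr (_ + _); rewrite addrC.
Qed.

HB.instance Definition _ s :=
  GRing.isLinear.Build k (gmap X Y) (gmap X Y) _ (hom_diff s) (hom_diff_linear s).

Lemma graded_subspace n : is_subspace (graded n).
Proof.
split=> [p|c u v hu hv p]; first by split=> //; apply: is_hom0.
have [h1 d1] := hu p; have [h2 d2] := hv p; split=> [|ne].
  by rewrite dprodP; apply: is_homZD.
by rewrite dprodP d1 // d2 // scaler0 addr0.
Qed.

Lemma graded_diff n s u : graded n u -> graded (n + 1) (hom_diff s u).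
Proof.
move=> hu [i j]; rewrite /hom_diff /=; split=> [|ne].
  apply: is_homB; first by apply: is_homM; [case: (hu (i, j - 1)) | exact: cdiff_hom].
  by apply/is_homZ/is_homM; [exact: cdiff_hom | case: (hu (i + 1, j))].
rewrite (hu (i, j - 1)).2 ?(hu (i + 1, j)).2 /=; first by rewrite mulmx0 mul0mx scaler0 subrr.
  by apply: contra_neq ne; lia.
by apply: contra_neq ne; lia.
Qed.

Lemma hom_diff_sq s u : hom_diff (- s) (hom_diff s u) = 0.
Proof.
apply: dprod_ext => -[i j]; rewrite /hom_diff /= dprod0.
rewrite mulmxBl mulmxBr -!mulmxA cdiff_sq mulmx0 sub0r.
rewrite -scalemxAr !mulmxA cdiff_sq mul0mx scaler0 subr0.
by rewrite -scalemxAl rmorphN scaleNr opprK addNr.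
Qed.

Definition cocyc n u := graded n u /\ hom_diff (sgz_parity n) u = 0.
Definition cobnd n u := exists2 v, graded (n - 1) v & u = hom_diff (sgz_parity (n - 1)) v.

Lemma cocyc_subspace n : is_subspace (cocyc n).
Proof.
split=> [|c u v [gu du] [gv dv]]; split; rewrite ?linear0 //.
- by case: (graded_subspace n).
- by case: (graded_subspace n) => _; apply.
- by rewrite hom_diff_linear du dv scaler0 addr0.
Qed.

Lemma cobnd_subspace n : is_subspace (cobnd n).
Proof.
split=> [|c _ _ [u gu ->] [v gv ->]].
  by exists 0; rewrite ?linear0 //; case: (graded_subspace (n - 1)).
exists (c *: u + v); last by rewrite hom_diff_linear.
by case: (graded_subspace (n - 1)) => _; apply.
Qed.

Lemma cobnd_cocyc n u : cobnd n u -> cocyc n u.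
Proof.
move=> [v gv ->]; split; first by have := graded_diff (sgz_parity (n - 1)) gv; rewrite subrK.
have -> : sgz_parity n = - sgz_parity (n - 1) by rewrite -sgz_parityS subrK.
exact: hom_diff_sq.
Qed.

(** The piece of degree n is the product over i of Hom(X i, Y (i + n)); boundedness of X alone makes
    this product finite. *)
Definition graded_dim (n : int) := (\sum_(p <- [seq (i, (i + n)%R) | i <- window
   (projT1 (cid (cbounded X)))]) homdim (X p.1) (Y p.2))%N.

Lemma reldim_graded n : reldim (graded n) (fun u => u = 0) (graded_dim n).
Proof.
rewrite /graded_dim; case: cid => N HN /=; set S := map _ _.
have uS : uniq S by rewrite map_inj_uniq ?window_uniq // => i j [].
pose W (p : int * int) (F : 'M[k]_(X p.1, Y p.2)) := is_hom F.
have := @reldim_supported k _ (fun p => ('M[k]_(X p.1, Y p.2) : lmodType k)) W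
  (fun p => is_hom_subspace _ _) _ (fun p => homdimP _ _) S uS.
apply: reldim_ext => // u; split=> hu [i j]; have [hom h0] := hu (i, j); split=> //=.
  move=> ne; apply: h0; apply: contraNN ne => /mapP[l _ [-> ->]].
  by rewrite eqxx.
move=> nS; have [lt|le] := ltnP N `|i|; first by apply: mx_dim0; left; apply: HN.
apply: h0 => /=; apply: contraNneq nS => ->.
by apply/mapP; exists i => //; rewrite mem_window.
Qed.

Definition cocyc_dim n := projT1 (cid (reldim_sub (cocyc_subspace n)
  (@subspace_eq0 k _) (fun u (h : cocyc n u) => h.1) (reldim_graded n))).

Lemma reldim_cocyc n : reldim (cocyc n) (fun u => u = 0) (cocyc_dim n).
Proof. by rewrite /cocyc_dim; case: cid. Qed.

(** The rank of the differential leaving degree n, by rank-nullity; the truncated subtraction is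
    exact by [graded_dimE]. *)
Definition diff_rank n := (graded_dim n - cocyc_dim n)%N.

Lemma graded_dimE n : graded_dim n = (diff_rank n + cocyc_dim n)%N /\
  reldim (graded n) (cocyc n) (diff_rank n).
Proof.
have c0 u : u = 0 -> cocyc n u by move=> ->; case: (cocyc_subspace n).
have [r hr] := reldim_quo (graded_subspace n) (cocyc_subspace n)
  (@subspace_eq0 k _) c0 (reldim_graded n).
have := reldim_add (cocyc_subspace n) (@subspace_eq0 k _) c0
  (fun u (h : cocyc n u) => h.1) hr (reldim_cocyc n).
move=> /(reldim_unique (@subspace_eq0 k _) (reldim_graded n)) e.
by rewrite /diff_rank e addnK.
Qed.

Lemma reldim_cobnd n : reldim (cobnd (n + 1)) (fun u => u = 0) (diff_rank n).
Proof.
have [_] := graded_dimE n.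
apply: (reldim_transfer (F := hom_diff (sgz_parity n))).
- exact: graded_subspace.
- exact: subspace_eq0.
- by move=> z gz; exists z; rewrite addrK.
- by move=> z gz; split=> [[]|].
- by move=> w [z]; rewrite addrK => gz ->; exists z => //; rewrite subrr.
Qed.

Lemma cohomology_dim n : exists2 h, reldim (cocyc n) (cobnd n) h &
  cocyc_dim n = (h + diff_rank (n - 1))%N.
Proof.
have c0 u : u = 0 -> cobnd n u by move=> ->; case: (cobnd_subspace n).
have [h hh] := reldim_quo (cocyc_subspace n) (cobnd_subspace n)
  (@subspace_eq0 k _) c0 (reldim_cocyc n).
exists h => //; have hb := reldim_cobnd (n - 1); rewrite subrK in hb.
have := reldim_add (cobnd_subspace n) (@subspace_eq0 k _) c0 (@cobnd_cocyc n) hh hb.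
exact: (reldim_unique (@subspace_eq0 k _) (reldim_cocyc n)).
Qed.

Definition regrade n (u : gmap X Y) : gmap X (shift Y n) :=
  fun p => u (p.1, p.2 + n).

Lemma regrade_linear n : linear (regrade n).
Proof. by move=> c u v; apply: dprod_ext. Qed.

HB.instance Definition _ n :=
  GRing.isLinear.Build k (gmap X Y) (gmap X (shift Y n)) _ (regrade n) (regrade_linear n).

Lemma scale_sgz_parity n (V : lmodType k) (v : V) :
  (sgz_parity n)%:~R *: v = (-1) ^+ `|n|%N *: v.
Proof. by rewrite /sgz_parity rmorphXn rmorphN1. Qed.

Lemma sgz_parityK n (V : lmodType k) (v : V) :
  (sgz_parity n)%:~R *: ((sgz_parity n)%:~R *: v) = v.
Proof.
by rewrite scalerA -intrM /sgz_parity -exprMn mulrNN mulr1 expr1n scale1r.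
Qed.

(** The target degree is a function j0 because indices such as i - 1 + n and i + (n - 1) are equal
    without being convertible. *)
Definition spread (j0 : int -> int) (G : forall i, 'M[k]_(X i, Y (j0 i))) : gmap X Y :=
  fun p => row_update (G p.1) p.2.

Lemma spreadE j0 G i : @spread j0 G (i, j0 i) = G i.
Proof. exact: row_update_in. Qed.

Lemma spread_graded n j0 G : (forall i, j0 i = i + n) -> (forall i, is_hom (G i)) ->
  graded n (@spread j0 G).
Proof.
move=> e hG [i j]; split=> [|ne]; first exact: row_update_hom.
by apply: row_update_out; rewrite e.
Qed.

Lemma graded_ext n u v : graded n u -> graded n v ->
  (forall i, u (i, i + n) = v (i, i + n)) -> u = v.
Proof.
move=> hu hv e; apply: dprod_ext => -[i j]; have [->|ne] := eqVneq j (i + n); first exact: e.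
by rewrite (hu (i, j)).2 // (hv (i, j)).2.
Qed.

(** Cocycles of degree n are the chain maps into the shift, and coboundaries the null-homotopic
    ones. The shifted differential carries the sign (-1)^n, so the two kinds of homotopy differ by
    this sign. *)
Lemma reldim_shift n h :
  reldim (cocyc n) (cobnd n) h ->
  reldim (@is_chmap k A X (shift Y n)) (@null_gmap k A X (shift Y n)) h.
Proof.
apply: (reldim_transfer (F := regrade n)).
- exact: cocyc_subspace.
- exact: null_gmap_subspace.
- move=> u [gu du]; apply/is_chmapP; split=> [i j|i j ne|i] /=.
  + by case: (gu (i, j + n)).
  + by case: (gu (i, j + n)) => _; apply=> /=; apply: contraNneq ne => /addIr ->.
  + have := congr1 (fun u => u (i, i + 1 + n)) du; rewrite /hom_diff /= dprod0.
    rewrite [_ - 1]addrAC addrK => /subr0_eq e.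
    rewrite /regrade /shift_diff -scalemxAr -scale_sgz_parity.
    by rewrite /= e sgz_parityK.
- move=> z [gz dz]; have sgn1 : sgz_parity (n - 1) = - sgz_parity n.
    by rewrite -{2}[n](subrK 1) sgz_parityS opprK.
  split=> [[v gv ez]|[x hx ex]].
    exists (fun i j => (sgz_parity n)%:~R *: v (i, j + n)) => [i j|i].
      by apply: is_homZ; case: (gv (i, j + n)).
    rewrite /= ez /regrade /hom_diff /= sgn1 mulrNz scaleNr opprK [LHS]addrC.
    rewrite -scalemxAr; congr (_ + _).
    rewrite /shift_diff -scalemxAr -scale_sgz_parity -scalemxAl sgz_parityK.
    by rewrite addrAC.
  pose G i : 'M[k]_(X i, Y (i - 1 + n)) := (sgz_parity n)%:~R *: x i (i - 1).
  have eG i : spread G (i, i - 1 + n) = G i by exact: (@spreadE (fun i => i - 1 + n)).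
  have gG : graded (n - 1) (spread G).
    by apply: spread_graded => i; [rewrite addrAC addrA | exact/is_homZ/hx].
  exists (spread G) => //; apply: graded_ext gz _ _.
    by have := graded_diff (sgz_parity (n - 1)) gG; rewrite subrK.
  move=> i; have := ex i; rewrite /= {1}/regrade /= => ->.
  have e1 := eG (i + 1); rewrite /G addrK in e1.
  rewrite /hom_diff /= e1 sgn1 mulrNz scaleNr opprK [RHS]addrC; congr (_ + _).
    by rewrite -scalemxAr sgz_parityK.
  have ei : i - 1 + n = i + n - 1 by rewrite addrAC.
  by rewrite -ei eG /G /shift_diff -scalemxAr -scale_sgz_parity -scalemxAl.
- move=> w [f ef]; pose G i : 'M[k]_(X i, Y (i + n)) := f i i.
  have gG : graded n (spread G) by apply: spread_graded => // i; exact: (cmor_hom f i i).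
  have eG i : spread G (i, i + n) = G i by exact: spreadE.
  exists (spread G); last first.
    apply: nullh_ext (nullh0 _ _) => i; by rewrite dprodB ef /= /regrade /= eG subrr.
  split=> //; apply: (graded_ext (graded_diff _ gG)); first by case: (graded_subspace (n + 1)).
  move=> i; rewrite dprod0 /hom_diff /=.
  have e1 := eG i; have e2 := eG (i + 1).
  have c := cmor_comm f i (i + 1); rewrite /= /shift_diff -scalemxAr -scale_sgz_parity in c.
  have ei : i + 1 + n = i + (n + 1) by rewrite -addrA [1 + n]addrC.
  have ei' : i + (n + 1) - 1 = i + n by rewrite addrA addrK.
  by rewrite ei' e1 -ei e2 /G c sgz_parityK subrr.
Qed.
End EulerCharacteristic.

(** * The Euler characteristic and its derived invariance *)

Section EulerForm.
Variables (k : fieldType) (A : algType k).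
Implicit Types P V W X Y Z : cplx A.
Implicit Types L : fdmod A.

(** The alternating sum of the dimensions of the Hom complex; it sees only the terms of X and Y, not
    their differentials. *)
Definition chi X Y : int := isum (fun i => sgz_parity i *
  isum (fun j => sgz_parity j * (homdim (X i) (Y j))%:Z)).

Definition euler_cplx X Y : int :=
  isum (fun n => sgz_parity n * (derived_hom_dim X (shift Y n))%:Z).

Lemma euler_perfE (X Y : perf A) : euler_perf X Y = euler_cplx X Y.
Proof. by []. Qed.

Lemma sgz_parity_sq n : sgz_parity n * sgz_parity n = 1.
Proof. by rewrite /sgz_parity -exprMn mulrNN mulr1 expr1n. Qed.

Lemma sgz_parity_sum X Y :
  isum (fun n => sgz_parity n * (graded_dim X Y n)%:Z) = chi X Y.
Proof.
rewrite /graded_dim; case: cid => N HN /=; have [M HM] := cbounded Y.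
have z1 i j : (N < `|i|)%N -> homdim (X i) (Y j) = 0%N.
  by move=> h; apply: homdim0; left; apply: HN.
have z2 i j : (M < `|j|)%N -> homdim (X i) (Y j) = 0%N.
  by move=> h; apply: homdim0; right; apply: HM.
rewrite (@eq_isum _ (fun n => isum (fun i => sgz_parity n * (homdim (X i) (Y (i + n)))%:Z))).
  rewrite (@isum_exchange _ (N + M)); last first.
    move=> n i h; have [lt|le] := ltnP N `|i|; first by rewrite z1 // mulr0.
    by rewrite z2 ?mulr0 //; lia.
  apply: eq_isum => i; rewrite -isumZ -[RHS](isum_shift i).
  apply: eq_isum => j; rewrite sgz_parityD mulrA [sgz_parity j * sgz_parity i]mulrC mulrA.
  by rewrite sgz_parity_sq mul1r [j + i]addrC.
move=> n; rewrite isumZ big_map; congr (_ * _).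
rewrite (@isumE _ N); last by move=> i /z1 ->.
by rewrite (big_morph Posz PoszD (erefl _)).
Qed.

(** In degree n the Hom complex has dimension h n plus the ranks of the outgoing and incoming
    differentials, and these ranks telescope. *)
Lemma euler_char X Y : exists h : int -> nat,
  (forall n, reldim (@is_chmap k A X (shift Y n)) (@null_gmap k A X (shift Y n)) (h n)) /\
  isum (fun n => sgz_parity n * (h n)%:Z) = chi X Y.
Proof.
pose h n := s2val (cid2 (cohomology_dim X Y n)).
have hP n : reldim (@cocyc k A X Y n) (@cobnd k A X Y n) (h n) := s2valP (cid2 (cohomology_dim X Y n)).
have hE n : cocyc_dim X Y n = (h n + diff_rank X Y (n - 1))%N := s2valP' (cid2 (cohomology_dim X Y n)).
exists h; split=> [n|]; first exact: reldim_shift.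
have [N HN] : exists N : nat, forall n, (N < `|n|)%N -> graded_dim X Y n = 0%N.
  have [N HN] := cbounded X; have [M HM] := cbounded Y; exists (N + M)%N => n lt.
  rewrite /graded_dim; case: cid => N' _ /=; rewrite big_map big1 // => i _ /=.
  apply: homdim0; have [lt'|le] := ltnP N `|i|; [left; exact: HN | right; apply: HM; lia].
have eE n : graded_dim X Y n = (h n + (diff_rank X Y n + diff_rank X Y (n - 1)))%N.
  by have [-> _] := graded_dimE X Y n; rewrite hE; lia.
rewrite -sgz_parity_sum -[LHS]addr0.
have bh : exists N, finsupp_bound (fun n => sgz_parity n * (h n)%:Z) N.
  by exists N => n /HN; rewrite eE => /eqP; rewrite addn_eq0 => /andP[/eqP -> _]; rewrite mulr0.
have br : exists N, finsupp_bound (fun n => (diff_rank X Y n)%:Z) N.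
  by exists N => n /HN; rewrite eE; lia.
have br' : exists N, finsupp_bound
    (fun n => sgz_parity n * ((diff_rank X Y n)%:Z + (diff_rank X Y (n - 1))%:Z)) N.
  exists N => n /HN; rewrite eE => /eqP; rewrite !addn_eq0.
  by move=> /andP[_ /andP[/eqP -> /eqP ->]]; rewrite addr0 mulr0.
rewrite -(isum_telescope br) -isumD //; apply: eq_isum => n.
by rewrite eE !PoszD -mulrDr.
Qed.

Lemma euler_cplxE P X Y (p : chmap P X) :
  projective_cplx P -> quasi_iso p -> euler_cplx X Y = chi P Y.
Proof.
move=> pP qp; have [h [hP <-]] := euler_char P Y.
by apply: eq_isum => n; rewrite (derived_hom_dimE pP qp (hP n)).
Qed.

Section ShiftMap.
Variables (V W : cplx A) (s : chmap V W) (n : int).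

Definition shift_mor i j : 'M[k]_(shift V n i, shift W n j) := s (i + n) (j + n).

Lemma shift_mor_hom i j : is_hom (shift_mor i j).
Proof. exact: (cmor_hom s (i + n) (j + n)). Qed.

Lemma shift_mor_deg i j : j != i -> shift_mor i j = 0.
Proof. move=> ij; apply: (cmor_deg s); apply: contraNneq ij => /addIr ->; exact: eqxx. Qed.

Lemma shift_mor_comm i j :
  cdiff (shift V n) i j *m shift_mor j j = shift_mor i i *m cdiff (shift W n) i j.
Proof.
by rewrite /= /shift_diff /shift_mor -scalemxAl -scalemxAr (cmor_comm s).
Qed.

Definition shift_map : chmap (shift V n) (shift W n) :=
  Chmap shift_mor_hom shift_mor_deg shift_mor_comm.

Lemma quasi_iso_shift : quasi_iso s -> quasi_iso shift_map.
Proof.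
move=> qs i; have [is_ ss] := qs (i + n).
have n0 : (-1) ^+ `|n|%N != 0 :> k by rewrite signr_eq0.
have ei : i + 1 + n = i + n + 1 by rewrite addrAC.
have ei' : i - 1 + n = i + n - 1 by rewrite addrAC.
have cyc Y (v : 'rV[k]_(Y (i + n))) :
    v *m shift_diff Y n i (i + 1) = 0 <-> v *m cdiff Y (i + n) (i + n + 1) = 0.
  rewrite /shift_diff ei -scalemxAr; split=> [/eqP|->]; last by rewrite scaler0.
  by rewrite scaler_eq0 (negPf n0) => /eqP.
have bnd Y (v : 'rV[k]_(Y (i + n))) :
    (v <= shift_diff Y n (i - 1) i)%MS = (v <= cdiff Y (i + n - 1) (i + n))%MS.
  by rewrite /shift_diff ei' eqmx_scale.
split=> [v /cyc hv|w /cyc /ss[v hv bv]].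
  by rewrite /= !bnd; apply: is_.
by exists v; [apply/cyc | rewrite /= bnd].
Qed.
End ShiftMap.

(** Both sides are alternating sums of dimensions of homotopy classes of maps from P into a shift,
    and composition with s is bijective on such classes. *)
Lemma chi_quasi_iso P V W (s : chmap V W) :
  projective_cplx P -> quasi_iso s -> chi P V = chi P W.
Proof.
move=> pP qs; have [h [hP <-]] := euler_char P V; have [g [gP <-]] := euler_char P W.
apply: eq_isum => n; congr (_ * Posz _).
apply: (reldim_unique (null_gmap_subspace P (shift W n))) (gP n).
have qsn := quasi_iso_shift n qs.
pose F (u : gmap P (shift V n)) : gmap P (shift W n) :=
  fun p => u p *m shift_map s n p.2 p.2.
have lF : linear F.
  by move=> c u v; apply: dprod_ext => p; rewrite /F !dprodP mulmxDl scalemxAl.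
pose F' : {linear gmap P (shift V n) -> gmap P (shift W n)} :=
  HB.pack F (GRing.isLinear.Build _ _ _ _ F lF).
apply: (reldim_transfer (F := F')) (hP n).
- exact: is_chmap_subspace.
- exact: null_gmap_subspace.
- move=> z [f ef]; exists (chcomp f (shift_map s n)) => i j; rewrite /= /F /= ef /chcomp_mor.
  have [->//|ij] := eqVneq j i.
  by rewrite (cmor_deg f ij) (cmor_deg (shift_map s n) ij) mulmx0 mul0mx.
- move=> z [f ef]; split=> [|h0].
    exact: nullh_compr.
  apply: (quasi_iso_nullh pP qsn) h0 => i; rewrite !ef; first exact: cmor_hom.
  by rewrite cmor_comm.
- move=> w [f ef]; have [g' hg] := quasi_iso_lift pP qsn f.
  exists (gmap_of g'); first by exists g'.
  by apply: nullh_ext hg => i; rewrite dprodB ef.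
Qed.

End EulerForm.

Lemma mxDE (R : nmodType) m n (F G : 'M[R]_(m, n)) i j : (F + G) i j = F i j + G i j.
Proof. by rewrite mxE. Qed.

Lemma mxNE (R : zmodType) m n (F : 'M[R]_(m, n)) i j : (- F) i j = - F i j.
Proof. by rewrite mxE. Qed.

Lemma mx0E (R : nmodType) m n i j : (0 : 'M[R]_(m, n)) i j = 0.
Proof. by rewrite mxE. Qed.

(** Additive identities are checked entrywise; matrix products stay atoms for [ring]. *)
Ltac mx_abel := apply/matrixP => ? ?; rewrite ?(mxDE, mxNE, mx0E); ring.

Section HomDirectSum.
Variables (k : fieldType) (A : algType k) (L M N : fdmod A).

Lemma homdim_dsuml : homdim (dsum M N) L = (homdim M L + homdim N L)%N.
Proof.
pose F (x : 'M[k]_(M, L) * 'M[k]_(N, L)) : 'M[k]_(M + N, L) := col_mx x.1 x.2.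
have lF : linear F by move=> c x y; rewrite /F scale_col_mx add_col_mx.
pose F' : {linear _ -> _} := HB.pack F (GRing.isLinear.Build _ _ _ _ F lF).
apply: homdim_unique; have h0 K := @is_hom0 k A K L.
apply: (reldim_transfer (F := F')) (reldim_prod (h0 M) (h0 N) (homdimP M L) (homdimP N L)).
- by split=> [//|c x y [hx1 hx2] [hy1 hy2]]; split; apply: is_homZD.
- exact: subspace_eq0.
- by move=> x []; apply: is_hom_col.
- move=> [x y] _; split=> [->|]; first exact: linear0.
  by rewrite /= /F -(@col_mx0 _ M N L) => /eq_col_mx[/= -> ->].
- move=> H hH; exists (usubmx H, dsubmx H); last by rewrite /= /F vsubmxK subrr.
  split=> a; [have := congr1 usubmx (hH a) | have := congr1 dsubmx (hH a)];
  by rewrite /= /dsum_act -[H in LHS]vsubmxK mul_block_col !mul0mx addr0 add0r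
     ?col_mxKu ?col_mxKd -?mul_usub_mx -?mul_dsub_mx.
Qed.

Lemma homdim_dsumr : homdim L (dsum M N) = (homdim L M + homdim L N)%N.
Proof.
pose F (x : 'M[k]_(L, M) * 'M[k]_(L, N)) : 'M[k]_(L, M + N) := row_mx x.1 x.2.
have lF : linear F by move=> c x y; rewrite /F scale_row_mx add_row_mx.
pose F' : {linear _ -> _} := HB.pack F (GRing.isLinear.Build _ _ _ _ F lF).
apply: homdim_unique; have h0 K := @is_hom0 k A L K.
apply: (reldim_transfer (F := F')) (reldim_prod (h0 M) (h0 N) (homdimP L M) (homdimP L N)).
- by split=> [//|c x y [hx1 hx2] [hy1 hy2]]; split; apply: is_homZD.
- exact: subspace_eq0.
- by move=> x []; apply: is_hom_row.
- move=> [x y] _; split=> [->|]; first exact: linear0.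
  by rewrite /= /F -(@row_mx0 _ L M N) => /eq_row_mx[/= -> ->].
- move=> H hH; exists (lsubmx H, rsubmx H); last by rewrite /= /F hsubmxK subrr.
  by split; [exact: is_hom_lsub hH | exact: is_hom_rsub hH].
Qed.

End HomDirectSum.

(** * Additivity on triangles and the Grothendieck group *)

Section Cones.
Variables (k : fieldType) (A : algType k).
Implicit Types P V W X Y Z : cplx A.

Lemma finsupp_chi1 X Y i :
  exists N, finsupp_bound (fun j => sgz_parity j * (homdim (X i) (Y j))%:Z) N.
Proof.
have [N HN] := cbounded Y; exists N => j lt.
by rewrite homdim0 ?mulr0 //; right; apply: HN.
Qed.

Lemma finsupp_chi X Y : exists N, finsupp_bound (fun i => sgz_parity i *
  isum (fun j => sgz_parity j * (homdim (X i) (Y j))%:Z)) N.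
Proof.
have [N HN] := cbounded X; exists N => i lt; rewrite /isum fsbig1 ?mulr0 // => j _.
by rewrite homdim0 ?mulr0 //; left; apply: HN.
Qed.

Lemma isum_sgz_shift F :
  isum (fun i => sgz_parity i * F (i + 1)) = - isum (fun i => sgz_parity i * F i).
Proof.
rewrite -[in RHS](isum_shift 1) -[RHS]mulN1r -isumZ; apply: eq_isum => i.
by rewrite sgz_parityS !mulNr mul1r opprK.
Qed.

Lemma finsupp_shift F : (exists N, finsupp_bound (fun i => sgz_parity i * F i) N) ->
  exists N, finsupp_bound (fun i => sgz_parity i * F (i + 1)) N.
Proof.
move=> [N HN]; exists N.+1 => i lt; have := HN (i + 1).
rewrite sgz_parityS mulNr => h; apply/eqP; rewrite -oppr_eq0; apply/eqP/h; lia.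
Qed.

(** Termwise the cone is the direct sum of Y and of X moved by one degree, and the move reverses the
    sign. *)
Lemma chi_cone_l X Y (f : chmap X Y) Z : chi (cone f) Z = chi Y Z - chi X Z.
Proof.
rewrite /chi.
pose F X i := isum (fun j => sgz_parity j * (homdim (X i) (Z j))%:Z).
rewrite (@eq_isum _ (fun i => sgz_parity i * F X (i + 1) + sgz_parity i * F Y i)).
  rewrite isumD ?isum_sgz_shift 1?addrC //; last exact: finsupp_chi.
  by apply: finsupp_shift; apply: finsupp_chi.
move=> i; rewrite -mulrDr; congr (_ * _); rewrite /F -isumD.
- apply: eq_isum => j; rewrite -mulrDr -PoszD -homdim_dsuml //.
- exact: (finsupp_chi1 X Z (i + 1)).
- exact: finsupp_chi1.
Qed.

Lemma chi_cone_r X Y (f : chmap X Y) Z : chi Z (cone f) = chi Z Y - chi Z X.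
Proof.
rewrite /chi.
pose F X i := isum (fun j => sgz_parity j * (homdim (Z i) (X j))%:Z).
rewrite (@eq_isum _ (fun i => sgz_parity i * F Y i + -1 * (sgz_parity i * F X i))).
  rewrite isumD ?isumZ ?mulN1r //; first exact: finsupp_chi.
  have [N HN] := finsupp_chi Z X; exists N => i /HN; rewrite -/(F X i) => ->.
  by rewrite mulr0.
move=> i; rewrite mulN1r -mulrBr; congr (_ * _).
rewrite /F -[- isum _]isum_sgz_shift addrC -isumD.
- by apply: eq_isum => j; rewrite -mulrDr -PoszD -homdim_dsumr.
- exact: (finsupp_shift (F := fun j => (homdim (Z i) (X j))%:Z) (finsupp_chi1 Z X i)).
- exact: finsupp_chi1.
Qed.

Lemma derived_iso_sym X Y : derived_iso X Y -> derived_iso Y X.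
Proof. by move=> [W [s [t [qs qt]]]]; exists W, t, s. Qed.

Lemma resolution_transport P X Y (p : chmap P X) :
  projective_cplx P -> quasi_iso p -> derived_iso X Y ->
  exists q : chmap P Y, quasi_iso q.
Proof.
move=> pP qp [W [s [t [qs qt]]]]; have [u hu] := quasi_iso_lift pP qs p.
exists (chcomp u t); apply: quasi_iso_comp => //.
exact: quasi_iso_cancel (quasi_iso_homotopic hu qp) qs.
Qed.

Lemma resolution X : perfect X ->
  exists P, projective_cplx P /\ exists p : chmap P X, quasi_iso p.
Proof.
move=> [P pP /derived_iso_sym hXP]; exists P; split=> //.
exact: resolution_transport pP (@quasi_iso_id k A P) hXP.
Qed.

Lemma euler_derived_l X X' Y : perfect X -> derived_iso X X' ->
  euler_cplx X Y = euler_cplx X' Y.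
Proof.
move=> /resolution[P [pP [p qp]]] h; have [q qq] := resolution_transport pP qp h.
by rewrite (euler_cplxE _ pP qp) (euler_cplxE _ pP qq).
Qed.

Lemma euler_derived_r X Y Y' : perfect X -> derived_iso Y Y' ->
  euler_cplx X Y = euler_cplx X Y'.
Proof.
move=> /resolution[P [pP [p qp]]] [W [s [t [qs qt]]]].
by rewrite !(euler_cplxE _ pP qp) -(chi_quasi_iso pP qs) -(chi_quasi_iso pP qt).
Qed.

Lemma euler_triangle_r X Y1 Y2 Y3 : perfect X -> triangle Y1 Y2 Y3 ->
  euler_cplx X Y2 = euler_cplx X Y1 + euler_cplx X Y3.
Proof.
move=> pX [Y1' [Y2' [f [h1 h2 h3]]]].
rewrite (euler_derived_r pX h1) (euler_derived_r pX h2) (euler_derived_r pX h3).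
have [P [pP [p qp]]] := resolution pX.
by rewrite !(euler_cplxE _ pP qp) chi_cone_r addrC subrK.
Qed.

Lemma cone_cycle X Y (f : chmap X Y) i n (a : 'M[k]_(n, X (i + 1))) (b : 'M[k]_(n, Y i)) :
  row_mx a b *m cdiff (cone f) i (i + 1) = 0 <->
  a *m cdiff X (i + 1) (i + 1 + 1) = 0 /\
  a *m f (i + 1) (i + 1) + b *m cdiff Y i (i + 1) = 0.
Proof.
rewrite /= /cone_diff mul_row_block mulmx0 addr0 mulmxN -row_mx0.
split=> [/eq_row_mx[/eqP]|[-> ->]]; last by rewrite oppr0.
by rewrite oppr_eq0 => /eqP.
Qed.

Lemma cone_boundary X Y (f : chmap X Y) i (a : 'rV[k]_(X (i + 1))) (b : 'rV[k]_(Y i)) :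
  (row_mx a b <= cdiff (cone f) (i - 1) i)%MS <->
  exists a0 b0, a = - (a0 *m cdiff X i (i + 1)) /\
                b = a0 *m f i i + b0 *m cdiff Y (i - 1) i.
Proof.
rewrite /= /cone_diff /cone_obj; have -> : i - 1 + 1 = i by rewrite subrK.
split=> [/submxP[c]|[a0 [b0 [-> ->]]]].
  rewrite -[c]hsubmxK mul_row_block mulmx0 addr0 mulmxN => /eq_row_mx[-> ->].
  by exists (lsubmx c), (rsubmx c).
apply/submxP; exists (row_mx a0 b0).
by rewrite mul_row_block mulmx0 addr0 mulmxN.
Qed.

Section ConeMap.
Variables (P1 P2 X1 X2 : cplx A) (g : chmap P1 P2) (f : chmap X1 X2).
Variables (p : chmap P1 X1) (q : chmap P2 X2).
Variable h : forall i j, 'M[k]_(P1 i, X2 j).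
Hypothesis hh : forall i j, is_hom (h i j).
Hypothesis eh : forall i, g i i *m q i i - p i i *m f i i =
  cdiff P1 i (i + 1) *m h (i + 1) i + h i (i - 1) *m cdiff X2 (i - 1) i.

(** The square of g, f, p and q commutes only up to the homotopy h, which therefore has to appear as
    the off-diagonal block. *)
Definition cone_map_mor i j : 'M[k]_(cone g i, cone f j) :=
  if j == i then block_mx (p (i + 1) (j + 1)) (h (i + 1) j) 0 (q i j) else 0.

Lemma cone_map_hom i j : is_hom (cone_map_mor i j).
Proof.
rewrite /cone_map_mor; case: eqP => _; last exact: is_hom0.
move=> a; rewrite /= /dsum_act !mulmx_block !(mulmx0, mul0mx, addr0, add0r).
by rewrite (cmor_hom p) (cmor_hom q) hh.
Qed.

Lemma cone_map_deg i j : j != i -> cone_map_mor i j = 0.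
Proof. by rewrite /cone_map_mor => /negPf ->. Qed.

Lemma cone_map_comm i :
  cdiff (cone g) i (i + 1) *m cone_map_mor (i + 1) (i + 1) =
  cone_map_mor i i *m cdiff (cone f) i (i + 1).
Proof.
rewrite /cone_map_mor !eqxx /= /cone_diff !mulmx_block !(mulmx0, mul0mx, addr0, add0r).
rewrite mulmxN mulNmx (cmor_comm p) (cmor_comm q); congr block_mx.
rewrite mulNmx; have := eh (i + 1); rewrite addrK => /eqP.
by rewrite subr_eq => /eqP ->; rewrite -!addrA addKr addrC.
Qed.

Definition cone_map : chmap (cone g) (cone f) :=
  diag_chmap cone_map_hom cone_map_deg cone_map_comm.

(** A five lemma for the cohomology sequences of the two cones, carried out as a chase on rows. *)
Lemma quasi_iso_cone_map : quasi_iso p -> quasi_iso q -> quasi_iso cone_map.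
Proof.
move=> qp qq i; have [ip sp] := qp (i + 1); have [iq sq] := qq i.
have [ip' sp'] := qp i; have [iq' sq'] := qq (i + 1).
have cmE n (a : 'M[k]_(n, P1 (i + 1))) (b : 'M[k]_(n, P2 i)) :
    row_mx a b *m cone_map i i = row_mx (a *m p (i + 1) (i + 1)) (a *m h (i + 1) i + b *m q i i).
  by rewrite /= /cone_map_mor eqxx mul_row_block mulmx0 addr0.
have bndE Y n (v : 'M[k]_(n, Y (i + 1))) :
    (v <= cdiff Y (i + 1 - 1) (i + 1))%MS = (v <= cdiff Y i (i + 1))%MS by rewrite addrK.
have eq_i n (x : 'M[k]_(n, P1 i)) : x *m g i i *m q i i = x *m p i i *m f i i +
    x *m cdiff P1 i (i + 1) *m h (i + 1) i + x *m h i (i - 1) *m cdiff X2 (i - 1) i.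
  have /eqP := eh i; rewrite subr_eq -!mulmxA => /eqP ->; rewrite !mulmxDr !mulmxA; mx_abel.
split=> [v|w].
  rewrite -[v]hsubmxK; move: (lsubmx v) (rsubmx v) => x y {v}.
  rewrite cmE => /cone_cycle[dx dy] /cone_boundary[a0 [b0 [ea eb]]].
  have /submxP[x0 ex] : (x <= cdiff P1 i (i + 1))%MS.
    by rewrite -bndE; apply: ip => //; rewrite bndE ea -mulNmx submxMl.
  (* The preimage x0 is determined only up to a cocycle; replacing it by x0 - x1 makes a0 + x0 p a
     boundary. *)
  have [x1 dx1 /submxP[a1 ea1]] : exists2 x1, x1 *m cdiff P1 i (i + 1) = 0 &
      (a0 + x0 *m p i i - x1 *m p i i <= cdiff X1 (i - 1) i)%MS.
    by apply: sp'; rewrite mulmxDl -mulmxA -cmor_comm mulmxA -ex ea addrN.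
  have /submxP[y1 ey1] : (y + x0 *m g i i - x1 *m g i i <= cdiff P2 (i - 1) i)%MS.
    apply: iq.
      rewrite mulmxBl mulmxDl -!mulmxA -!(cmor_comm g) !mulmxA -ex dx1 mul0mx subr0.
      by rewrite [LHS]addrC.
    apply/submxP; exists (b0 + x0 *m h i (i - 1) + a1 *m f (i - 1) (i - 1) - x1 *m h i (i - 1)).
    rewrite !mulmxBl !mulmxDl !eq_i dx1 -ex -[a1 *m _ *m _]mulmxA -(cmor_comm f) !mulmxA -ea1.
    have -> : y *m q i i = a0 *m f i i + b0 *m cdiff X2 (i - 1) i - x *m h (i + 1) i.
      by rewrite -eb; mx_abel.
    by rewrite !mulmxBl !mulmxDl mul0mx; mx_abel.
  apply/cone_boundary; exists (x1 - x0), y1; rewrite !mulmxBl dx1 -ex sub0r opprK; split=> //.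
  by rewrite -ey1; mx_abel.
rewrite -[w]hsubmxK; move: (lsubmx w) (rsubmx w) => a b {w} /cone_cycle[da db].
(* The first component lifts to x up to a boundary; completing x to a cocycle of the cone requires x
   g to be a boundary. *)
have [x dx] := sp a da; rewrite bndE => /submxP[a0 ea].
have eqS : x *m g (i + 1) (i + 1) *m q (i + 1) (i + 1) =
    x *m p (i + 1) (i + 1) *m f (i + 1) (i + 1) + x *m h (i + 1) i *m cdiff X2 i (i + 1).
  have /eqP := eh (i + 1); rewrite addrK subr_eq => /eqP e.
  by rewrite -[LHS]mulmxA e !mulmxDr !mulmxA dx mul0mx add0r [LHS]addrC.
have efa : x *m p (i + 1) (i + 1) *m f (i + 1) (i + 1) =
    - (b *m cdiff X2 i (i + 1)) - a0 *m f i i *m cdiff X2 i (i + 1).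
  rewrite -[a0 *m _ *m _]mulmxA -(cmor_comm f) mulmxA -ea mulmxBl.
  by rewrite -(addr0_eq db); mx_abel.
have /submxP[y0 ey0] : (x *m g (i + 1)%R (i + 1)%R <= cdiff P2 i (i + 1))%MS.
  rewrite -bndE; apply: iq'; first by rewrite -mulmxA -(cmor_comm g) mulmxA dx mul0mx.
  rewrite bndE eqS efa; apply/submxP; exists (- b - a0 *m f i i + x *m h (i + 1) i).
  by rewrite mulmxDl mulmxBl mulNmx.
(* What is left of b after this choice is a cocycle of X2, so it lifts through q up to a
   boundary. *)
have [y1 dy1 /submxP[b1 eb1]] : exists2 y1, y1 *m cdiff P2 i (i + 1) = 0 &
    (b - x *m h (i + 1)%R i + y0 *m q i i + a0 *m f i i - y1 *m q i i <= cdiff X2 (i - 1) i)%MS.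
  apply: sq; rewrite !mulmxDl mulNmx -[y0 *m _ *m _]mulmxA -(cmor_comm q) mulmxA -ey0.
  by rewrite eqS efa; mx_abel.
exists (row_mx x (y1 - y0)).
  by apply/cone_cycle; split=> //; rewrite mulmxBl dy1 -ey0 sub0r subrr.
rewrite cmE opp_row_mx add_row_mx; apply/cone_boundary; exists (- a0), b1.
by rewrite ea mulNmx opprK mulNmx -eb1 mulmxBl; split=> //; mx_abel.
Qed.

End ConeMap.
End Cones.

Section Grothendieck.
Variables (k : fieldType) (A : algType k).

Lemma projective_cone (P1 P2 : cplx A) (f : chmap P1 P2) :
  projective_cplx P1 -> projective_cplx P2 -> projective_cplx (cone f).
Proof. by move=> h1 h2 i; apply: projective_dsum. Qed.

(** The triangle is now in the argument that has to be resolved: once its first map is lifted to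
    projective resolutions, the cone of the lift resolves the third term. *)
Lemma euler_triangle_l (X1 X2 X3 : perf A) (Y : cplx A) : triangle X1 X2 X3 ->
  euler_cplx X2 Y = euler_cplx X1 Y + euler_cplx X3 Y.
Proof.
move=> [X1' [X2' [f [h1 h2 h3]]]].
have [P1 [pP1 [p1 qp1]]] := resolution (perfP X1).
have [P2 [pP2 [p2 qp2]]] := resolution (perfP X2).
have [q1 qq1] := resolution_transport pP1 qp1 h1.
have [q2 qq2] := resolution_transport pP2 qp2 h2.
have [g hg] := quasi_iso_lift pP1 qq2 (chcomp q1 f).
have [h hh eh] := homotopic_sym hg.
have eh' i : g i i *m q2 i i - q1 i i *m f i i =
  cdiff P1 i (i + 1) *m h (i + 1) i + h i (i - 1) *m cdiff X2' (i - 1) i := eh i.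
have qc := quasi_iso_cone_map hh eh' qq1 qq2.
rewrite (euler_cplxE _ pP1 qp1) (euler_cplxE _ pP2 qp2).
rewrite (euler_derived_l Y (perfP X3) h3) (euler_cplxE _ (projective_cone pP1 pP2) qc).
by rewrite chi_cone_l addrC subrK.
Qed.

Section Extend.
Variable h : perf A -> int.

Definition zext (x : {malg int[perf A]}) : int := \sum_(X <- msupp x) x@_X * h X.

Lemma zextEw (d : {fset perf A}) x :
  (msupp x `<=` d)%fset -> zext x = \sum_(X <- d) x@_X * h X.
Proof.
move=> le; apply: (big_fset_incl _ le) => X _ /mcoeff_outdom ->.
by rewrite mul0r.
Qed.

Lemma zextB : zmod_morphism zext.
Proof.
move=> x y; pose d := (msupp x `|` msupp y)%fset.
rewrite (@zextEw d (x - y)); last first.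
  by apply: fsubset_trans (msuppB_le _ _) _.
rewrite (@zextEw d x) ?fsubsetUl // (@zextEw d y) ?fsubsetUr // -sumrB.
by apply: eq_bigr => X _; rewrite mcoeffB mulrBl.
Qed.

HB.instance Definition _ := GRing.isZmodMorphism.Build {malg int[perf A]} int zext zextB.

Lemma zextU X : zext << X >> = h X.
Proof.
rewrite (@zextEw [fset X]%fset); last exact: msuppU_le.
by rewrite big_seq_fset1 mcoeffUU mul1r.
Qed.

(** The zeros of [zext h] form a subgroup containing the generating relations. *)
Lemma zext_relations x : (forall X Y Z : perf A, triangle X Y Z -> h Y = h X + h Z) ->
  x \in @K0_relations k A -> zext x = 0.
Proof.
move=> tri /asboolP hx; apply/eqP.
apply: (hx (fun x => zext x == 0)); first split=> [|y z].
- by apply/eqP; rewrite raddf0.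
- by move=> /eqP hy /eqP hz; apply/eqP; rewrite raddfB /= hy hz subrr.
- move=> X Y Z t; apply/eqP; rewrite raddfB raddfB /= !zextU (tri _ _ _ t).
  by rewrite [h X + _]addrC addrK subrr.
Qed.

End Extend.

Lemma euler_freeE (x y : {malg int[perf A]}) :
  euler_free x y = zext (fun X => zext (fun Y => euler_perf X Y) y) x.
Proof.
rewrite /euler_free /zext; apply: eq_bigr => X _; rewrite mulr_sumr.
by apply: eq_bigr => Y _; rewrite mulrA.
Qed.

Lemma euler_freeBl (x x' y : {malg int[perf A]}) : euler_free (x - x') y = euler_free x y - euler_free x' y.
Proof. by rewrite !euler_freeE raddfB. Qed.

Lemma euler_freeBr (x y y' : {malg int[perf A]}) : euler_free x (y - y') = euler_free x y - euler_free x y'.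
Proof.
rewrite !euler_freeE /zext -sumrB; apply: eq_bigr => X _.
by rewrite -mulrBr; congr (_ * _); exact: (raddfB (zext (fun Y => euler_perf X Y))).
Qed.

Lemma euler_free_relr (x y : {malg int[perf A]}) : y \in @K0_relations k A -> euler_free x y = 0.
Proof.
move=> hy; rewrite euler_freeE /zext big1 // => X _.
rewrite -/(zext _ y) zext_relations ?mulr0 // => Y1 Y2 Y3 t.
by rewrite !euler_perfE; apply: euler_triangle_r t; apply: perfP.
Qed.

Lemma euler_free_rell (x y : {malg int[perf A]}) : x \in @K0_relations k A -> euler_free x y = 0.
Proof.
move=> hx; rewrite euler_freeE; apply: zext_relations => // X1 X2 X3 t.
rewrite /zext -big_split; apply: eq_bigr => Y _ /=; rewrite -mulrDr !euler_perfE.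
by rewrite (euler_triangle_l Y t).
Qed.

Definition K0cls (x : {malg int[perf A]}) : K0 A := (\pi_(K0 A))%qT x.

Lemma K0clsB : zmod_morphism K0cls.
Proof. exact: pi_is_zmod_morphism. Qed.

HB.instance Definition _ := GRing.isZmodMorphism.Build {malg int[perf A]} (K0 A) K0cls K0clsB.

Lemma K0cls_repr (x : K0 A) : K0cls (repr x) = x.
Proof. exact: reprK. Qed.

Lemma K0cls_eq x y : (K0cls x = K0cls y) <-> x - y \in @K0_relations k A.
Proof.
rewrite /K0cls; split=> [/eqP|h].
  by rewrite -Quotient.idealrBE.
by apply/eqP; rewrite -Quotient.idealrBE.
Qed.

Lemma repr_K0cls x : repr (K0cls x) - x \in @K0_relations k A.
Proof. by apply/K0cls_eq; rewrite K0cls_repr. Qed.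

Lemma euler_formE x y : euler_form (K0cls x) (K0cls y) = euler_free x y.
Proof.
rewrite /euler_form.
have := euler_free_rell (repr (K0cls y)) (repr_K0cls x).
rewrite euler_freeBl => /subr0_eq ->.
by have := euler_free_relr x (repr_K0cls y); rewrite euler_freeBr => /subr0_eq.
Qed.

Lemma euler_formBl (x x' y : K0 A) : euler_form (x - x') y = euler_form x y - euler_form x' y.
Proof.
by rewrite -[x]K0cls_repr -[x']K0cls_repr -[y]K0cls_repr -raddfB !euler_formE euler_freeBl.
Qed.

Lemma euler_formBr (x y y' : K0 A) : euler_form x (y - y') = euler_form x y - euler_form x y'.
Proof.
by rewrite -[x]K0cls_repr -[y']K0cls_repr -[y]K0cls_repr -raddfB !euler_formE euler_freeBr.
Qed.

Definition K0of (X : perf A) : K0 A := K0cls << X >>.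

Lemma euler_K0of X Y : euler_form (K0of X) (K0of Y) = euler_cplx X Y.
Proof. by rewrite euler_formE euler_freeE !zextU. Qed.

Lemma K0of_triangle (X Y Z : perf A) : triangle X Y Z -> K0of Y = K0of X + K0of Z.
Proof.
move=> t; rewrite /K0of -raddfD; apply/K0cls_eq/asboolP => S zS hS.
by rewrite opprD addrA; apply: hS.
Qed.

Lemma K0_ind (S : K0 A -> Prop) : S 0 ->
  (forall X, S (K0of X)) -> (forall x y, S x -> S y -> S (x - y)) -> forall x, S x.
Proof.
move=> h0 hX hB x; rewrite -[x]K0cls_repr.
have hN y : S y -> S (- y) by move=> hy; rewrite -sub0r; apply: hB.
have hD y z : S y -> S z -> S (y + z) by move=> hy hz; rewrite -[z]opprK; apply/hB/hN.
have hM y (n : nat) : S y -> S (y *+ n).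
  by move=> hy; elim: n => [|n IHn]; rewrite ?mulr0n // mulrS; apply: hD.
rewrite (monalgE (repr x)) raddf_sum.
elim/big_rec: _ => [//|X y _ hy]; apply: hD => //.
have -> : << (repr x)@_X *g X >> = << X >> *~ (repr x)@_X.
  apply/malgP => Y; rewrite -scaler_int intz mcoeffZ !mcoeffU.
  by case: (X == Y) => /=; rewrite ?mulr1n ?mulr0n ?mulr1 ?mulr0.
rewrite raddfMz; case: (_@_X) => n /=; rewrite ?NegzE ?mulrNz -pmulrn; first by apply: hM; apply: hX.
by apply: hN; apply: hM; apply: hX.
Qed.

Definition K0ext (h : perf A -> int) (x : K0 A) : int := zext h (repr x).

Lemma K0ext_cls h x : (forall X Y Z : perf A, triangle X Y Z -> h Y = h X + h Z) ->
  K0ext h (K0cls x) = zext h x.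
Proof.
move=> tri; have := zext_relations tri (repr_K0cls x).
by rewrite raddfB => /subr0_eq.
Qed.

End Grothendieck.

(** * Modules placed in a single degree *)

Section Concentrated.
Variables (k : fieldType) (A : algType k).

Definition zero_act (a : A) : 'M[k]_0 := 0.

Lemma zero_act_linear : linear zero_act.
Proof. by move=> c a b; rewrite /zero_act scaler0 addr0. Qed.

Lemma zero_act1 : zero_act 1 = 1%:M.
Proof. by rewrite [RHS]flatmx0. Qed.

Lemma zero_actM a b : zero_act (a * b) = zero_act a *m zero_act b.
Proof. by rewrite /zero_act mul0mx. Qed.

Definition zero_mod : fdmod A := Fdmod zero_act_linear zero_act1 zero_actM.

Variable M : fdmod A.

Definition at_zero (l : int) : fdmod A := if l is Posz 0 then M else zero_mod.

Lemma at_zero_out l : l != 0 -> at_zero l = 0%N :> nat.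
Proof. by case: l => [[]|]. Qed.

Variable n : int.

Definition conc_obj (i : int) : fdmod A := at_zero (i - n).

Definition conc_diff i j : 'M[k]_(conc_obj i, conc_obj j) := 0.

Lemma conc_hom i j : is_hom (conc_diff i j).
Proof. exact: is_hom0. Qed.

Lemma conc_deg i j : j != i + 1 -> conc_diff i j = 0.
Proof. by []. Qed.

Lemma conc_sq i j l : conc_diff i j *m conc_diff j l = 0.
Proof. by rewrite mul0mx. Qed.

Lemma conc_bounded : exists N : nat, forall i, (N < `|i|)%N -> conc_obj i = 0%N :> nat.
Proof. by exists `|n|%N => i lt; apply: at_zero_out; lia. Qed.

Definition conc : cplx A := Cplx conc_hom conc_deg conc_sq conc_bounded.

Lemma projective_zero : projective zero_mod.
Proof. by move=> X Y g f _ _ _; exists 0; [exact: is_hom0 | apply: mx_dim0; left]. Qed.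

Lemma projective_conc : projective M -> projective_cplx conc.
Proof.
by move=> pM i; rewrite /= /conc_obj /at_zero; case: (i - n) => [[|m]|m] //; apply: projective_zero.
Qed.

End Concentrated.

Lemma submx0m (F : fieldType) m p n (B : 'M[F]_(m, n)) :
  (B <= (0 : 'M_(p, n)))%MS = (B == 0).
Proof. by rewrite eqmx0 submx0. Qed.

Section Generation.
Variables (k : fieldType) (A : algType k).
Implicit Types P X Y : cplx A.

Lemma derived_iso_refl X : derived_iso X X.
Proof. by exists X, (chid X), (chid X); split; apply: quasi_iso_id. Qed.

Lemma derived_iso_map X Y (f : chmap X Y) : quasi_iso f -> derived_iso X Y.
Proof. by move=> qf; exists X, (chid X), f; split=> //; apply: quasi_iso_id. Qed.

Lemma projective_perfect P : projective_cplx P -> perfect P.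
Proof. by move=> pP; exists P => //; apply: derived_iso_refl. Qed.

Definition perf_of P (pP : projective_cplx P) : perf A := Perf (projective_perfect pP).

Lemma zero_chmap_comm X Y i :
  cdiff X i (i + 1) *m (0 : 'M[k]_(X (i + 1), Y (i + 1))) = 0 *m cdiff Y i (i + 1).
Proof. by rewrite mulmx0 mul0mx. Qed.

Definition zero_chmap X Y : chmap X Y :=
  diag_chmap (f := fun i j => 0) (fun i j => is_hom0 _ _) (fun _ _ _ => erefl) (@zero_chmap_comm X Y).

Lemma quasi_iso_zero X Y (f : chmap X Y) :
  (forall i, X i = 0%N :> nat) -> (forall i, Y i = 0%N :> nat) -> quasi_iso f.
Proof.
move=> hX hY i; split=> [v _ _|w _].
  by rewrite (mx_dim0 v 0 (or_intror (hX i))) sub0mx.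
exists 0; first by rewrite mul0mx.
by rewrite (mx_dim0 (w - _) 0 (or_intror (hY i))) sub0mx.
Qed.

Lemma K0of_zero (X : perf A) : (forall i, X i = 0%N :> nat) -> K0of X = 0.
Proof.
move=> hX; have t : triangle X X X.
  exists X, X, (chid X); split; try exact: derived_iso_refl.
  apply: (@derived_iso_map _ _ (zero_chmap _ _)); apply: quasi_iso_zero => // i.
  by rewrite /= !hX.
by have /eqP := K0of_triangle t; rewrite -[X in X == _]addr0 => /eqP/addrI.
Qed.

Definition zero_perf : perf A := perf_of (@projective_conc k A _ 0 (@projective_zero k A)).

Lemma zero_perfE i : zero_perf i = 0%N :> nat.
Proof. by rewrite /= /conc_obj /at_zero; case: (i - 0) => [[]|]. Qed.

(** An isomorphism fits into a triangle with third term zero, because the cone of an identity is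
    acyclic. *)
Lemma K0of_derived (X Y : perf A) : derived_iso X Y -> K0of X = K0of Y.
Proof.
move=> h.
pose Z := zero_perf; have z0 := zero_perfE.
have t : triangle X Y Z.
  exists X, X, (chid X); split; [exact: derived_iso_refl | |].
    by have [W [s [t [qs qt]]]] := h; exists W, t, s.
  apply: (@derived_iso_map _ _ (zero_chmap _ _)) => i; split=> [v _ _|w].
    by rewrite (mx_dim0 v 0 (or_intror (z0 i))) sub0mx.
  rewrite -[w]hsubmxK; move: (lsubmx w) (rsubmx w) => a b {w} /cone_cycle[da db].
  exists 0; first by rewrite mul0mx.
  (* In the cone of the identity, the cocycle (a, b) is the boundary of (b, 0). *)
  rewrite mul0mx subr0; apply/cone_boundary; exists b, 0.
  rewrite chidE mulmx1 mul0mx addr0; split=> //.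
  by move: db; rewrite chidE mulmx1 => /addr0_eq <-; rewrite opprK.
by rewrite (K0of_triangle t) (K0of_zero z0) addr0.
Qed.

Definition perf_conc (M : fdmod A) n (pM : projective M) : perf A :=
  perf_of (@projective_conc k A M n pM).

Lemma opprB_add (i n : int) : i + 1 - n = i - (n - 1).
Proof. by rewrite opprB addrA. Qed.

Lemma diag_mx1_bij (T : int -> fdmod A) l l' : l = l' ->
  (forall v : 'rV[k]_(T l), v *m diag_mx1 T l l' = 0 -> v = 0) /\
  (forall w : 'rV[k]_(T l'), exists v, v *m diag_mx1 T l l' = w).
Proof.
by move=> <-; rewrite diag_mx1_in; split=> [v|w]; [rewrite mulmx1 | exists w; rewrite mulmx1].
Qed.

(** The cone of the map from M in degree n to zero is M in degree n - 1. *)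
Lemma K0of_conc_pred (M : fdmod A) n (pM : projective M) :
  K0of (perf_conc (n - 1) pM) = - K0of (perf_conc n pM).
Proof.
pose Z := zero_perf; have z0 := zero_perfE.
suff t : triangle (perf_conc n pM) Z (perf_conc (n - 1) pM).
  by have := K0of_triangle t; rewrite (K0of_zero z0) => /esym/eqP; rewrite addrC addr_eq0 => /eqP.
exists (conc M n), Z, (zero_chmap _ _); split; try exact: derived_iso_refl.
(* For j = i the indices i - (n - 1) and j + 1 - n are equal but not convertible, hence [diag_mx1]
   in place of an identity matrix. *)
pose F i j : 'M[k]_(conc M (n - 1) i, cone (zero_chmap (conc M n) Z) j) :=
  row_mx (diag_mx1 (at_zero M) (i - (n - 1)) (j + 1 - n)) 0.
have hF i j : is_hom (F i j).
  apply: is_hom_row; last exact: is_hom0.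
  exact: (@diag_mx1_hom k A (at_zero M) (i - (n - 1)) (j + 1 - n)).
have dF i j : j != i -> F i j = 0.
  move=> ij; rewrite /F diag_mx1_out ?row_mx0 //.
  by apply: contra_neq ij; lia.
have d0 i j : cdiff (cone (zero_chmap (conc M n) Z)) i j = 0.
  by rewrite /= /cone_diff /= /conc_diff oppr0 block_mx0.
have cF i : cdiff (conc M (n - 1)) i (i + 1) *m F (i + 1) (i + 1) =
    F i i *m cdiff (cone (zero_chmap (conc M n) Z)) i (i + 1).
  by rewrite d0 mulmx0 mul0mx.
apply: (@derived_iso_map _ _ (diag_chmap hF dF cF)) => i.
have [inj surj] := @diag_mx1_bij (at_zero M) _ (i + 1 - n) (esym (opprB_add i n)).
split=> [v _|w _].
  rewrite d0 submx0m [v *m _]mul_mx_row -row_mx0 => /eqP/eq_row_mx[/inj v0 _].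
  by rewrite [v]v0 sub0mx.
rewrite d0; have [v ev] := surj (lsubmx w); exists v; first exact: mulmx0.
rewrite submx0m [v *m _]mul_mx_row ev mulmx0 -[X in X - _]hsubmxK subr_eq0.
by rewrite [rsubmx w](mx_dim0 _ 0 (or_intror (z0 i))).
Qed.

Lemma K0of_conc (M : fdmod A) n (pM : projective M) :
  K0of (perf_conc n pM) = K0of (perf_conc 0 pM) *~ sgz_parity n.
Proof.
pose c m := K0of (perf_conc m pM).
have pred m : c (m - 1) = - c m by exact: K0of_conc_pred.
rewrite -/(c n) -/(c 0).
have up (m : nat) : c m%:Z = c 0 *~ sgz_parity m%:Z.
  elim: m => [|m IHm]; first by [].
  have := pred m.+1%:Z; rewrite -{1}addn1 PoszD addrK IHm => e.
  by rewrite -[in RHS]addn1 PoszD sgz_parityS mulrNz e opprK.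
have down (m : nat) : c (- m%:Z) = c 0 *~ sgz_parity (- m%:Z).
  elim: m => [|m IHm]; first by [].
  rewrite -addn1 PoszD opprD pred IHm -[in RHS]opprD !sgz_parityN.
  by rewrite sgz_parityS mulrNz.
by case: n => m; [exact: up | rewrite NegzE; exact: down].
Qed.

End Generation.

(** * Generation of the Grothendieck group by projectives *)

Section IdempotentSubcomplex.
Variables (k : fieldType) (A : algType k) (P : cplx A).
Variable E : forall i, 'M[k]_(P i).
Hypothesis hE : forall i, @is_hom k A (P i) (P i) (E i).
Hypothesis idE : forall i, E i *m E i = E i.
Hypothesis stE : forall i j, E i *m cdiff P i j *m E j = E i *m cdiff P i j.

Let B i := row_base (E i).
Let fB i : row_free (B i) := row_base_free (E i).

Lemma sub_image i n (v : 'M[k]_(n, P i)) : (v <= B i)%MS = (v *m E i == v).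
Proof.
rewrite eq_row_base; apply/idP/eqP => [/submxP[u ->]|<-]; last exact: submxMl.
by rewrite -mulmxA idE.
Qed.

Let BE i : B i *m E i = B i.
Proof. by apply/eqP; rewrite -sub_image. Qed.

Let sB i a : (B i *m mact (P i) a <= B i)%MS.
Proof. by rewrite sub_image -mulmxA hE mulmxA BE. Qed.

Definition idem_obj i : fdmod A := submodule (fB i) (sB i).

Let dB i j : (B i *m cdiff P i j <= B j)%MS.
Proof. by rewrite sub_image -{1}BE -!mulmxA [E i *m _]mulmxA stE !mulmxA BE. Qed.

Definition idem_diff i j : 'M[k]_(idem_obj i, idem_obj j) :=
  B i *m cdiff P i j *m pinvmx (B j).

Lemma idem_diffK i j : idem_diff i j *m B j = B i *m cdiff P i j.
Proof. exact: (mulmxKpV (dB i j)). Qed.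

Lemma idem_hom i j : is_hom (idem_diff i j).
Proof.
apply: (@submodule_corestr k A (P j) _ (B j) (fB j) (sB j) (idem_obj i) (B i *m cdiff P i j)) (dB i j).
by apply: (is_homM (submodule_incl (fB i) (sB i))); apply: cdiff_hom.
Qed.

Lemma idem_deg i j : j != i + 1 -> idem_diff i j = 0.
Proof. by move=> ij; rewrite /idem_diff cdiff_deg // mulmx0 mul0mx. Qed.

Lemma idem_sq i j l : idem_diff i j *m idem_diff j l = 0.
Proof.
apply: (row_free_inj (fB l)); rewrite mul0mx -mulmxA idem_diffK mulmxA idem_diffK.
by rewrite -mulmxA cdiff_sq mulmx0.
Qed.

Lemma idem_bounded : exists N : nat, forall i, (N < `|i|)%N -> idem_obj i = 0%N :> nat.
Proof.
have [N HN] := cbounded P; exists N => i /HN e /=.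
by apply/eqP; rewrite -leqn0 -[X in (_ <= X)%N]e; apply: rank_leq_row.
Qed.

Definition idem_cplx : cplx A := Cplx idem_hom idem_deg idem_sq idem_bounded.

Lemma projective_idem : projective_cplx P -> projective_cplx idem_cplx.
Proof.
move=> pP i; apply: projective_retract (submodule_incl (fB i) (sB i)) _ _ (@pP i).
  by apply: (submodule_corestr (fB i) (sB i) (hE i)); rewrite sub_image idE.
by rewrite mulmxA BE; apply: mulmxVp; exact: fB.
Qed.

Lemma idem_incl_hom i j : is_hom (@row_update k A idem_cplx P i i (B i) j).
Proof. by apply: row_update_hom; apply: submodule_incl. Qed.

Lemma idem_incl_deg i j : j != i -> @row_update k A idem_cplx P i i (B i) j = 0.
Proof. exact: row_update_out. Qed.

Lemma idem_incl_comm i :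
  cdiff idem_cplx i (i + 1) *m @row_update k A idem_cplx P (i + 1) (i + 1) (B (i + 1)) (i + 1)
  = @row_update k A idem_cplx P i i (B i) i *m cdiff P i (i + 1).
Proof. by rewrite !row_update_in; apply: idem_diffK. Qed.

Definition idem_incl : chmap idem_cplx P :=
  diag_chmap idem_incl_hom idem_incl_deg idem_incl_comm.

Lemma idem_inclE i : idem_incl i i = B i.
Proof. exact: row_update_in. Qed.

Section Quotient.
Variables (M : fdmod A) (N : int).
Variables (r : 'M[k]_(P N, M)) (s : 'M[k]_(M, P N)).
Hypotheses (hr : is_hom r) (sr : s *m r = 1%:M).
Hypotheses (EN : E N = 1%:M - r *m s) (Eout : forall i, i != N -> E i = 1%:M).
Hypothesis low : forall i, (i < N)%R -> P i = 0%N :> nat.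

Let pr i : 'M[k]_(P i, M) := @dfwith _ (fun i => 'M[k]_(P i, M)) (fun _ => 0) N r i.

Let prN : pr N = r. Proof. exact: dfwith_in. Qed.
Let pr_out i : i != N -> pr i = 0.
Proof. by move=> h; rewrite /pr dfwith_out // eq_sym. Qed.

Let prz i l : 'M[k]_(P i, at_zero M l) :=
  @dfwith _ (fun l => 'M[k]_(P i, at_zero M l)) (fun _ => 0) 0 (pr i) l.

Let prz_hom i l : is_hom (prz i l).
Proof.
rewrite /prz; have [->|ne] := eqVneq l 0; last by rewrite dfwith_out 1?eq_sym //; apply: is_hom0.
rewrite dfwith_in; have [e|ne] := eqVneq i N; last by rewrite pr_out //; apply: is_hom0.
by rewrite e prN.
Qed.

Definition idem_quo_mor i j : 'M[k]_(cone idem_incl i, conc M N j) :=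
  if j == i then col_mx 0 (prz i (j - N)) else 0.

Lemma idem_quo_hom i j : is_hom (idem_quo_mor i j).
Proof.
rewrite /idem_quo_mor; case: eqP => _; last exact: is_hom0.
by apply: is_hom_col; [exact: is_hom0 | exact: prz_hom].
Qed.

Lemma idem_quo_deg i j : j != i -> idem_quo_mor i j = 0.
Proof. by rewrite /idem_quo_mor => /negPf ->. Qed.

Let prz_E i l n (b : 'M[k]_(n, P i)) : l = i - N ->
  b *m prz i l = 0 <-> b *m E i = b.
Proof.
move=> el; have [e|ne] := eqVneq i N; last first.
  rewrite (Eout ne) mulmx1; split=> // _.
  by apply: mx_dim0; right; apply: at_zero_out; rewrite el subr_eq0.
move: b; rewrite e el e subrr /prz dfwith_in prN EN => b.
rewrite mulmxBr mulmx1 mulmxA; split=> [->|]; first by rewrite mul0mx subr0.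
move=> /eqP; rewrite subr_eq addrC -subr_eq subrr eq_sym => /eqP e0.
by rewrite -[b *m r]mulmx1 -sr mulmxA e0 mul0mx.
Qed.

Lemma idem_quo_comm i :
  cdiff (cone idem_incl) i (i + 1) *m idem_quo_mor (i + 1) (i + 1) =
  idem_quo_mor i i *m cdiff (conc M N) i (i + 1).
Proof.
rewrite /= /conc_diff mulmx0 /idem_quo_mor eqxx /cone_diff mul_block_col.
rewrite !mulmx0 !add0r idem_inclE.
rewrite (prz_E _ (erefl _)).2 ?BE //.
(* The projection ignores all degrees but N, and no differential arrives in degree N because P
   vanishes below it. *)
have -> : cdiff P i (i + 1) *m prz (i + 1) (i + 1 - N) = 0.
  have [e|ne] := eqVneq (i + 1) N; last first.
    by apply: mx_dim0; right; apply: at_zero_out; rewrite subr_eq0.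
  by apply: mx_dim0; left; apply: low; lia.
by rewrite col_mx0.
Qed.

Definition idem_quo : chmap (cone idem_incl) (conc M N) :=
  diag_chmap idem_quo_hom idem_quo_deg idem_quo_comm.

(** The cone of the inclusion of a subcomplex is quasi-isomorphic to the quotient. Here the quotient
    is M in degree N: E is the identity elsewhere, and its image in degree N is the kernel of r. *)
Lemma quasi_iso_idem_quo : quasi_iso idem_quo.
Proof.
move=> i; have mE n (a : 'M[k]_(n, idem_obj (i + 1))) (b : 'M[k]_(n, P i)) :
    row_mx a b *m idem_quo i i = b *m prz i (i - N).
  by rewrite /= /idem_quo_mor eqxx mul_row_col mulmx0 add0r.
split=> [v|w _].
  rewrite -[v]hsubmxK; move: (lsubmx v) (rsubmx v) => a b {v}.
  rewrite mE => /cone_cycle[da db]; rewrite submx0m => /eqP/(prz_E _ (erefl _)) bE.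
  have /submxP[c ec] : (b <= B i)%MS by rewrite sub_image bE.
  apply/cone_boundary; exists c, 0; rewrite idem_inclE mul0mx addr0; split=> //.
  apply: (row_free_inj (fB (i + 1))); rewrite mulNmx -mulmxA [cdiff _ _ _ *m _]idem_diffK.
  by move/eqP: db; rewrite idem_inclE addr_eq0 ec -mulmxA => /eqP.
have [e|ne] := eqVneq i N; last first.
  exists 0; first by rewrite mul0mx.
  by rewrite (mx_dim0 (w - _) 0) ?sub0mx //; right; apply: at_zero_out; rewrite subr_eq0.
have sE : forall w : 'rV[k]_(at_zero M (i - N)), exists b : 'rV[k]_(P i), b *m prz i (i - N) = w.
  rewrite e subrr => w'; exists (w' *m s); rewrite /prz dfwith_in prN -mulmxA sr.
  exact: mulmx1.
have [b eb] := sE w.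
have /submxP[c ec] : (b *m cdiff P i (i + 1) <= B (i + 1))%MS.
  by rewrite sub_image Eout ?mulmx1 //; apply/eqP; lia.
exists (row_mx (- c) b); last by rewrite mE eb subrr sub0mx.
apply/cone_cycle; rewrite idem_inclE !mulNmx ec addNr; split=> //.
apply/eqP; rewrite oppr_eq0; apply/eqP.
apply: (row_free_inj (fB (i + 1 + 1))).
by rewrite mul0mx -mulmxA [cdiff _ _ _ *m _]idem_diffK mulmxA -ec -mulmxA cdiff_sq mulmx0.
Qed.

End Quotient.
End IdempotentSubcomplex.

Section Span.
Variables (k : fieldType) (A : algType k) (J : finType) (Pm : J -> fdmod A).
Hypothesis pPm : forall v, projective (Pm v).
Hypothesis Pm_neq0 : forall v, Pm v <> 0%N :> nat.
Hypothesis split_off : forall M : fdmod A, projective M -> M <> 0%N :> nat ->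
  exists v (r : 'M[k]_(M, Pm v)) (s : 'M[k]_(Pm v, M)),
    [/\ is_hom r, is_hom s & s *m r = 1%:M].

Definition K0proj v : K0 A := K0of (perf_conc 0 (@pPm v)).

Definition K0span (x : K0 A) : Prop := exists c : J -> int, x = \sum_v K0proj v *~ c v.

Lemma K0span0 : K0span 0.
Proof. by exists (fun _ => 0); rewrite big1. Qed.

Lemma K0spanD x y : K0span x -> K0span y -> K0span (x + y).
Proof.
move=> [c ->] [d ->]; exists (fun v => c v + d v); rewrite -big_split.
by apply: eq_bigr => v _; rewrite mulrzDr.
Qed.

Lemma K0spanN x : K0span x -> K0span (- x).
Proof.
move=> [c ->]; exists (fun v => - c v); rewrite -sumrN.
by apply: eq_bigr => v _; rewrite mulrNz.
Qed.

Lemma K0span_gen v n : K0span (K0proj v *~ n).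
Proof.
exists (fun w => if w == v then n else 0); rewrite (bigD1 v) //= eqxx.
by rewrite big1 ?addr0 // => w /negPf ->.
Qed.

Lemma lowest_degree (P : cplx A) : (exists i, P i <> 0%N :> nat) ->
  exists N, P N <> 0%N :> nat /\ forall i, (i < N)%R -> P i = 0%N :> nat.
Proof.
move=> [i0 hi0]; have [B HB] := cbounded P.
have ex : exists m : nat, (P (m%:Z - B%:Z) : nat) != 0%N.
  exists `|(i0 + B%:Z)%R|%N; suff -> : `|(i0 + B%:Z)%R|%N%:Z - B%:Z = i0 by apply/eqP.
  have [lt|le] := ltnP B `|i0|; first by case: hi0; apply: HB.
  by lia.
case: (ex_minnP ex) => m /eqP hm minm; exists (m%:Z - B%:Z); split=> // i lt.
have [ltB|leB] := ltnP B `|i|; first exact: HB.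
apply: contrapT => /eqP ni; have := minm `|(i + B%:Z)%R|%N.
have -> : `|(i + B%:Z)%R|%N%:Z - B%:Z = i by lia.
by move=> /(_ ni); lia.
Qed.

(** Induction on the total dimension. Splitting is done in the lowest nonzero degree N: no
    differential arrives there, so the kernel of r together with all higher degrees is a subcomplex,
    with quotient P_v in degree N. *)
Lemma K0span_projective (B n : nat) (P : cplx A) (pP : projective_cplx P) :
  (forall i, (B < `|i|)%N -> P i = 0%N :> nat) ->
  (\sum_(i <- window B) P i <= n)%N -> K0span (K0of (perf_of pP)).
Proof.
elim: n P pP => [|n IHn] P pP HB le.
  rewrite K0of_zero; first exact: K0span0.
  move=> i /=; have [lt|leB] := ltnP B `|i|; first exact: HB.
  have iw : i \in window B by rewrite mem_window.
  move: le; rewrite (bigD1_seq i) ?window_uniq //= leqn0 addn_eq0 => /andP[/eqP + _].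
  by [].
have [ex|nex] := pselect (exists i, P i <> 0%N :> nat); last first.
  rewrite K0of_zero; first exact: K0span0.
  by move=> i /=; apply: contrapT => h; apply: nex; exists i.
have [N [PN low]] := lowest_degree ex.
have [v [r [s [hr hs sr]]]] := split_off (@pP N) PN.
pose E : forall i, 'M[k]_(P i) := @dfwith _ (fun i => 'M[k]_(P i)) (fun i => 1%:M) N (1%:M - r *m s).
have EN : E N = 1%:M - r *m s by rewrite /E dfwith_in.
have Eout i : i != N -> E i = 1%:M by move=> h; rewrite /E dfwith_out // eq_sym.
have hE i : @is_hom k A (P i) (P i) (E i).
  have [->|ne] := eqVneq i N; last by rewrite Eout //; apply: is_hom1.
  by rewrite EN; apply: is_homB; [exact: is_hom1 | exact: is_homM].
have idE i : E i *m E i = E i.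
  have [->|ne] := eqVneq i N; last by rewrite Eout // mulmx1.
  by rewrite EN mulmxBl mul1mx mulmxBr mulmx1 -mulmxA [s *m _]mulmxA sr mul1mx subrr subr0.
have stE i j : E i *m cdiff P i j *m E j = E i *m cdiff P i j.
  have [->|ne] := eqVneq j N; last by rewrite [E j]Eout // mulmx1.
  have -> : cdiff P i N = 0; last by rewrite mulmx0 mul0mx.
  have [e|ne] := eqVneq N (i + 1); last exact: cdiff_deg.
  by apply: mx_dim0; left; apply: low; rewrite e; lia.
have pP' : projective_cplx (idem_cplx hE idE stE) by exact: projective_idem.
have t : triangle (perf_of pP') (perf_of pP) (perf_conc N (@pPm v)).
  exists (idem_cplx hE idE stE), P, (idem_incl hE idE stE).
  split; [exact: derived_iso_refl | exact: derived_iso_refl |].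
  apply: derived_iso_sym; apply: (@derived_iso_map _ _ _ _ (idem_quo hE idE stE hr sr EN Eout low)).
  exact: quasi_iso_idem_quo.
rewrite (K0of_triangle t) K0of_conc; apply: K0spanD; last exact: K0span_gen.
have le' i : (\rank (E i) <= P i)%N := rank_leq_row _.
(* Strict decrease: an idempotent [E N] of full rank would be the identity, so s and then P_v would
   be zero. *)
have ltN : (\rank (E N) < P N)%N.
  rewrite ltn_neqAle le' andbT; apply/eqP => e.
  have uE : E N \in unitmx by rewrite -row_full_unit /row_full e.
  have EN1 : E N = 1%:M by rewrite -[E N](mulKmx uE) idE mulVmx.
  have s0 : s = 0.
    rewrite -[s]mulmx1 -EN1 EN mulmxBr mulmx1 mulmxA sr mul1mx subrr //.
  apply: (@Pm_neq0 v); apply/eqP; rewrite -(mxrank1 k (Pm v)) -sr s0 mul0mx mxrank0 //.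
apply: IHn => [i lt|].
  by apply/eqP; rewrite -leqn0 -[X in (_ <= X)%N](HB i lt); apply: le'.
have Nw : N \in window B.
  by rewrite mem_window leqNgt; apply/negP => /HB.
rewrite -ltnS; apply: leq_trans le.
rewrite !(bigD1_seq N) ?window_uniq //= -addSn.
by apply: leq_add => //; apply: leq_sum.
Qed.

Lemma K0spanning (x : K0 A) : K0span x.
Proof.
move: x; apply: K0_ind => [|X|x y hx hy]; first exact: K0span0.
  have [P pP hP] := perfP X.
  rewrite (@K0of_derived _ _ X (perf_of pP)) //.
  have [B HB] := cbounded P; exact: K0span_projective HB (leqnn _).
by apply: K0spanD => //; apply: K0spanN.
Qed.

End Span.

(** * Path algebras modulo monomial relations *)

Section PathAlgebraFacts.
Variables (k : fieldType) (Q : quiver).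
Implicit Types (x y : pathalg k Q) (p q r : qpath Q).

Definition pcoef p x : k := x@_p.

Lemma pcoefD p x y : pcoef p (x + y) = pcoef p x + pcoef p y.
Proof. exact: mcoeffD. Qed.

Lemma pcoefB p x y : pcoef p (x - y) = pcoef p x - pcoef p y.
Proof. exact: mcoeffB. Qed.

Lemma pcoefZ p c x : pcoef p (c *: x) = c * pcoef p x.
Proof. exact: mcoeffZ. Qed.

Lemma pcoefU p q : pcoef p (pbase k q) = (q == p)%:R.
Proof. by rewrite /pcoef /pbase mcoeffU. Qed.

Lemma pcoef_linear p : linear (pcoef p : _ -> k^o).
Proof. by move=> c x y; rewrite pcoefD pcoefZ. Qed.

HB.instance Definition _ p :=
  GRing.isLinear.Build k (pathalg k Q) k^o _ (pcoef p : _ -> k^o) (pcoef_linear p).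

Lemma pathalg_sumE x : x = \sum_(p <- msupp x) pcoef p x *: pbase k p.
Proof.
rewrite {1}(monalgE x); apply: eq_bigr => p _; apply/malgP => q.
rewrite -[RHS]/(pcoef q _) pcoefZ pcoefU mcoeffU.
by case: (p == q) => /=; rewrite ?mulr1n ?mulr0n ?mulr1 ?mulr0.
Qed.

Lemma pmulE x y : x * y = \sum_(p <- msupp x) \sum_(r <- msupp y)
  (pcoef p x * pcoef r y) *: pbase_opt k (pcat p r).
Proof.
rewrite -[LHS]/(pmul x y) /pmul /pext; apply: eq_bigr => p _.
by rewrite scaler_sumr; apply: eq_bigr => r _; rewrite scalerA.
Qed.

Lemma pbaseM p r : pbase k p * pbase k r = pbase_opt k (pcat p r).
Proof. exact: pmulUU. Qed.

Lemma msupp_mul x y q : q \in msupp (x * y) ->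
  exists p r, [/\ p \in msupp x, r \in msupp y & pcat p r = Some q].
Proof.
move=> hq; apply: contrapT => nex; move: hq; rewrite -mcoeff_neq0.
rewrite -[_@_q]/(pcoef q (x * y)) pmulE linear_sum big_seq big1 ?eqxx // => p px.
rewrite linear_sum big_seq big1 // => r ry; rewrite /= pcoefZ.
case e : (pcat p r) => [q'|] /=; last by rewrite (linear0 (pcoef q)) mulr0.
rewrite pcoefU; have [e'|] := eqVneq q' q; last by rewrite mulr0.
by case: nex; exists p, r; rewrite -e'.
Qed.

Lemma pcat_arrow (a b : Q1 Q) : qs a = qt b ->
  exists2 p, pcat (patha a) (patha b) = Some p & parr p = [:: a; b].
Proof. by move=> e; case: pcatP => [p _ _ _ ?|[]] //; exists p. Qed.

Lemma arrM0 (a b : Q1 Q) : qs a <> qt b -> arr k a * arr k b = 0.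
Proof. by move=> ne; rewrite pbaseM; case: pcatP => // r e; case: ne. Qed.

Lemma pbaseMS p r q : pcat p r = Some q -> pbase k p * pbase k r = pbase k q.
Proof. by move=> e; rewrite pbaseM e. Qed.

Lemma parr_arrow p (a : Q1 Q) : parr p = [:: a] -> p = patha a.
Proof.
move=> e; apply: qpath_eq => //; have := valP p.
by rewrite /is_path -/(parr p) -/(ptgt p) e /= andbT => /eqP.
Qed.

Lemma path_split p s1 s2 : parr p = s1 ++ s2 ->
  exists p1 p2, [/\ pcat p1 p2 = Some p, parr p1 = s1 & parr p2 = s2].
Proof.
move=> e; have := valP p; rewrite /is_path -/(ptgt p) -/(parr p) e composable_cat => /andP[h1 h2].
exists (@QPath Q (ptgt p, s1) h1), (@QPath Q (_, s2) h2).
case: pcatP => [r _ tr _ ar|[]] //; split=> //; congr Some.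
by apply: qpath_eq => //; rewrite ar e.
Qed.

Lemma not_sorted_split (T : eqType) (e : rel T) s : ~~ sorted e s ->
  exists s1 a b s2, s = s1 ++ [:: a; b] ++ s2 /\ ~~ e a b.
Proof.
case: s => // a s /=; elim: s a => //= b s IHs a; rewrite negb_and.
case/orP => [ne|/IHs[s1 [c [d [s2 [-> ne]]]]]]; first by exists [::], a, b, s.
by exists (a :: s1), c, d, s2.
Qed.

End PathAlgebraFacts.

Section MonomialIdeal.
Variables (k : fieldType) (Q : quiver) (I : set (pathalg k Q)).
Hypothesis hI : is_ideal I.
Hypothesis gI : gen_by_length_two I.
Implicit Types (x y : pathalg k Q) (p q r : qpath Q).

Definition nz : rel (Q1 Q) := fun b a => `[< ~ I (arr k b * arr k a) >].

Definition goodp p : bool := sorted nz (parr p).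

Lemma ideal0 : I 0. Proof. by case: hI. Qed.
Lemma idealMl x y : I x -> I (y * x). Proof. by case: hI => _ _ h /(h _ y)[]. Qed.
Lemma idealMr x y : I x -> I (x * y). Proof. by case: hI => _ _ h /(h _ y)[]. Qed.
Lemma nz_composable b a : nz b a -> qs b = qt a.
Proof.
move=> /asboolP h; apply: contrapT => ne; apply: h; rewrite arrM0 //; exact: ideal0.
Qed.

Lemma bad_ideal p : ~~ goodp p -> I (pbase k p).
Proof.
move=> /not_sorted_split[s1 [a [b [s2 [e /asboolPn/contrapT nab]]]]].
have [p1 [p' [e1 _ ep']]] := path_split e.
have [p2 [p3 [e2 ep2 _]]] := path_split ep'.
rewrite -(pbaseMS k e1) -(pbaseMS k e2); apply/idealMl/idealMr.
have [s1' [s2' [e3 h1 h2]]] := path_split (ep2 : parr p2 = [:: a] ++ [:: b]).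
by rewrite -(pbaseMS k e3) (parr_arrow h1) (parr_arrow h2).
Qed.

(** The elements supported on paths with two consecutive arrows whose product is in I form an ideal
    that contains the generators. *)
Lemma ideal_supp x : I x -> forall p, p \in msupp x -> ~~ goodp p.
Proof.
have [R sR eI] := gI => hx.
pose J : set (pathalg k Q) := [set x | forall p, p \in msupp x -> ~~ goodp p]%classic.
have idJ : is_ideal J.
  split=> [p|y z hy hz p /(fsubsetP (msuppD_le _ _))|y z hy].
  - by rewrite msupp0 inE.
  - by rewrite inE => /orP[/hy|/hz].
  - have cat_good q r s : pcat q r = Some s -> goodp s -> goodp q /\ goodp r.
      case: pcatP => // s' _ _ _ + [<-]; rewrite /goodp => -> /cat_sorted2[-> ->] //.
    split=> p /msupp_mul[q [r [hq hr /cat_good hc]]]; apply/negP => /hc[gq gr].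
      by have := hy r hr; rewrite gr.
    by have := hy q hq; rewrite gq.
have genJ : ([set pbase k p | p in R] `<=` J)%classic.
  move=> _ [p Rp <-] q; rewrite /pbase msuppU oner_eq0 inE => /eqP ->.
  have := sR p Rp; case ep : (parr p) => [|a [|b [|]]] // _.
  have [p1 [p2 [e1 h1 h2]]] := path_split (ep : parr p = [:: a] ++ [:: b]).
  rewrite /goodp ep /= andbT; apply/negP => /asboolP; apply.
  rewrite /arr -(parr_arrow h1) -(parr_arrow h2) (pbaseMS k e1) eI => K hK sK.
  by apply: sK; exists p.
by move: hx; rewrite {1}eI => /(_ J idJ genJ).
Qed.

Lemma ideal_pcoef x p : I x -> goodp p -> pcoef p x = 0.
Proof.
move=> hx gp; apply: contrapT => /eqP ne; have := ideal_supp hx (p := p).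
by rewrite -mcoeff_neq0 gp => /(_ ne).
Qed.

Lemma ideal_pbase p : I (pbase k p) <-> ~~ goodp p.
Proof.
split=> [h|]; last exact: bad_ideal.
by apply: (ideal_supp h); rewrite /pbase msuppU oner_eq0 inE.
Qed.

Variable m : nat.
Hypothesis hm : (arrow_ideal_pow m `<=` I)%classic.

(** A path of length at least m has a segment of length m, and this segment lies in I by
    admissibility. *)
Lemma goodp_size p : goodp p -> (size (parr p) < m)%N.
Proof.
move=> gp; rewrite ltnNge; apply/negP => le.
have [p1 [p2 [e1 h1 _]]] := path_split (esym (cat_take_drop m (parr p))).
have : I (pbase k p1).
  by apply: hm => J hJ sJ; apply: sJ; exists p1; rewrite //= h1 size_take_min; apply/minn_idPl.
by move=> /(idealMr (pbase k p2)); rewrite (pbaseMS k e1) => /ideal_pbase; rewrite gp.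
Qed.

(** The fuel L keeps the recursion structural; L = m already exhausts the nonzero paths, by
    admissibility. *)
Fixpoint nz_tails (L : nat) (b : Q1 Q) : seq (seq (Q1 Q)) :=
  if L is L'.+1 then
    [::] :: flatten [seq [seq a :: s | s <- nz_tails L' a] | a <- enum (Q1 Q) & nz b a]
  else [::].

Lemma mem_nz_tails L b s : (s \in nz_tails L b) = path nz b s && (size s < L)%N.
Proof.
elim: L b s => [|L IHL] b s /=; first by rewrite andbF.
rewrite inE; case: s => [|a s]; first by rewrite eqxx.
rewrite /= ltnS -andbA -[in RHS]IHL; apply/flatten_mapP/andP => [[c]|[ha hs]].
  by rewrite mem_filter => /andP[hc _] /mapP[t ht [-> ->]].
exists a; first by rewrite mem_filter ha mem_enum.
by apply/mapP; exists s.
Qed.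

(** The function g recovers the index of the block an element comes from, so the blocks are
    disjoint. *)
Lemma uniq_flatten_map (S T : eqType) (F : S -> seq T) (g : T -> option S) s :
  uniq s -> (forall a t, a \in s -> t \in F a -> g t = Some a) ->
  (forall a, a \in s -> uniq (F a)) -> uniq (flatten [seq F a | a <- s]).
Proof.
elim: s => //= a s IHs /andP[nas us] hg hu; rewrite cat_uniq hu ?inE ?eqxx //=.
rewrite IHs //; first last.
- by move=> b hb; apply: hu; rewrite inE hb orbT.
- by move=> b t hb; apply: hg; rewrite inE hb orbT.
rewrite andbT; apply/hasPn => t /flatten_mapP[b hb ht]; apply/negP => hta.
have hb' : b \in a :: s by rewrite inE hb orbT.
have := hg a t (mem_head _ _) hta; rewrite (hg b t hb' ht) => -[e].
by move: nas; rewrite -e hb.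
Qed.

Lemma nz_tails_uniq L b : uniq (nz_tails L b).
Proof.
elim: L b => //= L IHL b; apply/andP; split.
  by apply/negP => /flatten_mapP[a _ /mapP[]].
apply: (uniq_flatten_map (g := ohead)) => [|a t _ /mapP[s _ ->]|a _] //.
  by rewrite filter_uniq ?enum_uniq.
by rewrite map_inj_uniq ?IHL // => s t [].
Qed.

Definition good_data v : seq (Q0 Q * seq (Q1 Q)) :=
  (v, [::]) :: flatten [seq [seq (v, b :: s) | s <- nz_tails m b] | b <- enum (Q1 Q) & qt b == v].

Lemma nz_path_composable b s : path nz b s -> composable (qt b) (b :: s).
Proof.
elim: s b => [|a s IHs] b /=; first by rewrite eqxx.
by move=> /andP[/nz_composable -> /IHs]; rewrite /= !eqxx.
Qed.

Lemma mem_good_data v (x : Q0 Q * seq (Q1 Q)) : (x \in good_data v) =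
  [&& x.1 == v, composable x.1 x.2, sorted nz x.2 & (size x.2 <= m)%N].
Proof.
case: x => w s; rewrite inE /=; case: s => [|b s] /=.
  rewrite xpair_eqE !eqxx !andbT orbC; case: flatten_mapP => [[b _ /mapP[t _ []]]|] //.
rewrite xpair_eqE andbF /=; apply/flatten_mapP/and4P => [[c]|[/eqP -> /andP[/eqP hb _] hs le]].
  rewrite mem_filter => /andP[/eqP hc _] /mapP[t]; rewrite mem_nz_tails => /andP[ht le] [-> -> ->].
  split=> //; first by rewrite -hc; apply: nz_path_composable.
exists b; first by rewrite mem_filter hb eqxx mem_enum.
by apply/mapP; exists s; rewrite // mem_nz_tails hs.
Qed.

Lemma good_data_uniq v : uniq (good_data v).
Proof.
rewrite /good_data cons_uniq; apply/andP; split; first by apply/negP => /flatten_mapP[a _ /mapP[]].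
apply: (uniq_flatten_map (g := fun x : Q0 Q * seq (Q1 Q) => ohead x.2)) => [|a t _ /mapP[s _ ->]|a _] //.
  by rewrite filter_uniq ?enum_uniq.
by rewrite map_inj_uniq ?nz_tails_uniq // => s t [].
Qed.

Definition good_paths v : seq (qpath Q) := pmap insub (good_data v).

Lemma val_good_paths v : map val (good_paths v) = good_data v.
Proof.
rewrite /good_paths; have : all (@is_path Q) (good_data v).
  by apply/allP => x; rewrite mem_good_data => /and4P[].
elim: (good_data v) => //= x s IHs /andP[hx hs].
by rewrite insubT /= IHs.
Qed.

Lemma good_paths_uniq v : uniq (good_paths v).
Proof. by rewrite -(map_inj_uniq val_inj) val_good_paths good_data_uniq. Qed.

Lemma mem_good_paths v p : (p \in good_paths v) = (ptgt p == v) && goodp p.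
Proof.
rewrite -(mem_map val_inj) val_good_paths mem_good_data.
have -> : composable (val p).1 (val p).2 by exact: (valP p).
rewrite /=; congr (_ && _); rewrite /goodp; case h : (sorted _ _) => //=.
by apply: ltnW; apply: (goodp_size (p := p)).
Qed.

End MonomialIdeal.

(** * Indecomposable projectives and simples *)

(* The paths satisfying good map to a basis of A and the other ones to 0. *)
Record path_basis (k : fieldType) (A : algType k) (Q : quiver) (good : pred (qpath Q))
    (G : Q0 Q -> seq (qpath Q)) (pa : qpath Q -> A) (coef : qpath Q -> A -> k) : Prop := {
  pb_mem : forall v p, (p \in G v) = (ptgt p == v) && good p;
  pb_uniq : forall v, uniq (G v);
  pb_trivial : forall v, good (pathv v);
  pb_bounded : exists m : nat, forall p, good p -> (size (parr p) < m)%N;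
  pb_linear : forall p, good p -> forall c a b, coef p (c *: a + b) = c * coef p a + coef p b;
  pb_coef : forall p q, good p -> good q -> coef p (pa q) = (q == p)%:R;
  pb_bad : forall p, ~~ good p -> pa p = 0;
  pb_expand : forall a, a = \sum_v \sum_(p <- G v) coef p a *: pa p;
  pb_mul : forall p q, pa p * pa q = oapp pa 0 (pcat p q);
  pb_one : 1 = \sum_v pa (pathv v) }.

Section QuiverModules.
Variables (k : fieldType) (A : algType k) (Q : quiver) (good : pred (qpath Q)).
Variables (G : Q0 Q -> seq (qpath Q)) (pa : qpath Q -> A) (coef : qpath Q -> A -> k).
Hypothesis pb : path_basis good G pa coef.
Implicit Types (p q r : qpath Q) (v w : Q0 Q) (a b : A).

Definition vtx v : A := pa (pathv v).

Lemma vtxM v p : vtx v * pa p = if v == ptgt p then pa p else 0.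
Proof. by rewrite /vtx (pb_mul pb) pcat1p; case: eqP. Qed.

Lemma paM_vtx p v : pa p * vtx v = if psrc p == v then pa p else 0.
Proof. by rewrite /vtx (pb_mul pb) pcatp1; case: eqP. Qed.

Lemma vtx_idem v : vtx v * vtx v = vtx v.
Proof. by rewrite vtxM eqxx. Qed.

Lemma acoef0 p : good p -> coef p 0 = 0.
Proof.
by move=> gp; have := pb_linear pb gp (-1) 0 0; rewrite scaler0 addr0 mulN1r addNr.
Qed.

Lemma acoef_sum (T : Type) (s : seq T) (F : T -> A) p : good p ->
  coef p (\sum_(i <- s) F i) = \sum_(i <- s) coef p (F i).
Proof.
move=> gp; have cD a b : coef p (a + b) = coef p a + coef p b.
  by have := pb_linear pb gp 1 a b; rewrite scale1r mul1r.
by rewrite (big_morph (coef p) cD (acoef0 gp)).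
Qed.

Lemma acoefZ p c a : good p -> coef p (c *: a) = c * coef p a.
Proof.
by move=> gp; have := pb_linear pb gp c a 0; rewrite addr0 acoef0 // addr0.
Qed.

Lemma expand_vtx v a : vtx v * a = a -> a = \sum_(p <- G v) coef p a *: pa p.
Proof.
move=> e; rewrite -[LHS]e [X in _ * X](pb_expand pb) mulr_sumr (bigD1 v) //=.
rewrite [X in _ + X]big1 ?addr0 => [|w wv].
  rewrite mulr_sumr big_seq [RHS]big_seq; apply: eq_bigr => p.
  by rewrite (pb_mem pb) => /andP[/eqP hp _]; rewrite -scalerAr vtxM hp eqxx.
rewrite mulr_sumr big_seq big1 // => p; rewrite (pb_mem pb) => /andP[/eqP hp _].
by rewrite -scalerAr vtxM hp eq_sym (negPf wv) scaler0.
Qed.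

Definition pdim v := size (G v).

Definition bpath v (i : 'I_(pdim v)) : qpath Q := nth (pathv v) (G v) i.
Arguments bpath : clear implicits.

Lemma bpathP v i : ptgt (bpath v i) = v /\ good (bpath v i).
Proof.
have : bpath v i \in G v by apply: mem_nth.
by rewrite (pb_mem pb) => /andP[/eqP].
Qed.

Lemma bpath_good v i : good (bpath v i). Proof. by case: (bpathP i). Qed.

Lemma bpath_inj v : injective (bpath v).
Proof.
move=> i j e; apply/val_inj/eqP.
by rewrite -(nth_uniq (pathv v) (ltn_ord i) (ltn_ord j) (pb_uniq pb v)); apply/eqP.
Qed.

Lemma bpath_surj v p : ptgt p = v -> good p -> exists i, bpath v i = p.
Proof.
move=> tp gp; have hp : p \in G v by rewrite (pb_mem pb) tp eqxx.
have lt : (index p (G v) < pdim v)%N by rewrite index_mem.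
by exists (Ordinal lt); rewrite /bpath nth_index.
Qed.

Lemma vtx_bpath v i : vtx v * pa (bpath v i) = pa (bpath v i).
Proof. by rewrite vtxM; have [-> _] := bpathP i; rewrite eqxx. Qed.

Definition triv v : 'I_(pdim v) := projT1 (cid (bpath_surj (erefl : ptgt (pathv v) = v) (pb_trivial pb v))).

Lemma trivE v : bpath v (triv v) = pathv v.
Proof. by rewrite /triv; case: cid. Qed.

(** Right multiplication by a on e_v A, in the basis of nonzero paths with target v; the module
    obtained is P_v. *)
Definition proj_act v a : 'M[k]_(pdim v) := \matrix_(i, j) coef (bpath v j) (pa (bpath v i) * a).

Lemma paM_expand v i a :
  pa (bpath v i) * a = \sum_j proj_act v a i j *: pa (bpath v j).
Proof.
rewrite {1}(@expand_vtx v (pa (bpath v i) * a)) ?mulrA ?vtx_bpath //.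
rewrite (big_nth (pathv v)) big_mkord; apply: eq_bigr => j _.
by rewrite mxE.
Qed.

Lemma proj_act_linear v : linear (proj_act v).
Proof.
move=> c a b; apply/matrixP => i j; rewrite !mxE mulrDr -scalerAr.
by rewrite (pb_linear pb) // bpath_good.
Qed.

Lemma proj_act1 v : proj_act v 1 = 1%:M.
Proof.
apply/matrixP => i j; rewrite !mxE mulr1 (pb_coef pb) ?bpath_good //.
by rewrite (inj_eq (@bpath_inj v)).
Qed.

Lemma proj_actM v a b : proj_act v (a * b) = proj_act v a *m proj_act v b.
Proof.
apply/matrixP => i j; rewrite !mxE mulrA paM_expand mulr_suml acoef_sum ?bpath_good //.
by apply: eq_bigr => l _; rewrite -scalerAl acoefZ ?bpath_good // [in RHS]mxE mulrC [in RHS]mxE mulrC mxE.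
Qed.

Definition Pmod v : fdmod A := Fdmod (@proj_act_linear v) (@proj_act1 v) (@proj_actM v).

Lemma Pmod_neq0 v : Pmod v <> 0%N :> nat.
Proof. by move=> e; have := ltn_ord (triv v); rewrite [X in (_ < X)%N]e. Qed.

Section HomFromProjective.
Variables (N : fdmod A) (v : Q0 Q).

Definition hom_of (u : 'rV[k]_N) : 'M[k]_(Pmod v, N) :=
  \matrix_i (u *m mact N (pa (bpath v i))).

Lemma mact_sum (T : Type) (s : seq T) (F : T -> A) :
  mact N (\sum_(i <- s) F i) = \sum_(i <- s) mact N (F i).
Proof.
have l := @mact_linear k A N.
have m0 : mact N 0 = 0 by have := l (-1) 0 0; rewrite scaler0 addr0 scaleN1r addNr.
have mD : {morph mact N : a b / a + b}.
  by move=> a b; have := l 1 a b; rewrite !scale1r.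
by rewrite (big_morph _ mD m0).
Qed.

Lemma mactZ c a : mact N (c *: a) = c *: mact N a.
Proof.
have l := @mact_linear k A N.
have m0 : mact N 0 = 0 by have := l (-1) 0 0; rewrite scaler0 addr0 scaleN1r addNr.
by have := l c a 0; rewrite m0 !addr0.
Qed.

Lemma hom_of_hom u : is_hom (hom_of u).
Proof.
move=> a; apply/row_matrixP => i; rewrite !row_mul rowK -mulmxA -mactM paM_expand mact_sum.
rewrite mulmx_sum_row mulmx_sumr; apply: eq_bigr => j _.
by rewrite rowK mactZ -scalemxAr mxE.
Qed.

Lemma hom_of_triv u : row (triv v) (hom_of u) = u *m mact N (vtx v).
Proof. by rewrite rowK trivE. Qed.

Lemma hom_row (F : 'M[k]_(Pmod v, N)) : is_hom F ->
  forall i, row i F = row (triv v) F *m mact N (pa (bpath v i)).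
Proof.
move=> hF i; rewrite -row_mul -hF row_mul.
have -> : row (triv v) (mact (Pmod v) (pa (bpath v i))) = delta_mx 0 i.
  apply/rowP => j; rewrite !mxE trivE -/(vtx v) vtx_bpath (pb_coef pb) ?bpath_good //.
  by rewrite (inj_eq (@bpath_inj v)) eq_sym.
by rewrite -rowE.
Qed.

Lemma hom_row_vtx (F : 'M[k]_(Pmod v, N)) : is_hom F ->
  row (triv v) F *m mact N (vtx v) = row (triv v) F.
Proof. by move=> hF; rewrite [RHS](hom_row hF) trivE. Qed.

Lemma hom_eq (F H : 'M[k]_(Pmod v, N)) : is_hom F -> is_hom H ->
  row (triv v) F = row (triv v) H -> F = H.
Proof. by move=> hF hH e; apply/row_matrixP => i; rewrite (hom_row hF) (hom_row hH) e. Qed.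

(** A homomorphism from e_v A to N is determined by the image of e_v, which can be any element of N
    e_v. *)
Lemma homdim_Pmod : homdim (Pmod v) N = \rank (mact N (vtx v)).
Proof.
apply: homdim_unique.
have lF : linear hom_of.
  by move=> c x y; apply/row_matrixP => i; rewrite linearP /= !rowK mulmxDl -scalemxAl.
pose F' : {linear 'rV[k]_N -> 'M[k]_(Pmod v, N)} :=
  HB.pack hom_of (GRing.isLinear.Build _ _ _ _ _ lF).
have fixE (x : 'rV[k]_N) : (x <= mact N (vtx v))%MS -> x *m mact N (vtx v) = x.
  by move=> /submxP[u ->]; rewrite -mulmxA -mactM vtx_idem.
apply: (reldim_transfer (F := F')) (reldim_rowspace (mact N (vtx v))).
- split=> [|c x y hx hy]; first exact: sub0mx.
  by apply: addmx_sub => //; apply: scalemx_sub.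
- exact: subspace_eq0.
- by move=> z _; apply: hom_of_hom.
- move=> z hz; split=> [->|e]; first by rewrite linear0.
  by rewrite -(fixE z hz) -hom_of_triv [hom_of z]e row0.
- move=> H hH; exists (row (triv v) H); first by rewrite -(hom_row_vtx hH) submxMl.
  apply/eqP; rewrite subr_eq0; apply/eqP; apply: hom_eq => //; first exact: hom_of_hom.
  by rewrite /= hom_of_triv hom_row_vtx.
Qed.

End HomFromProjective.

Lemma projective_Pmod v : projective (Pmod v).
Proof.
move=> M N g f hg hf full; have /submxP[u eu] := submx_full (row (triv v) f) full.
exists (hom_of v (u *m mact M (vtx v))); first exact: hom_of_hom.
apply: hom_eq => //; first by apply: is_homM => //; apply: hom_of_hom.
rewrite row_mul hom_of_triv -[_ *m _ *m mact M _]mulmxA -mactM vtx_idem.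
by rewrite -mulmxA hg mulmxA -eu hom_row_vtx.
Qed.

End QuiverModules.

Lemma mxrank_diag_bool (k : fieldType) n (b : pred 'I_n) :
  \rank (\matrix_(i, j) (if b i && (i == j) then 1 else 0) : 'M[k]_n) = #|b|.
Proof.
set E := \matrix_(_, _) _.
apply: (reldim_unique (@subspace_eq0 k _) (reldim_rowspace E)).
have EE (x : 'rV[k]_n) i : (x *m E) 0 i = if b i then x 0 i else 0.
  rewrite mxE (bigD1 i) //= big1 ?addr0 => [|j /negPf ji]; rewrite !mxE.
    by rewrite eqxx andbT; case: (b i); rewrite ?mulr1 ?mulr0.
  by rewrite ji andbF mulr0.
have idE : E *m E = E.
  apply/row_matrixP => i; rewrite row_mul; apply/rowP => j; rewrite EE mxE [RHS]mxE mxE.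
  by case: eqP => [<-|_]; [case: (b i) | rewrite !andbF; case: (b j)].
have inE (x : 'rV[k]_n) : (x <= E)%MS <-> forall i, ~~ b i -> x 0 i = 0.
  split=> [/submxP[u ->] i /negPf bi|h]; first by rewrite EE bi.
  suff -> : x = x *m E by apply: submxMl.
  by apply/rowP => i; rewrite EE; case: ifPn => // /h.
exists (fun i : 'I_#|b| => delta_mx 0 (enum_val i)); split=> [i|x hx|c hc].
- apply/inE => j bj; rewrite mxE; case: eqP => // _ /=; case: eqP => // e.
  by have := enum_valP i; rewrite -e /in_mem /= (negPf bj).
- exists (\row_i x 0 (enum_val i)); apply/rowP => j; rewrite [RHS]mxE mxE [X in _ + X]mxE.
  rewrite /lincomb summxE; have [bj|bj] := boolP (b j).
    rewrite (bigD1 (enum_rank_in (bj : j \in b) j)) //= big1 ?addr0.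
      by rewrite !mxE enum_rankK_in // !eqxx mulr1 subrr.
    move=> i ne; rewrite !mxE eqxx /=; case: eqP => [e|_]; last by rewrite mulr0.
    by case/eqP: ne; apply: enum_val_inj; rewrite enum_rankK_in // -e.
  rewrite big1 => [|i _]; first by rewrite (inE x).1 // subrr.
  rewrite !mxE eqxx /=; case: eqP => [e|_]; last by rewrite mulr0.
  by have := enum_valP i; rewrite -e /in_mem /= (negPf bj).
- apply/rowP => i; have := congr1 (fun u : 'rV[k]_n => u 0 (enum_val i)) hc.
  rewrite /lincomb summxE (bigD1 i) //= big1 ?addr0 => [|j ne]; rewrite !mxE.
    by rewrite !eqxx mulr1.
  by rewrite (inj_eq enum_val_inj) eq_sym (negPf ne) andbF mulr0.
Qed.

Section Simples.
Variables (k : fieldType) (A : algType k) (Q : quiver) (good : pred (qpath Q)).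
Variables (G : Q0 Q -> seq (qpath Q)) (pa : qpath Q -> A) (coef : qpath Q -> A -> k).
Hypothesis pb : path_basis good G pa coef.
Implicit Types (p q r : qpath Q) (v w : Q0 Q) (a b : A).

Local Notation vtx := (vtx pa).
Local Notation Pmod := (Pmod pb).

Lemma pathv_inj : injective (@pathv Q).
Proof. by move=> v w /(congr1 (@ptgt Q)). Qed.

Lemma sum_trivial (F : qpath Q -> k) v :
  \sum_w \sum_(p <- G w) F p * (p == pathv v)%:R = F (pathv v).
Proof.
rewrite (bigD1 v) //= [X in _ + X]big1 ?addr0 => [|w wv].
  rewrite (bigD1_seq (pathv v)) ?(pb_uniq pb) //=; last first.
    by rewrite (pb_mem pb) eqxx (pb_trivial pb).
  by rewrite eqxx mulr1 big1 ?addr0 // => p /negPf ->; rewrite mulr0.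
rewrite big_seq big1 // => p; rewrite (pb_mem pb) => /andP[/eqP tp _].
by case: eqP => [e|_]; [move: wv; rewrite -tp e eqxx | rewrite mulr0].
Qed.

(** A product of two paths is trivial only if both factors are that trivial path. *)
Lemma coef_trivM v p b : good p ->
  coef (pathv v) (pa p * b) = (p == pathv v)%:R * coef (pathv v) b.
Proof.
move=> gp; have gv := pb_trivial pb v.
rewrite {1}(pb_expand pb b) mulr_sumr (acoef_sum pb) // mulrC.
rewrite -(sum_trivial (fun p => coef p b) v) mulr_suml; apply: eq_bigr => w _.
rewrite mulr_sumr (acoef_sum pb) // mulr_suml big_seq [RHS]big_seq; apply: eq_bigr => q.
rewrite (pb_mem pb) => /andP[_ gq]; rewrite -scalerAr (acoefZ pb) // -mulrA; congr (_ * _).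
rewrite (pb_mul pb); case: pcatP => [r e tr sr ar|ne] /=.
  have e0 : (q == pathv v) && (p == pathv v) = (r == pathv v).
    apply/andP/eqP => [[/eqP eq /eqP ep]|er].
      by apply: qpath_eq; rewrite ?tr ?ar ep ?eq.
    move: ar; rewrite er /=; case ep : (parr p) => //; case eq : (parr q) => // _.
    have tp : ptgt p = v by rewrite -tr er.
    have tq : ptgt q = v by rewrite -e /psrc ep /= tp.
    by split; apply/eqP/qpath_eq.
  rewrite -natrM mulnb e0; have [gr|br] := boolP (good r); first by rewrite (pb_coef pb).
  rewrite (pb_bad pb) // (acoef0 pb) //; case: eqP => // er.
  by move: br; rewrite er (pb_trivial pb).
rewrite (acoef0 pb) //; have [eq|_] := eqVneq q (pathv v); last by rewrite mul0r.
have [ep|_] := eqVneq p (pathv v); last by rewrite mulr0.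
by case: ne; rewrite ep eq.
Qed.

(** Multiplicativity of this coefficient is what defines the simple module at v. *)
Lemma coef_trivMM v a b :
  coef (pathv v) (a * b) = coef (pathv v) a * coef (pathv v) b.
Proof.
have gv := pb_trivial pb v.
rewrite {1}(pb_expand pb a) mulr_suml (acoef_sum pb) //.
rewrite -(sum_trivial (fun p => coef p a) v) mulr_suml; apply: eq_bigr => w _.
rewrite [in LHS]mulr_suml (acoef_sum pb) // mulr_suml big_seq [RHS]big_seq; apply: eq_bigr => q.
rewrite (pb_mem pb) => /andP[_ gq].
by rewrite -scalerAl (acoefZ pb) // coef_trivM // mulrA.
Qed.

Section Simple.
Variable v : Q0 Q.

Definition simp_act a : 'M[k]_1 := (coef (pathv v) a)%:M.

Lemma simp_act_linear : linear simp_act.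
Proof.
move=> c a b; rewrite /simp_act (pb_linear pb) ?(pb_trivial pb) //.
by rewrite raddfD /= scale_scalar_mx.
Qed.

Lemma coef_triv_vtx w : coef (pathv v) (vtx w) = (w == v)%:R.
Proof. by rewrite (pb_coef pb) ?(pb_trivial pb) // (inj_eq pathv_inj). Qed.

Lemma simp_act1 : simp_act 1 = 1%:M.
Proof.
rewrite /simp_act (pb_one pb) (acoef_sum pb) ?(pb_trivial pb) //.
rewrite (bigD1 v) //= coef_triv_vtx eqxx big1 ?addr0 // => w /negPf wv.
by rewrite coef_triv_vtx wv.
Qed.

Lemma simp_actM a b : simp_act (a * b) = simp_act a *m simp_act b.
Proof. by rewrite /simp_act coef_trivMM -scalar_mxM. Qed.

Definition Smod : fdmod A := Fdmod simp_act_linear simp_act1 simp_actM.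

End Simple.

Lemma homdim_Smod v w : homdim (Pmod v) (Smod w) = (v == w).
Proof.
rewrite homdim_Pmod /= /simp_act coef_triv_vtx; case: eqP => _; first exact: mxrank1.
by rewrite -[X in \rank X]scalemx1 scale0r mxrank0.
Qed.

(** Right multiplication by e_v is diagonal in the path basis of P_w: it keeps the paths with source
    v and kills the others. *)
Lemma homdim_Pmod2 v w : homdim (Pmod v) (Pmod w) = count (fun p => psrc p == v) (G w).
Proof.
rewrite homdim_Pmod /=.
have -> : @proj_act k A Q G pa coef w (vtx v) =
    \matrix_(i, j) (if (psrc (@bpath Q G w i) == v) && (i == j) then 1 else 0).
  apply/matrixP => i j; rewrite !mxE (paM_vtx pb); case: eqP => _ /=.
    rewrite (pb_coef pb) ?(bpath_good pb) // (inj_eq (@bpath_inj _ _ _ _ _ _ _ pb w)).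
    by case: eqP.
  by rewrite (acoef0 pb) // (bpath_good pb).
rewrite mxrank_diag_bool -sum1_card -sum1_count (big_nth (pathv w)) big_mkord.
by apply: eq_bigl.
Qed.

End Simples.

(** * Splitting an indecomposable projective off a projective module *)

Section SplitOff.
Variables (k : fieldType) (A : algType k) (Q : quiver) (good : pred (qpath Q)).
Variables (G : Q0 Q -> seq (qpath Q)) (pa : qpath Q -> A) (coef : qpath Q -> A -> k).
Hypothesis pb : path_basis good G pa coef.
Implicit Types (p q r : qpath Q) (v w : Q0 Q) (a b : A).

Local Notation vtx := (vtx pa).
Local Notation Pmod := (Pmod pb).
Local Notation Smod := (Smod pb).

Lemma longest_path (M : fdmod A) : M <> 0%N :> nat ->
  exists2 p, mact M (pa p) <> 0 &
    forall q, (size (parr p) < size (parr q))%N -> mact M (pa q) = 0.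
Proof.
move=> M0; have [m hm] := pb_bounded pb.
pose P n := `[< exists p, size (parr p) = n /\ mact M (pa p) <> 0 >].
have m0 : mact M 0 = 0 by rewrite -[0](scale0r 0) mactZ scale0r.
have exP : exists n, P n.
  have [v hv] : exists v, mact M (vtx v) <> 0.
    apply: contrapT => nex; apply: M0.
    have : mact M 1 = 0.
      rewrite (pb_one pb) mact_sum big1 // => v _; apply: contrapT => h.
      by apply: nex; exists v.
    by rewrite mact1 => e; apply/eqP; rewrite -(mxrank1 k M) e mxrank0.
  by exists 0%N; apply/asboolP; exists (pathv v).
have bP n : P n -> (n <= m)%N.
  move=> /asboolP[p [<- hp]]; apply/ltnW/hm; apply/negPn/negP => bp.
  by apply: hp; rewrite (pb_bad pb).
case: (ex_maxnP exP bP) => n /asboolP[p [sp hp]] maxn; exists p => // q lt.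
apply: contrapT => hq; have := maxn (size (parr q)); rewrite leqNgt -sp lt => h.
by have : false by apply: h; apply/asboolP; exists q.
Qed.

(* A path of maximal length acting nontrivially on M gives a quotient of M which
   is simple. *)
Lemma socle_functional (M : fdmod A) : M <> 0%N :> nat ->
  exists v (l : 'cV[k]_M), l <> 0 /\ @is_hom k A M (Smod v) l.
Proof.
move=> /longest_path[p hp maxp]; pose v := ptgt p; exists v.
have hl a : mact M a *m mact M (pa p) = coef (pathv v) a *: mact M (pa p).
  rewrite {1}(pb_expand pb a) -(sum_trivial pb (fun p => coef p a) v).
  rewrite mact_sum mulmx_suml scaler_suml; apply: eq_bigr => w _.
  rewrite mact_sum mulmx_suml scaler_suml; apply: eq_bigr => q _.
  rewrite mactZ -scalemxAl -mactM -scalerA; congr (_ *: _).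
  have [->|ne] := eqVneq q (pathv v).
    by rewrite -/(vtx v) (vtxM pb) eqxx scale1r.
  rewrite scale0r (pb_mul pb); case: pcatP => [r e tr sr ar|_] /=.
    apply: maxp; rewrite ar size_cat -[X in (X < _)%N]add0n ltn_add2r lt0n.
    apply/eqP => /size0nil eq; case/eqP: ne; apply: qpath_eq => //.
    by move: e; rewrite /psrc eq.
  by rewrite -[0](scale0r 0) mactZ scale0r.
have [j hj] : exists j, col j (mact M (pa p)) <> 0.
  apply: contrapT => nex; apply: hp; apply/matrixP => i j; rewrite [RHS]mxE.
  have e : col j (mact M (pa p)) = 0 by apply: contrapT => h; apply: nex; exists j.
  by have := congr1 (fun u : 'cV[k]_M => u i 0) e; rewrite !mxE.
exists (col j (mact M (pa p))); split=> // a.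
by rewrite /= /simp_act colE mulmxA hl -scalemxAl mul_mx_scalar.
Qed.

(* A nonzero map from M to a simple and the projective cover of this simple lift
   to each other; the composite endomorphism of P_v is unitriangular with respect
   to path length, hence invertible. *)
Lemma split_off (M : fdmod A) : projective M -> M <> 0%N :> nat ->
  exists v (r : 'M[k]_(M, Pmod v)) (s : 'M[k]_(Pmod v, M)),
    [/\ is_hom r, is_hom s & s *m r = 1%:M].
Proof.
move=> pM /socle_functional[v [l [l0 hl]]]; exists v.
pose c : 'M[k]_(Pmod v, Smod v) := @hom_of k A Q good G pa coef pb (Smod v) v 1%:M.
have hc : is_hom c by apply: hom_of_hom.
have cE i : c i 0 = (i == triv pb v)%:R.
  rewrite mxE mul1mx /= /simp_act mxE mulr1n (pb_coef pb) ?(pb_trivial pb) ?(bpath_good pb) //.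
  by rewrite -{1}(trivE pb v) (inj_eq (@bpath_inj _ _ _ _ _ _ _ pb v)).
have full1 n (u : 'cV[k]_n) : u <> 0 -> row_full u.
  move=> u0; rewrite -col_leq_rank lt0n mxrank_eq0; exact/eqP.
have c0 : c <> 0.
  by move/matrixP/(_ (triv pb v) 0); rewrite cE eqxx mxE => /eqP; rewrite oner_eq0.
have [s hs es] := @projective_Pmod k A Q good G pa coef pb v _ _ _ _ hl hc (full1 _ _ l0).
have [r hr er] := pM _ _ _ _ hc hl (full1 _ _ c0).
pose F := s *m r; have hF : is_hom F by apply: is_homM.
have Fc : F *m c = c by rewrite -mulmxA er.
pose sz i := size (parr (@bpath Q G v i)).
(* The entry F i j collects the products of a path l' with path i that equal path j. When path j is
   not longer than path i, only the trivial l' contributes, and its coefficient is 1 because F is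
   compatible with c. *)
have FE i j : (sz j <= sz i)%N -> F i j = (i == j)%:R.
  move=> le; have := hom_row hF i; move/rowP/(_ j); rewrite mxE => ->.
  have u1 : F (triv pb v) (triv pb v) = 1.
    have := congr1 (fun u : 'M[k]_(Pmod v, 1) => u (triv pb v) 0) Fc.
    rewrite cE eqxx mxE (bigD1 (triv pb v)) //= cE eqxx mulr1 big1 ?addr0 // => l' ne.
    by rewrite cE (negPf ne) mulr0.
  have entry l' : mact (Pmod v) (pa (@bpath Q G v i)) l' j =
      if l' == triv pb v then (i == j)%:R else 0.
    rewrite /= mxE; case: eqP => [->|ne].
      rewrite trivE -/(vtx v) (vtx_bpath pb) (pb_coef pb) ?(bpath_good pb) //.
      by rewrite (inj_eq (@bpath_inj _ _ _ _ _ _ _ pb v)).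
    rewrite (pb_mul pb); case: pcatP => [q e tq sq aq|_] /=; last by rewrite (acoef0 pb) // (bpath_good pb).
    have [gq|bq] := boolP (good q); last first.
      by rewrite (pb_bad pb) // (acoef0 pb) // (bpath_good pb).
    rewrite (pb_coef pb) ?(bpath_good pb) //; case: eqP => // eq.
    case: ne; apply: (@bpath_inj _ _ _ _ _ _ _ pb v); rewrite trivE.
    move: le; rewrite /sz -eq aq size_cat -[X in (_ <= X)%N]add0n leq_add2r leqn0 => /eqP/size0nil en.
    by apply: qpath_eq; rewrite ?en //; case: (bpathP pb l').
  rewrite mxE (bigD1 (triv pb v)) //= [X in _ + X]big1 ?addr0 => [|l' ne].
    by rewrite entry eqxx mxE u1 mul1r.
  by rewrite entry (negPf ne) mulr0.
have uF : F \in unitmx.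
  rewrite -row_free_unit -kermx_eq0; apply/eqP/row_matrixP => i0; rewrite row0.
  set x := row i0 _; have xF : x *m F = 0 by rewrite /x -row_mul mulmx_ker row0.
  apply/eqP; apply: contrapT => /negP x0.
  have [i xi] : exists i, x 0 i != 0.
    apply: contrapT => nex; case/negP: x0; apply/eqP/rowP => i; rewrite [RHS]mxE.
    by apply: contrapT => /eqP h; apply: nex; exists i.
  (* Among the nonzero coordinates of x, take one whose path is shortest: there x F has the same
     entry as x. *)
  case: (@arg_minnP _ i (fun i => x 0 i != 0) sz xi) => j xj minj.
  have := congr1 (fun u : 'rV[k]_(Pmod v) => u 0 j) xF; rewrite !mxE (bigD1 j) //= FE // eqxx mulr1.
  rewrite big1 ?addr0 => [e|l' ne]; first by rewrite e eqxx in xj.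
  have [->|xl] := eqVneq (x 0 l') 0; first by rewrite mul0r.
  by rewrite FE ?(negPf ne) ?mulr0 //; apply: minj.
exists (r *m invmx F), s; split=> //; last by rewrite mulmxA mulmxV.
apply: is_homM => // a; apply: (can_inj (mulmxK uF)).
by rewrite -!mulmxA mulVmx // mulmx1 hF mulmxA mulVmx // mul1mx.
Qed.

End SplitOff.

(** * The path basis of a presented algebra *)

Section Presentation.
Variables (k : fieldType) (Q : quiver) (I : set (pathalg k Q)).
Variables (A : algType k) (pi : {rmorphism pathalg k Q -> A}).
Hypothesis hI : is_ideal I.
Hypothesis gI : gen_by_length_two I.
Variable m : nat.
Hypothesis hm : (arrow_ideal_pow m `<=` I)%classic.
Hypothesis hpi : presents I pi.
Implicit Types (x y : pathalg k Q) (p q r : qpath Q) (v w : Q0 Q).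

Lemma piM x y : pi (x * y) = pi x * pi y. Proof. exact: rmorphM. Qed.
Lemma piB x y : pi (x - y) = pi x - pi y. Proof. exact: rmorphB. Qed.
Lemma piD x y : pi (x + y) = pi x + pi y. Proof. exact: rmorphD. Qed.
Lemma pi_sum (T : Type) (s : seq T) (F : T -> pathalg k Q) :
  pi (\sum_(i <- s) F i) = \sum_(i <- s) pi (F i).
Proof. exact: rmorph_sum. Qed.

Lemma piZ c x : pi (c *: x) = c *: pi x.
Proof. by case: hpi => h _ _; apply: h. Qed.

Lemma pi_eq0 x : pi x = 0 <-> I x.
Proof. by case: hpi. Qed.

(** A mere choice of preimages. The coefficients read off from it are nevertheless linear at good
    paths, since elements of I have coefficient 0 there. *)
Definition pi_lift (a : A) : pathalg k Q :=
  let: And3 _ h _ := hpi in projT1 (cid (h a)).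

Lemma pi_liftK a : pi (pi_lift a) = a.
Proof. by rewrite /pi_lift; case: hpi => ? h ?; case: cid. Qed.

Lemma pcoef_pi p x y : goodp I p -> pi x = pi y -> pcoef p x = pcoef p y.
Proof.
move=> gp e; have h : I (x - y) by apply/pi_eq0; apply: (etrans (piB _ _)); rewrite e subrr.
have := ideal_pcoef gI h gp; move=> h0; apply/eqP; rewrite -subr_eq0 -h0; apply/eqP.
exact/esym/pcoefB.
Qed.

Lemma sum_by_target (F : qpath Q -> A) x :
  (forall p, ~~ goodp I p -> F p = 0) -> (forall p, p \notin msupp x -> F p = 0) ->
  \sum_(p <- msupp x) F p = \sum_v \sum_(p <- good_paths I m v) F p.
Proof.
move=> F0 Fx; rewrite (partition_big (@ptgt Q) xpredT) //=; apply: eq_bigr => v _.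
rewrite (bigID (goodp I)) /= addrC big1 ?add0r; last by move=> p /andP[_ /F0].
rewrite [RHS](bigID (fun p => p \in msupp x)) /= [X in _ = _ + X]big1 ?addr0; last first.
  by move=> p; apply: Fx.
rewrite -big_filter -[RHS]big_filter; apply: perm_big; apply: uniq_perm.
- by rewrite filter_uniq // fset_uniq.
- by rewrite filter_uniq // good_paths_uniq.
- by move=> p; rewrite !mem_filter (mem_good_paths hI gI hm) andbC.
Qed.

Definition path_class p : A := pi (pbase k p).
Definition path_coef p (a : A) : k := pcoef p (pi_lift a).

Lemma presentation_basis :
  path_basis (goodp I) (good_paths I m) path_class path_coef.
Proof.
split.
- exact: mem_good_paths.
- exact: good_paths_uniq.
- by [].
- by exists m => p; apply: goodp_size.
- move=> p gp c a b; rewrite /path_coef -pcoefZ -pcoefD; apply: pcoef_pi => //.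
  by rewrite pi_liftK; apply/esym; apply: (etrans (piD _ _)); rewrite piZ !pi_liftK.
- move=> p q gp gq; rewrite /path_coef -(pcoefU k); apply: pcoef_pi => //.
  by rewrite pi_liftK.
- by move=> p bp; apply/pi_eq0/(bad_ideal hI).
- move=> a; rewrite -[LHS]pi_liftK {1}[pi_lift a]pathalg_sumE pi_sum.
  under eq_bigr do rewrite piZ.
  apply: sum_by_target => p hp; last by rewrite /path_coef /pcoef mcoeff_outdom // scale0r.
  suff -> : pi (pbase k p) = 0 by rewrite scaler0.
  exact/pi_eq0/(bad_ideal hI).
- move=> p q; apply: (etrans (esym (piM _ _))); rewrite pbaseM.
  by case: (pcat p q) => [r|] //=; exact: rmorph0.
- by rewrite -(rmorph1 pi) -pi_sum.
Qed.

End Presentation.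

Section K0Basis.
Variables (k : fieldType) (A : algType k) (Q : quiver) (good : pred (qpath Q)).
Variables (G : Q0 Q -> seq (qpath Q)) (pa : qpath Q -> A) (coef : qpath Q -> A -> k).
Hypothesis pb : path_basis good G pa coef.
Implicit Types (v w : Q0 Q).

Let pP v : projective (Pmod pb v) := @projective_Pmod _ _ _ _ _ _ _ pb v.

Definition K0vtx v : K0 A := @K0proj k A (Q0 Q) (Pmod pb) pP v.

Lemma chi_conc (M N : fdmod A) : chi (conc M 0) (conc N 0) = homdim M N.
Proof.
have z (L : fdmod A) (i : int) : i != 0 -> at_zero L (i - 0) = 0%N :> nat.
  by move=> h; apply: at_zero_out; rewrite subr0.
rewrite /chi (@isumE _ 0); last first.
  move=> i lt; rewrite /isum fsbig1 ?mulr0 // => j _.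
  by rewrite homdim0 ?mulr0 //; left; apply: z; rewrite -absz_eq0 -lt0n.
rewrite /window /= big_seq1 (@isumE _ 0); last first.
  move=> j lt; rewrite homdim0 ?mulr0 //; right; apply: z.
  by rewrite -absz_eq0 -lt0n.
by rewrite /window /= big_seq1 !mul1r.
Qed.

Lemma euler_K0vtx v w : euler_form (K0vtx v) (K0vtx w) = count (fun p => psrc p == v) (G w).
Proof.
rewrite /K0vtx /K0proj euler_K0of.
rewrite (euler_cplxE _ (@projective_conc k A _ 0 (@pP v)) (quasi_iso_id _)).
by rewrite chi_conc homdim_Pmod2.
Qed.

(** The simple at w need not be perfect when the global dimension is infinite, so the pairing is
    taken between complexes, where only the first argument is resolved, and then extended to K_0. *)
Definition vtx_rank w (x : K0 A) : int :=
  K0ext (fun X => euler_cplx X (conc (Smod pb w) 0)) x.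

Lemma K0ext_zmod (h : perf A -> int) :
  (forall X Y Z : perf A, triangle X Y Z -> h Y = h X + h Z) -> zmod_morphism (K0ext h).
Proof.
move=> tri x y; rewrite -[x]K0cls_repr -[y]K0cls_repr -raddfB !(K0ext_cls _ tri).
exact: (raddfB (zext h)).
Qed.

Lemma vtx_rank_zmod w : zmod_morphism (vtx_rank w).
Proof. by apply: K0ext_zmod => X Y Z t; apply: euler_triangle_l. Qed.

HB.instance Definition _ w :=
  GRing.isZmodMorphism.Build (K0 A) int (vtx_rank w) (vtx_rank_zmod w).

Lemma vtx_rank_K0vtx v w : vtx_rank w (K0vtx v) = (v == w).
Proof.
rewrite /vtx_rank /K0vtx /K0proj /K0of K0ext_cls; last first.
  by move=> X Y Z t; apply: euler_triangle_l.
rewrite zextU.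
rewrite (euler_cplxE _ (@projective_conc k A _ 0 (@pP v)) (quasi_iso_id _)).
by rewrite chi_conc homdim_Smod.
Qed.

Lemma vtx_rank_sum (c : Q0 Q -> int) w : vtx_rank w (\sum_v K0vtx v *~ c v) = c w.
Proof.
rewrite raddf_sum (bigD1 w) //= big1 ?addr0 => [|v vw]; rewrite raddfMz /= vtx_rank_K0vtx.
  by rewrite eqxx intz.
by rewrite (negPf vw) mul0rz.
Qed.

Lemma K0vtx_expand (x : K0 A) : x = \sum_v K0vtx v *~ vtx_rank v x.
Proof.
have [c e] := K0spanning pP (@Pmod_neq0 _ _ _ _ _ _ _ pb) (@split_off _ _ _ _ _ _ _ pb) x.
rewrite {1}e; apply: eq_bigr => v _; congr (_ *~ _).
by rewrite e (vtx_rank_sum c).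
Qed.

End K0Basis.

(** * Polarizations and the multi-clock condition *)

(* The half-arrows at a vertex are split into two classes: ts b (resp. tt b) is
   the class of b at its source (resp. target), and two composable arrows have a
   nonzero product exactly when they meet in the same class. *)
Definition polarization (Q : quiver) (nz : rel (Q1 Q)) (ts tt : Q1 Q -> bool) : Prop :=
  [/\ forall a b, a != b -> qs a = qs b -> ts a != ts b,
      forall a b, a != b -> qt a = qt b -> tt a != tt b
    & forall b a, nz b a = (qs b == qt a) && (ts b == tt a)].

Section Polarization.
Variables (k : fieldType) (Q : quiver) (I : set (pathalg k Q)).
Hypothesis gQ : gentle I.
Local Notation nz := (nz I).

Lemma arrM_neq0 (b a : Q1 Q) : qs b = qt a -> arr k b * arr k a <> 0.
Proof.
move=> e; have [p ep _] := pcat_arrow e; rewrite /arr (pbaseMS k ep) => h.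
have : pcoef p (pbase k p) = 0 by rewrite h; exact: (linear0 (pcoef p)).
by rewrite pcoefU eqxx => /eqP; rewrite oner_eq0.
Qed.

Lemma nzPn (b a : Q1 Q) : ~~ nz b a -> I (arr k b * arr k a).
Proof. by move=> /asboolPn/contrapT. Qed.

Lemma three_in_two (T : finType) (S : {set T}) a b c :
  (#|S| <= 2)%N -> a \in S -> b \in S -> c \in S -> a != b -> c != a -> c = b.
Proof.
move=> le ha hb hc ab ca; apply/eqP; apply: contraTT le => cb; rewrite -ltnNge.
apply: (@leq_trans #|[set a; b; c]|).
  by rewrite -finset.setUA !cardsU1 cards1 !inE negb_or ab (eq_sym a c) ca (eq_sym b c) cb.
by apply: subset_leq_card; apply/fintype.subsetP => x; rewrite !inE => /orP[/orP[]|] /eqP ->.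
Qed.

(** At each vertex one incoming arrow is the reference and gets class false; an outgoing arrow gets
    class false when its product with the reference is nonzero. If no arrow comes in, a reference
    outgoing arrow gets class false. The degree bounds and the uniqueness conditions then force the
    remaining arrows. *)
Lemma gentle_polarization : exists ts tt, polarization nz ts tt.
Proof.
have [_ [[[hI _] _] [deg [s1 [s2 [z1 z2]]]]]] := gQ.
have nzc b a : nz b a -> qs b = qt a by apply: nz_composable.
have nzs1 b a a' : nz a b -> nz a' b -> a = a'.
  by move=> /asboolP h /asboolP h'; apply: s1 h h'.
have nzs2 b a a' : nz b a -> nz b a' -> a = a'.
  by move=> /asboolP h /asboolP h'; apply: s2 h h'.
have zz1 b a a' : qs a = qt b -> qs a' = qt b -> ~~ nz a b -> ~~ nz a' b -> a = a'.
  move=> e e' /nzPn h /nzPn h'.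
  exact: z1 (arrM_neq0 e) h (arrM_neq0 e') h'.
have zz2 b a a' : qs b = qt a -> qs b = qt a' -> ~~ nz b a -> ~~ nz b a' -> a = a'.
  move=> e e' /nzPn h /nzPn h'.
  exact: z2 (arrM_neq0 e) h (arrM_neq0 e') h'.
have three (f : Q1 Q -> Q0 Q) a b c : (#|[set x | f x == f a]| <= 2)%N ->
    f b = f a -> f c = f a -> a != b -> c != a -> c = b.
  by move=> le eb ec; apply: three_in_two le _ _ _; rewrite inE ?eb ?ec.
pose ref_in (v : Q0 Q) := [pick a : Q1 Q | qt a == v].
pose ref_out (v : Q0 Q) := [pick a : Q1 Q | qs a == v].
pose tt (a : Q1 Q) := ref_in (qt a) != Some a.
pose ts (b : Q1 Q) := if ref_in (qs b) is Some a then ~~ nz b a else ref_out (qs b) != Some b.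
exists ts, tt; split=> [a b ab e|a b ab e|b a].
- rewrite /ts -e /ref_in; case: pickP => [c /eqP hc|_].
    apply/eqP => h; case nza : (nz a c) h => /= h.
      have nzb : nz b c by move: h; case: (nz b c).
      by rewrite (nzs1 _ _ _ nza nzb) eqxx in ab.
    have nzb : ~~ nz b c by rewrite -h.
    by rewrite (@zz1 c a b) ?eqxx ?nza // -?e ?hc in ab.
  rewrite /ref_out; case: pickP => [c /eqP hc|/(_ a)]; last by rewrite eqxx.
  apply/eqP => h; have := three _ _ _ _ (deg (qs a)).1 (esym e) hc ab.
  case: (eqVneq c a) h => [-> h _|ca h /(_ isT) cb].
    by move: h; rewrite eqxx => /esym/negbFE/eqP[e']; rewrite e' eqxx in ab.
  by move: h; rewrite cb eqxx => /negbFE/eqP[e']; rewrite e' eqxx in ab.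
- rewrite /tt -e /ref_in; case: pickP => [c /eqP hc|/(_ a)]; last by rewrite eqxx.
  apply/eqP => h; have := three _ _ _ _ (deg (qt a)).2 (esym e) hc ab.
  case: (eqVneq c a) h => [-> h _|ca h /(_ isT) cb].
    by move: h; rewrite eqxx => /esym/negbFE/eqP[e']; rewrite e' eqxx in ab.
  by move: h; rewrite cb eqxx => /negbFE/eqP[e']; rewrite e' eqxx in ab.
- apply/idP/andP => [h|[/eqP e]].
    have e := nzc _ _ h; rewrite e eqxx; split=> //; rewrite /ts /tt e /ref_in.
    case: pickP => [c /eqP hc|/(_ a)]; last by rewrite eqxx.
    have [->|ca] := eqVneq c a; first by rewrite h eqxx.
    have -> : Some c == Some a = false by apply/negbTE; apply: contra ca => /eqP[->].
    apply/eqP; apply/negP => hc'; move/eqP: ca; apply; exact: nzs2 hc' h.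
  rewrite /ts /tt e /ref_in; case: pickP => [c /eqP hc|/(_ a)]; last by rewrite eqxx.
  have [->|ca] := eqVneq c a; first by rewrite eqxx => /eqP/negbFE.
  have -> : Some c == Some a = false by apply/negbTE; apply: contra ca => /eqP[->].
  move=> /eqP nzc'; apply: contraNT ca => nza; apply/eqP.
  exact: (zz2 b c a (etrans e (esym hc)) e nzc' nza).
Qed.

End Polarization.

Section XorSums.
Variable T : eqType.
Implicit Types (s : seq T).

Lemma odd_count (P : pred T) s : odd (count P s) = \big[addb/false]_(x <- s) P x.
Proof.
elim: s => [|x s IHs]; first by rewrite big_nil.
by rewrite big_cons /= oddD IHs; case: (P x).
Qed.

Lemma rot1_perm s : perm_eq (rot 1 s) s.
Proof. by rewrite perm_rot. Qed.

Lemma xor_split (f g : T -> bool) s :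
  \big[addb/false]_(x <- s) f x (+) \big[addb/false]_(x <- s) g x =
  \big[addb/false]_(x <- s) (f x (+) g x).
Proof. by rewrite big_split. Qed.

Lemma xor_zip (f g : T -> bool) s t : size s = size t ->
  \big[addb/false]_(z <- zip s t) (f z.1 (+) g z.2) =
  (\big[addb/false]_(x <- s) f x) (+) (\big[addb/false]_(y <- t) g y).
Proof.
elim: s t => [|x s IHs] [|y t] //=; first by rewrite !big_nil.
move=> [e]; rewrite !big_cons IHs //=.
by case: (f x); case: (g y); case: (\big[addb/false]_(x <- s) f x); case: (\big[addb/false]_(y <- t) g y).
Qed.

Lemma zip_rot1_perm s n : perm_eq (zip (rot n s) (rot 1 (rot n s))) (zip s (rot 1 s)).
Proof.
rewrite rot_rot; move: (rot 1 s) (size_rot 1 s) => t e.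
suff -> : zip (rot n s) (rot n t) = rot n (zip s t) by rewrite perm_rot.
rewrite /rot zip_cat ?size_drop ?e //; congr (_ ++ _).
  by elim: n s t e => [|n IHn] [|x s] [|y t] //= [/IHn].
by elim: n s t e => [|n IHn] [|x s] [|y t] //= [/IHn ->].
Qed.

Lemma zip_swap (U : eqType) s (t : seq U) :
  zip t s = [seq (z.2, z.1) | z <- zip s t].
Proof. by elim: s t => [|x s IHs] [|y t] //=; rewrite IHs. Qed.

(** Lets the relations met by the inverse walk be counted along the walk itself. *)
Lemma zip_rev_rot s :
  perm_eq (zip (rev s) (rot 1 (rev s))) [seq (z.2, z.1) | z <- zip s (rot 1 s)].
Proof.
have -> : rot 1 (rev s) = rev (rotr 1 s) by rewrite rev_rotr.
rewrite -rev_zip ?size_rotr // perm_rev.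
rewrite zip_swap; apply: perm_map.
by have := zip_rot1_perm s (size s - 1); rewrite -/(rotr 1 s) rotrK.
Qed.

Lemma uniq_zip (U : eqType) s (t : seq U) : uniq s -> uniq (zip s t).
Proof.
elim: s t => [|x s IHs] [|y t] //= /andP[nx us]; rewrite IHs // andbT.
by apply: contra nx => /(map_f fst) /= h; apply: mem_subseq h; elim: (s) (t) => [|? ? IH] [|? ?] //=; rewrite ?sub0seq // eqxx.
Qed.

Lemma mem_zip (U : eqType) s (t : seq U) z : z \in zip s t -> (z.1 \in s) && (z.2 \in t).
Proof.
elim: s t => [|x s IHs] [|y t] //=; rewrite !inE => /orP[/eqP ->|/IHs /andP[h1 h2]].
  by rewrite !eqxx.
by rewrite h1 h2 !orbT.
Qed.

Lemma cycle_zip (R : rel T) s : cycle R s = all (fun z => R z.1 z.2) (zip s (rot 1 s)).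
Proof.
have h z w t : path R z (rcons t w) = all (fun z => R z.1 z.2) (zip (z :: t) (rcons t w)).
  by elim: t z => [|y t IHt] z /=; rewrite ?andbT // IHt.
by case: s => // x s; rewrite rot1_cons /= h.
Qed.

End XorSums.

(** * Signs of closed walks *)

Section MultiClock.
Variables (k : fieldType) (Q : quiver) (I : set (pathalg k Q)).
Variables (ts tt : Q1 Q -> bool).
Hypothesis pol : polarization (nz I) ts tt.

Definition step (x y : letter Q) : bool := letter_src x == letter_tgt y.

Definition src_class (x : letter Q) : bool := if x.2 then tt x.1 else ts x.1.
Definition tgt_class (x : letter Q) : bool := if x.2 then ts x.1 else tt x.1.

Definition walk_sign (w : seq (letter Q)) : bool := \big[addb/false]_(x <- w) (ts x.1 (+) tt x.1).

Definition direct_rel (z : letter Q * letter Q) : bool :=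
  [&& ~~ z.1.2, ~~ z.2.2, qs z.1.1 == qt z.2.1 & ~~ nz I z.1.1 z.2.1].

Implicit Types (w : seq (letter Q)) (x y : letter Q).

(** [nr_direct] is the size of a set of pairs; when no letter repeats, neither does a consecutive
    pair, so counting along the list gives the same number. *)
Lemma nr_directE w : uniq w -> nr_direct I w = count direct_rel (zip w (rot 1 w)).
Proof.
move=> uw; have uz := uniq_zip (rot 1 w) uw.
rewrite /nr_direct -size_filter -(card_uniqP (filter_uniq direct_rel uz)).
pose F (p : Q1 Q * Q1 Q) : letter Q * letter Q := ((p.1, false), (p.2, false)).
have iF : injective F by move=> [a b] [c d] [-> ->].
have nzE a b : ~~ nz I a b = `[< I (arr k a * arr k b) >] by rewrite /nz asbool_neg negbK.
rewrite -(card_imset _ iF); apply: eq_card => z; rewrite mem_filter.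
apply/imsetP/andP => [[p]|[/and4P[/negbTE d1 /negbTE d2 e n] hz]].
  by rewrite inE => /and3P[e hI hz] ->; split=> //; rewrite /direct_rel /= e nzE hI.
case: z d1 d2 e n hz => [[a d] [b d']] /= -> -> e n hz; exists (a, b) => //.
by rewrite inE /= e -nzE n.
Qed.

Lemma letter_neq w x y : no_repeated_edge w -> x \in w -> y \in w -> x != y -> x.1 != y.1.
Proof.
rewrite /no_repeated_edge; elim: w => //= z w IHw /andP[nz uw].
rewrite !inE => /orP[/eqP ->|hx] /orP[/eqP ->|hy] ne.
- by rewrite eqxx in ne.
- by apply: contra nz => /eqP ->; apply: map_f.
- by apply: contra nz => /eqP <-; apply: map_f.
- exact: IHw.
Qed.

(* At a change of direction the two half-arrows differ, hence lie in different
   classes; the number of such changes along a closed walk is even. *)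
Lemma odd_nr w : closed_walk w -> no_repeated_edge w -> odd (nr I w) = walk_sign w.
Proof.
have [p1 p2 p3] := pol.
move=> cw rw; have uw : uniq w by exact: map_uniq rw.
have uw' : uniq (walk_inv w).
  by rewrite /walk_inv rev_uniq map_inj_uniq // => -[a b] [c d] [-> /negb_inj ->].
pose s := [seq letter_inv x | x <- w]; pose Z := zip w (rot 1 w).
pose inv_rel (z : letter Q * letter Q) := direct_rel (letter_inv z.2, letter_inv z.1).
have e1 : nr_direct I w = count direct_rel Z by exact: nr_directE.
have ez : zip s (rot 1 s) = [seq (letter_inv z.1, letter_inv z.2) | z <- Z].
  by rewrite /s /Z -map_rot; elim: (w) (rot 1 w) => [|x u IHu] [|y v] //=; rewrite IHu.
have e2 : nr_direct I (walk_inv w) = count inv_rel Z.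
  apply: etrans (nr_directE uw') _; apply: etrans (permP (zip_rev_rot s) _) _.
  by apply: etrans (count_map _ _ _) _; rewrite ez; apply: count_map.
rewrite /nr oddD e1 e2 (odd_count direct_rel) (odd_count inv_rel) xor_split /walk_sign.
have hZ z : z \in Z -> [/\ z.1 \in w, z.2 \in w & step z.1 z.2].
  move=> hz; have /andP[h1] := mem_zip hz; rewrite mem_rot => h2; split=> //.
  by move: cw; rewrite /closed_walk cycle_zip => /allP/(_ z hz).
(* The orientation bits encode the changes of direction. They split into a part depending on z.1 and
   one depending on z.2, and these cancel once the sums are taken over the whole cycle. *)
transitivity (\big[addb/false]_(z <- Z) ((src_class z.1 (+) z.1.2) (+) (tgt_class z.2 (+) z.2.2))).
  rewrite big_seq [RHS]big_seq; apply: eq_bigr => z /hZ[].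
  case: z => [[a d] [b d']] /= ha hb; rewrite /inv_rel /step /letter_src /letter_tgt /direct_rel /src_class /tgt_class /=.
  have ne : d != d' -> a != b.
    by move=> ne; have := letter_neq rw ha hb; apply; apply: contra ne => /eqP[_ ->].
  case: d d' ha hb ne => [] [] ha hb ne /= /eqP e; rewrite ?e ?eqxx /=.
  - by rewrite p3 e eqxx /=; case: (tt a); case: (ts b).
  - by have := p2 a b (ne isT) e; case: (tt a); case: (tt b).
  - by have := p1 a b (ne isT) e; case: (ts a); case: (ts b).
  - by rewrite p3 e eqxx /=; case: (ts a); case: (tt b).
rewrite (xor_zip (fun x => src_class x (+) x.2) (fun y => tgt_class y (+) y.2)) ?size_rot //.
rewrite (perm_big _ (rot1_perm w)) xor_split; apply: eq_bigr => -[a d] _ /=.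
by rewrite /src_class /tgt_class /=; case: d; case: (ts a); case: (tt a).
Qed.

(** A switching function: the sign of each edge is the difference of its values at the two ends. *)
Definition balanced := exists sg : Q0 Q -> bool,
  forall a, sg (qs a) (+) ts a = sg (qt a) (+) tt a.

Lemma walk_sign_cat w1 w2 : walk_sign (w1 ++ w2) = walk_sign w1 (+) walk_sign w2.
Proof. exact: big_cat. Qed.

Lemma walk_sign_cons x w : walk_sign (x :: w) = (ts x.1 (+) tt x.1) (+) walk_sign w.
Proof. exact: big_cons. Qed.

Lemma balanced_multi_clock : balanced -> multi_clock I.
Proof.
move=> [sg hsg] w _ cw rw; rewrite odd_nr //.
have gE x : ts x.1 (+) tt x.1 = sg (letter_src x) (+) sg (letter_tgt x).
  move: (hsg x.1); rewrite /letter_src /letter_tgt.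
  by case: x.2; case: (ts x.1); case: (tt x.1); case: (sg (qs x.1)); case: (sg (qt x.1)).
rewrite /walk_sign; under eq_bigr do rewrite gE.
rewrite -xor_split -[X in _ (+) X](perm_big _ (rot1_perm w)).
rewrite -(xor_zip (fun x => sg (letter_src x)) (fun x => sg (letter_tgt x))) ?size_rot //.
rewrite big_seq big1 // => z hz.
by move: cw; rewrite /closed_walk cycle_zip => /allP/(_ z hz)/= /eqP ->; rewrite addbb.
Qed.

Lemma repeated_edge_split w : ~~ no_repeated_edge w ->
  exists u x v y t, w = u ++ x :: v ++ y :: t /\ x.1 = y.1.
Proof.
rewrite /no_repeated_edge; elim: w => //= x w IHw; rewrite negb_and negbK.
case/orP => [/mapP[y hy e]|/IHw[u [x' [v [y [t [-> e]]]]]]].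
  by case/splitPr: hy => v t; exists [::], x, v, y, t.
by exists (x :: u), x', v, y, t.
Qed.

Lemma step_inv x y : x.1 = y.1 -> x != y -> letter_src x = letter_tgt y /\ letter_tgt x = letter_src y.
Proof.
case: x y => [a d] [b d'] /= -> ne; rewrite /letter_src /letter_tgt /=.
by case: d d' ne => [] []; rewrite ?eqxx.
Qed.

(* Splitting off at a repeated edge reduces an arbitrary closed walk to walks
   without repeated edges. *)
Lemma multi_clock_closed : multi_clock I ->
  forall w, closed_walk w -> walk_sign w = false.
Proof.
move=> mc w; have [n] := ubnP (size w); elim: n w => // n IHn w lt cw.
have [->|nw] := eqVneq w [::]; first by rewrite /walk_sign big_nil.
have [rw|/repeated_edge_split[u [x [v [y [t [ew e]]]]]]] := boolP (no_repeated_edge w).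
  by rewrite -odd_nr //; apply/negbTE/mc => //; apply/eqP.
have sw : walk_sign w = walk_sign (x :: v ++ y :: (t ++ u)).
  rewrite ew walk_sign_cat addbC -walk_sign_cat; congr walk_sign.
  by rewrite /= -catA.
have cw' : closed_walk (x :: v ++ y :: (t ++ u)).
  have -> : x :: v ++ y :: (t ++ u) = rot (size u) w by rewrite ew rot_size_cat /= -catA.
  by rewrite /closed_walk rot_cycle.
have szw : size w = (size v + size (t ++ u)).+2.
  by rewrite ew !size_cat /= !size_cat /=; lia.
rewrite sw; move: (t ++ u) cw' szw => {sw ew}t cw' szw.
move: cw'; rewrite /closed_walk /= rcons_cat cat_path rcons_cons /= => /and3P[pv sv pt].
have [exy|nxy] := eqVneq x y.
  rewrite -cat_cons walk_sign_cat !IHn ?addbF //=; try by rewrite szw in lt; lia.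
    by rewrite /closed_walk /= -exy in pt *.
  by rewrite /closed_walk /= rcons_path pv; move: sv; rewrite /step exy => ->.
(* The edge is traversed in opposite directions, so v and t are closed walks by themselves and the
   signs of x and y cancel. *)
have [e1 e2] := step_inv e nxy.
rewrite walk_sign_cons walk_sign_cat walk_sign_cons e !IHn; try by rewrite szw in lt; lia.
- case: t pt {szw} => //= z t /andP[sz]; rewrite !rcons_path => /andP[pt lz].
  by rewrite pt /= (eqP lz) e2 (eqP sz).
- case: v pv sv {szw} => //= z v /andP[sz pv] lz.
  by rewrite rcons_path pv /= (eqP lz) -e1 (eqP sz).
Qed.

Fixpoint is_walk (u : Q0 Q) w (v : Q0 Q) : bool :=
  if w is x :: w' then (letter_tgt x == u) && is_walk (letter_src x) w' v else u == v.

Lemma is_walk_cat u v z w1 w2 : is_walk u w1 v -> is_walk v w2 z -> is_walk u (w1 ++ w2) z.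
Proof.
by elim: w1 u => [|x w1 IHw] u /=; [move=> /eqP -> | move=> /andP[-> /IHw h] /h].
Qed.

Lemma is_walk_inv u v w : is_walk u w v -> is_walk v (walk_inv w) u.
Proof.
elim: w u => [|x w IHw] u /=; first by rewrite eq_sym.
move=> /andP[/eqP <- /IHw hw]; rewrite /walk_inv /= rev_cons -cats1.
apply: is_walk_cat hw _; rewrite /= /letter_tgt /letter_src /letter_inv /=.
by case: x => a [] /=; rewrite !eqxx.
Qed.

Lemma walk_sign_inv w : walk_sign (walk_inv w) = walk_sign w.
Proof.
rewrite /walk_sign /walk_inv (perm_big _ (permEl (perm_rev _))) big_map.
exact: eq_bigr.
Qed.

Lemma is_walk_closed u w : is_walk u w u -> closed_walk w.
Proof.
case: w => //= x w /andP[/eqP <-].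
have h z : is_walk (letter_src z) w (letter_tgt x) ->
    path (fun x y => letter_src x == letter_tgt y) z (rcons w x).
  elim: w z => [|y w IHw] z /=; first by rewrite andbT.
  by move=> /andP[/eqP <- /IHw ->]; rewrite eqxx.
exact: h.
Qed.

Lemma connected_walk u v : connect (@adjacent Q) u v -> exists w, is_walk u w v.
Proof.
move=> /connectP[p]; elim: p u => [|y p IHp] u /=; first by exists [::]; apply/eqP.
move=> /andP[/existsP[a ha] /IHp h] /h[w hw].
case/orP: ha => /andP[/eqP e1 /eqP e2]; [exists ((a, true) :: w) | exists ((a, false) :: w)];
  by rewrite /= /letter_tgt /letter_src /= ?e1 ?e2 eqxx.
Qed.

(** The value at v is the sign of a chosen walk joining a base point to v; positivity of closed
    walks makes these values compatible along every arrow. *)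
Lemma multi_clock_balanced : connected_quiver Q -> multi_clock I -> balanced.
Proof.
move=> cQ /multi_clock_closed mc.
have [v0 _|nov] := pickP (fun _ : Q0 Q => true); last first.
  by exists (fun _ => false) => a; have := nov (qs a).
have /choice[W hW] : forall v, exists w, is_walk v0 w v by move=> v; apply/connected_walk/cQ.
exists (fun v => walk_sign (W v)) => a.
have hw : is_walk v0 (W (qt a) ++ (a, false) :: walk_inv (W (qs a))) v0.
  apply: is_walk_cat (hW _) _; rewrite /= /letter_tgt /letter_src /= eqxx.
  exact/is_walk_inv/hW.
have := mc _ (is_walk_closed hw); rewrite walk_sign_cat walk_sign_cons walk_sign_inv /=.
by case: (walk_sign _); case: (walk_sign _); case: (ts a); case: (tt a).
Qed.

Lemma multi_clockP : connected_quiver Q -> multi_clock I <-> balanced.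
Proof. by move=> cQ; split; [exact: multi_clock_balanced | exact: balanced_multi_clock]. Qed.

End MultiClock.

(** * The Cartan form and its kernel *)

Section KernelTranspose.
Variables (k : fieldType) (S T : finType).

Definition fspace (X : Type) : lmodType k := @dprod k X (fun _ => (k^o : lmodType k)).

Lemma reldim_leftker (U W : finType) (M : U -> W -> k) :
  reldim (fun x : fspace U => forall w, \sum_u x u * M u w = 0) (fun x => x = 0)
    (#|U| - \rank (\matrix_(i < #|U|, j < #|W|) M (enum_val i) (enum_val j)))%N.
Proof.
set B := \matrix_(_, _) _; rewrite -mxrank_ker.
pose F (x : 'rV[k]_#|U|) : fspace U := fun u => x 0 (enum_rank u).
have lF : linear F by move=> c x y; apply: dprod_ext => u; rewrite dprodP /F !mxE.
pose F' : {linear 'rV[k]_#|U| -> fspace U} := HB.pack F (GRing.isLinear.Build _ _ _ _ F lF).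
have FB (x : 'rV_#|U|) j : (x *m B) 0 j = \sum_u F x u * M u (enum_val j).
  rewrite mxE (reindex (@enum_rank U)) /=; last exact: onW_bij (@enum_rank_bij U).
  by apply: eq_bigr => u _; rewrite mxE enum_rankK.
apply: (reldim_transfer (F := F')) (reldim_kermx B).
- by split=> [|c x y hx hy]; rewrite ?mul0mx // mulmxDl -scalemxAl hx hy scaler0 addr0.
- exact: subspace_eq0.
- move=> x hx w; have := FB x (enum_rank w); rewrite enum_rankK => <-.
  by rewrite hx mxE.
- move=> x _; split=> [->|h]; first by rewrite linear0.
  apply/rowP => i; rewrite mxE -[i]enum_valK.
  by have := congr1 (fun f : fspace U => f (enum_val i)) h.
- move=> x hx; exists (\row_i x (enum_val i)); last first.
    by apply: dprod_ext => u; rewrite dprodB /= /F mxE enum_rankK subrr.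
  apply/rowP => j; rewrite FB mxE -[RHS](hx (enum_val j)).
  by apply: eq_bigr => u _; rewrite /F mxE enum_rankK.
Qed.

Lemma reldim_transpose (B : S -> T -> k) d : #|S| = #|T| ->
  reldim (fun y : fspace T => forall s, \sum_t B s t * y t = 0) (fun y => y = 0) d ->
  reldim (fun x : fspace S => forall t, \sum_s x s * B s t = 0) (fun x => x = 0) d.
Proof.
move=> e h; have hT := reldim_leftker (fun t s => B s t); have hS := reldim_leftker B.
suff -> : d = (#|S| - \rank (\matrix_(i < #|S|, j < #|T|) B (enum_val i) (enum_val j)))%N by [].
rewrite {1}e; rewrite -(mxrank_tr (\matrix_(i < #|S|, j < #|T|) _)).
have -> : (\matrix_(i < #|S|, j < #|T|) B (enum_val i) (enum_val j))^T =
  \matrix_(i < #|T|, j < #|S|) B (enum_val j) (enum_val i) by apply/matrixP => i j; rewrite !mxE.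
apply: (reldim_unique (@subspace_eq0 k _) h).
apply: reldim_ext hT => // y; split=> h' s; rewrite -[RHS](h' s);
  by apply: eq_bigr => t _; rewrite mulrC.
Qed.

End KernelTranspose.

Section SumOverPasses.
Variables (R : comNzRingType) (S T : finType) (f : S -> T).

Lemma sum_fibers (F : S -> R) : \sum_u \sum_(a | f a == u) F a = \sum_a F a.
Proof. by rewrite [RHS](partition_big f xpredT). Qed.

(** For sums over the arrows entering, or leaving, a passage, which have at most one term. *)
Lemma mul_sum_single (P : pred S) (F G : S -> R) :
  (forall a b, P a -> P b -> a = b) ->
  (\sum_(a | P a) F a) * (\sum_(a | P a) G a) = \sum_(a | P a) F a * G a.
Proof.
move=> h; have [a Pa|nP] := pickP P; last by rewrite !big_pred0 // mul0r.
have e (H : S -> R) : \sum_(b | P b) H b = H a.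
  by rewrite (bigD1 a) //= big1 ?addr0 // => b /andP[Pb]; rewrite (h b a) // eqxx.
by rewrite !e.
Qed.

End SumOverPasses.

Section CartanForm.
Variables (k : fieldType) (Q : quiver) (I : set (pathalg k Q)).
Hypothesis hI : is_ideal I.
Hypothesis gI : gen_by_length_two I.
Variable m : nat.
Hypothesis hm : (arrow_ideal_pow m `<=` I)%classic.
Variables (ts tt : Q1 Q -> bool).
Hypothesis pol : polarization (nz I) ts tt.
Variable R : realFieldType.
Implicit Types (x : Q0 Q -> R) (y : Q1 Q -> R) (v w : Q0 Q) (a b : Q1 Q).
Implicit Types (u : Q0 Q * bool).

Lemma nz_path_size b s : path (nz I) b s -> (size s < m)%N.
Proof.
move=> hp; have hc : composable (qt b) (b :: s) := nz_path_composable hI hp.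
have := @goodp_size k Q I hI gI m hm (@QPath Q (qt b, b :: s) hc) hp.
by rewrite /parr /= => /ltnW.
Qed.

(* The sum of x over the sources of the nonzero paths ending with the arrow b. *)
Definition arrow_sum x b : R := \sum_(s <- nz_tails I m b) x (last (qs b) [seq qs a | a <- s]).

(** A nonzero path ending with b is b alone, or b preceded by a nonzero path ending with some a such
    that b a is nonzero. *)
Lemma arrow_sum_nz x b : arrow_sum x b = x (qs b) + \sum_(a | nz I b a) arrow_sum x a.
Proof.
(* One more unit of fuel adds no path, and unfolding it leaves fuel m for the remaining paths. *)
rewrite /arrow_sum (perm_big (nz_tails I m.+1 b)); last first.
  apply: uniq_perm; try exact: nz_tails_uniq.
  move=> s; rewrite !mem_nz_tails; case hp : (path _ _ _) => //=.
  by have h := nz_path_size hp; rewrite h ltnS ltnW.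
rewrite [nz_tails _ _.+1 _]/= big_cons /=; congr (_ + _).
rewrite big_flatten big_map big_filter big_enum_cond /=; apply: eq_bigr => a _.
by rewrite big_map.
Qed.

Lemma good_paths_sum x w :
  \sum_(p <- good_paths I m w) x (psrc p) = x w + \sum_(b | qt b == w) arrow_sum x b.
Proof.
pose F (z : Q0 Q * seq (Q1 Q)) := x (last z.1 [seq qs a | a <- z.2]).
have -> : \sum_(p <- good_paths I m w) x (psrc p) = \sum_(z <- good_data I m w) F z.
  by rewrite -val_good_paths // big_map.
rewrite /good_data big_cons; congr (_ + _).
rewrite big_flatten big_map big_filter big_enum_cond /=; apply: eq_bigr => a _.
by rewrite big_map.
Qed.

(** A passage u is a vertex with a class. The polarization allows at most one arrow into u, so the
    sum is its value or 0, without a case distinction; [y_out] is analogous. *)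
Definition y_in y u : R := \sum_(a | (qt a, tt a) == u) y a.
Definition y_out y u : R := \sum_(b | (qs b, ts b) == u) y b.
Definition has_out u : bool := [exists b, (qs b, ts b) == u].
Definition pass_sum x u : R := x u.1 + y_in (arrow_sum x) u.

Lemma in_single u a b : (qt a, tt a) == u -> (qt b, tt b) == u -> a = b.
Proof.
move=> /eqP <- /eqP[e1 e2]; apply/eqP; apply: contraT => ne.
by have [_ /(_ _ _ ne (esym e1)) /eqP[]] := pol.
Qed.

Lemma out_single u a b : (qs a, ts a) == u -> (qs b, ts b) == u -> a = b.
Proof.
move=> /eqP <- /eqP[e1 e2]; apply/eqP; apply: contraT => ne.
by have [/(_ _ _ ne (esym e1)) /eqP[]] := pol.
Qed.

Lemma y_outE y b : y_out y (qs b, ts b) = y b.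
Proof.
rewrite /y_out (bigD1 b) //= big1 ?addr0 // => a /andP[ha ne].
by rewrite (out_single ha (eqxx _)) eqxx in ne.
Qed.

Lemma sum_nz y b : \sum_(a | nz I b a) y a = y_in y (qs b, ts b).
Proof.
apply: eq_bigl => a; have [_ _ ->] := pol.
by rewrite xpair_eqE [qt a == _]eq_sym [tt a == _]eq_sym.
Qed.

Lemma arrow_sumE x b : arrow_sum x b = pass_sum x (qs b, ts b).
Proof. by rewrite arrow_sum_nz sum_nz. Qed.

Lemma pass_sum_out x u : has_out u -> pass_sum x u = y_out (arrow_sum x) u.
Proof. by move=> /existsP[b /eqP <-]; rewrite y_outE arrow_sumE. Qed.

Lemma y_out0 y u : ~~ has_out u -> y_out y u = 0.
Proof.
move=> h; apply: big1 => b hb; case/negP: h; by apply/existsP; exists b.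
Qed.

Definition cartan_form x x' : R := \sum_w x' w * \sum_(p <- good_paths I m w) x (psrc p).

Lemma sum_passes (F : Q0 Q * bool -> R) : \sum_u F u = \sum_v (F (v, true) + F (v, false)).
Proof.
rewrite (eq_bigr (fun u => F (u.1, u.2))); last by case.
rewrite -(pair_bigA _ (fun v c => F (v, c))) /=.
by apply: eq_bigr => v _; rewrite big_bool.
Qed.

Lemma cartan_formE x x' :
  cartan_form x x' = \sum_v x v * x' v + \sum_u x' u.1 * y_in (arrow_sum x) u.
Proof.
rewrite /cartan_form sum_passes -big_split; apply: eq_bigr => w _ /=.
rewrite good_paths_sum mulrDr [x' w * x w]mulrC -mulrDr; congr (_ + _ * _).
rewrite (bigID (fun b => tt b)) /=; congr (_ + _); apply: eq_bigl => b;
  by rewrite xpair_eqE; case: (tt b); rewrite ?andbT ?andbF.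
Qed.

(* With y = arrow_sum x, the value of pass_sum x at a passage left by an arrow b is
   y b, so over these passages the squares add up to the sum of all (y b)^2, which
   is also the sum of the squares of the incoming terms y_in; what remains is the
   sum over the passages that no arrow leaves. *)
Lemma cartan_form_sym x x' :
  cartan_form x x' + cartan_form x' x =
  \sum_(u | ~~ has_out u) pass_sum x u * pass_sum x' u.
Proof.
set y := arrow_sum x; set y' := arrow_sum x'.
have e1 : \sum_u y_in y u * y_in y' u = \sum_a y a * y' a.
  rewrite -(sum_fibers (fun a => (qt a, tt a))); apply: eq_bigr => u _.
  by rewrite mul_sum_single //; apply: in_single.
have e2 : \sum_(u | has_out u) pass_sum x u * pass_sum x' u = \sum_a y a * y' a.
  rewrite -(sum_fibers (fun a => (qs a, ts a))) [RHS](bigID has_out) /=.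
  rewrite [X in _ = _ + X]big1 ?addr0; last by move=> u /(y_out0 (fun a => y a * y' a)).
  apply: eq_bigr => u hu; rewrite !pass_sum_out // mul_sum_single //; exact: out_single.
(* Each vertex has two passages, so the product of x and x' there occurs twice, just as in the two
   Cartan forms. *)
have e3 : \sum_u pass_sum x u * pass_sum x' u = cartan_form x x' + cartan_form x' x +
    \sum_u y_in y u * y_in y' u.
  rewrite !cartan_formE -/y -/y' !sum_passes -!big_split; apply: eq_bigr => v _ /=.
  by rewrite /pass_sum /= -/y -/y'; ring.
apply: (addIr (\sum_u y_in y u * y_in y' u)); rewrite -e3 (bigID has_out) /= e2 e1.
by rewrite addrC.
Qed.

Lemma cartan_form_ge0 x : 0 <= cartan_form x x.
Proof.
have : 0 <= cartan_form x x + cartan_form x x.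
  by rewrite cartan_form_sym; apply: sumr_ge0 => u _; apply: sqr_ge0.
by rewrite -mulr2n pmulrn_lge0.
Qed.

Lemma cartan_kernel x :
  (forall x', cartan_form x x' + cartan_form x' x = 0) <->
  forall u, ~~ has_out u -> pass_sum x u = 0.
Proof.
split=> [h u hu|h x'].
  have := h x; rewrite cartan_form_sym => /eqP; rewrite psumr_eq0; last by move=> w _; apply: sqr_ge0.
  by move=> /allP/(_ u (mem_index_enum _)); rewrite hu mulf_eq0 orbb => /eqP.
by rewrite cartan_form_sym big1 // => u hu; rewrite h // mul0r.
Qed.

End CartanForm.

(** * The kernel as the flow space of a signed graph *)

Section Kernel.
Variables (k : fieldType) (Q : quiver) (I : set (pathalg k Q)).
Hypothesis hI : is_ideal I.
Hypothesis gI : gen_by_length_two I.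
Variable m : nat.
Hypothesis hm : (arrow_ideal_pow m `<=` I)%classic.
Variables (ts tt : Q1 Q -> bool).
Hypothesis pol : polarization (nz I) ts tt.
Variable R : realFieldType.

Local Notation arrow_sum := (@arrow_sum k Q I m R).
Local Notation pass_sum := (@pass_sum k Q I m tt R).

Definition sg (c : bool) : R := if c then 1 else -1.

Lemma sg_neq0 c : sg c != 0.
Proof. by case: c; rewrite /sg ?oppr_eq0 oner_eq0. Qed.

Definition incidence (v : Q0 Q) (b : Q1 Q) : R :=
  (qs b == v)%:R * sg (ts b) - (qt b == v)%:R * sg (tt b).

(** Row v compares the net outflows of y at the two passages of v. *)
Lemma incidence_row (y : Q1 Q -> R) v : \sum_b incidence v b * y b =
  (y_out ts y (v, true) - y_in tt y (v, true)) - (y_out ts y (v, false) - y_in tt y (v, false)).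
Proof.
have e (f : Q1 Q -> Q0 Q) (g : Q1 Q -> bool) :
    \sum_b (f b == v)%:R * sg (g b) * y b =
    \sum_(b | (f b, g b) == (v, true)) y b - \sum_(b | (f b, g b) == (v, false)) y b.
  rewrite [X in _ = X - _]big_mkcond [X in _ = _ - X]big_mkcond -sumrB.
  apply: eq_bigr => b _; rewrite !xpair_eqE /sg.
  by case: (f b == v); case: (g b) => /=; ring.
rewrite /y_out /y_in opprB addrACA -[X in _ = X + _]opprK.
under eq_bigr do rewrite /incidence mulrBl.
by rewrite sumrB !e; ring.
Qed.

Lemma incidence_col (s : Q0 Q -> R) b : \sum_v s v * incidence v b =
  s (qs b) * sg (ts b) - s (qt b) * sg (tt b).
Proof.
have e (w : Q0 Q) (c : R) : \sum_v s v * ((w == v)%:R * c) = s w * c.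
  rewrite (bigD1 w) //= eqxx mul1r big1 ?addr0 // => v /negPf vw.
  by rewrite eq_sym vw mul0r mulr0.
by under eq_bigr do rewrite /incidence mulrBr; rewrite sumrB !e.
Qed.

(** Induction on a bound for the lengths of the nonzero paths ending with the given arrow, which
    admissibility provides. *)
Lemma nz_recursion_unique (y y' : Q1 Q -> R) (x : Q0 Q -> R) :
  (forall b, y b = x (qs b) + \sum_(a | nz I b a) y a) ->
  (forall b, y' b = x (qs b) + \sum_(a | nz I b a) y' a) -> y =1 y'.
Proof.
move=> hy hy' b.
have h L a : (forall s, path (nz I) a s -> (size s < L)%N) -> y a = y' a.
  elim: L a => [|L IHL] a hL; first by have := hL [::] isT.
  rewrite hy hy'; congr (_ + _); apply: eq_bigr => c hc; apply: IHL => s hs.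
  by have := hL (c :: s); rewrite /= hc hs => /(_ isT).
by apply: (h m) => s; apply: (nz_path_size hI gI hm).
Qed.

Lemma arrow_sum_linear c (x x' : Q0 Q -> R) b :
  arrow_sum (fun v => c * x v + x' v) b = c * arrow_sum x b + arrow_sum x' b.
Proof. by rewrite /arrow_sum big_split /= mulr_sumr. Qed.

Definition pass_kernel (x : fspace R (Q0 Q)) : Prop :=
  forall u, ~~ has_out ts u -> pass_sum x u = 0.

(** At a passage with an outgoing arrow this is the recursion for that arrow; at any other nothing
    flows out and it is the kernel condition. *)
Lemma pass_kernel_balance (x : fspace R (Q0 Q)) u : pass_kernel x ->
  x u.1 = y_out ts (arrow_sum x) u - y_in tt (arrow_sum x) u.
Proof.
move=> hx; case hu : (has_out ts u).
  rewrite -(pass_sum_out hI gI hm pol x hu) /pass_sum addrK //.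
have nu : ~~ has_out ts u by rewrite hu.
have := hx u nu; rewrite /pass_sum => /eqP.
by rewrite (y_out0 _ nu) addr_eq0 sub0r => /eqP.
Qed.

Lemma pass_kernel_subspace : is_subspace pass_kernel.
Proof.
have lin c (x x' : fspace R (Q0 Q)) u :
    pass_sum (c *: x + x' : fspace R (Q0 Q)) u = c * pass_sum x u + pass_sum x' u.
  rewrite /pass_sum /y_in dprodP mulrDr addrACA; congr (_ + _).
  by rewrite mulr_sumr -big_split; apply: eq_bigr => a _; apply: arrow_sum_linear.
split=> [u hu|c x x' hx hx' u hu]; last by rewrite lin hx // hx' // mulr0 addr0.
rewrite /pass_sum dprod0 add0r; apply: big1 => a _.
by rewrite /arrow_sum big1.
Qed.

(* On the kernel, x v is the divergence of y = arrow_sum x at both passages of v,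
   so x can be eliminated and y is a flow on the signed graph. *)
Lemma reldim_flow d : reldim pass_kernel (fun x => x = 0) d ->
  reldim (fun y : fspace R (Q1 Q) => forall v, \sum_b incidence v b * y b = 0) (fun y => y = 0) d.
Proof.
pose F (x : fspace R (Q0 Q)) : fspace R (Q1 Q) := arrow_sum x.
have lF : linear F.
  by move=> c x x'; apply: dprod_ext => b; apply: arrow_sum_linear.
pose F' : {linear fspace R (Q0 Q) -> fspace R (Q1 Q)} :=
  HB.pack F (GRing.isLinear.Build _ _ _ _ F lF).
apply: (reldim_transfer (F := F')).
- exact: pass_kernel_subspace.
- exact: subspace_eq0.
- move=> x hx v; rewrite incidence_row.
  by rewrite -(pass_kernel_balance (v, true) hx) -(pass_kernel_balance (v, false) hx) subrr.
- move=> x hx; split=> [->|h]; first by rewrite linear0.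
  have h' : arrow_sum x = (fun _ => 0) by exact: h.
  apply: dprod_ext => v; rewrite (pass_kernel_balance (v, true) hx) h'.
  by rewrite /y_out /y_in !big1 // subrr.
(* The passage of class false gives the same x, because row v of the incidence matrix annihilates
   y. *)
- move=> y hy; pose x : fspace R (Q0 Q) := fun v => y_out ts y (v, true) - y_in tt y (v, true).
  have xE u : x u.1 = y_out ts y u - y_in tt y u.
    case: u => v [] //; apply/eqP; rewrite -subr_eq0 -incidence_row; apply/eqP; exact: hy.
  have ey : arrow_sum x = y.
    apply: functional_extensionality_dep => b; apply: nz_recursion_unique => {}b.
      exact: (arrow_sum_nz hI gI hm).
    by rewrite (sum_nz pol) (xE (qs b, ts b)) (y_outE pol) subrK.
  exists x; last by rewrite /= /F ey subrr.
  by move=> u hu; rewrite /pass_sum ey xE (y_out0 _ hu) subrK.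
Qed.

Definition potential (s : fspace R (Q0 Q)) : Prop := forall b, \sum_v s v * incidence v b = 0.

Lemma potentialP s : potential s <-> forall b, s (qs b) * sg (ts b) = s (qt b) * sg (tt b).
Proof.
split=> h b; first by apply/eqP; rewrite -subr_eq0 -incidence_col h.
by rewrite incidence_col h subrr.
Qed.

Hypothesis cQ : connected_quiver Q.

Lemma potential_zero s v w : potential s -> s v = 0 -> s w = 0.
Proof.
move=> /potentialP hs.
have key b : (s (qs b) == 0) = (s (qt b) == 0).
  have := congr1 (fun z => z == 0) (hs b).
  by rewrite /= !mulf_eq0 !(negPf (sg_neq0 _)) !orbF.
have [p] := connectP (cQ v w); elim: p v => [|z p IHp] v /=; first by move=> _ ->.
move=> /andP[/existsP[b hb] hp] el v0; apply: (IHp z hp el); apply/eqP.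
case/orP: hb => /andP[/eqP e1 /eqP e2]; first by rewrite -e2 -key e1 v0.
by rewrite -e1 key e2 v0.
Qed.

Lemma sgM c c' : sg (c (+) c') = - (sg c * sg c').
Proof. by case: c; case: c'; rewrite /sg /=; ring. Qed.

(** On a connected quiver a potential vanishing at one vertex is zero, so the dimension is at most
    1. A switching function gives a potential with values 1 and -1; conversely the signs of a
    nonzero potential form a switching function. *)
Lemma reldim_potential (v0 : Q0 Q) :
  reldim potential (fun s => s = 0) (if `[< balanced ts tt >] then 1%N else 0%N).
Proof.
case: asboolP => [[e he]|nb].
  pose s0 : fspace R (Q0 Q) := fun v => sg (e v).
  have hs0 : potential s0.
    (* Both sides are negated to match the minus sign in [sgM]. *)
    apply/potentialP => b; apply: oppr_inj.
    by rewrite /s0 -!sgM he.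
  exists (fun _ => s0); split=> // [s hs|c].
    pose c := s v0 / s0 v0; exists (const_mx c).
    have sub : is_subspace potential.
      split=> [b|a s1 s2 h1 h2 b]; first by rewrite big1 // => v _; rewrite dprod0 mul0r.
      have -> : \sum_v (a *: s1 + s2 : fspace R (Q0 Q)) v * incidence v b =
          a * (\sum_v s1 v * incidence v b) + \sum_v s2 v * incidence v b.
        rewrite mulr_sumr -big_split; apply: eq_bigr => v _ /=.
        by rewrite dprodP mulrDl mulrA.
      by rewrite h1 h2 mulr0 addr0.
    apply: dprod_ext => w; apply: (@potential_zero _ v0).
      by apply: (subspaceB sub) => //; apply: subspace_lincomb.
    rewrite dprodB dprod_lincomb /lincomb big_ord1 mxE /c.
    by rewrite -[_ *: _]/(_ * _) divfK ?subrr // sg_neq0.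
  move=> h; apply/rowP => i; rewrite ord1 mxE; have := congr1 (fun s : fspace R _ => s v0) h.
  rewrite dprod_lincomb /lincomb big_ord1 dprod0 => /eqP.
  by rewrite -[_ *: _]/(_ * _) mulf_eq0 (negPf (sg_neq0 _)) orbF => /eqP.
apply: reldim_refl => s hs; apply: dprod_ext => w; rewrite dprod0.
apply: contrapT => sw; apply: nb; exists (fun v => 0 < s v) => b.
have nz v : s v != 0.
  by apply/eqP => h; apply: sw; apply: potential_zero hs h.
have /potentialP/(_ b) := hs; have := nz (qs b); have := nz (qt b).
rewrite /sg; case: (ltgtP (s (qs b)) 0) => // h1 _; case: (ltgtP (s (qt b)) 0) => // h2 _;
  case: (ts b); case: (tt b) => //=; rewrite ?mulr1 ?mulrN1; lra.
Qed.

Lemma pass_kernel_dim d : #|Q0 Q| = #|Q1 Q| -> (0 < #|Q1 Q|)%N ->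
  reldim pass_kernel (fun x => x = 0) d -> d = nabla I.
Proof.
move=> e01 /card_gt0P[b _] /reldim_flow /(reldim_transpose e01) h.
have := reldim_unique (@subspace_eq0 R _) h (reldim_potential (qs b)).
move=> ->; rewrite /nabla; congr (if _ then _ else _).
by apply/asbool_equiv_eq; apply: iff_sym; apply: multi_clockP.
Qed.

End Kernel.

(** * The Euler form *)

Section Polar.
Variables (k : fieldType) (A : algType k).
Implicit Types x y : K0 A.

Lemma euler_form_suml (T : Type) (s : seq T) (F : T -> K0 A) (c : T -> int) y :
  euler_form (\sum_(i <- s) F i *~ c i) y = \sum_(i <- s) c i * euler_form (F i) y.
Proof.
pose f : {additive K0 A -> int} := HB.pack (fun x => euler_form x y)
  (GRing.isZmodMorphism.Build _ _ _ (fun a b => euler_formBl a b y)).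
rewrite -[LHS]/(f _) raddf_sum; apply: eq_bigr => i _.
by rewrite raddfMz -mulrzl intz.
Qed.

Lemma euler_form_sumr (T : Type) (s : seq T) (F : T -> K0 A) (c : T -> int) x :
  euler_form x (\sum_(i <- s) F i *~ c i) = \sum_(i <- s) c i * euler_form x (F i).
Proof.
pose f : {additive K0 A -> int} := HB.pack (fun y => euler_form x y)
  (GRing.isZmodMorphism.Build _ _ _ (fun a b => euler_formBr x a b)).
rewrite -[LHS]/(f _) raddf_sum; apply: eq_bigr => i _.
by rewrite raddfMz -mulrzl intz.
Qed.

Lemma polarE x y : polar x y = euler_form x y + euler_form y x.
Proof.
have Dl a b c : euler_form (a + b) c = euler_form a c + euler_form b c :> int.
  have h := euler_formBl (a + b) b c; rewrite addrK in h.
  by rewrite h subrK.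
have Dr a b c : euler_form c (a + b) = euler_form c a + euler_form c b :> int.
  have h := euler_formBr c (a + b) b; rewrite addrK in h.
  by rewrite h subrK.
rewrite /polar /q_form Dl !Dr; ring.
Qed.

End Polar.

(** * The Gram matrix in an arbitrary basis *)

Section Corank.
Variables (k : fieldType) (Q : quiver) (I : set (pathalg k Q)).
Variables (A : algType k) (pi : {rmorphism pathalg k Q -> A}).
Hypothesis gQ : gentle I.
Hypothesis hpi : presents I pi.
Hypothesis hI : is_ideal I.
Hypothesis gI : gen_by_length_two I.
Variable m : nat.
Hypothesis hm : (arrow_ideal_pow m `<=` I)%classic.
Variables (ts tt : Q1 Q -> bool).
Hypothesis pol : polarization (nz I) ts tt.

Let pb := presentation_basis hI gI hm hpi.
Local Notation b0 := (K0vtx pb).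
Local Notation rk := (vtx_rank pb).
Local Notation cartan := (@cartan_form k Q I m rat).

Definition ranks (x : K0 A) (v : Q0 Q) : rat := (rk v x)%:~R.

Lemma cartan_suml (T : finType) (c : T -> rat) (F : T -> Q0 Q -> rat) x :
  cartan (fun v => \sum_i c i * F i v) x = \sum_i c i * cartan (F i) x.
Proof.
rewrite /cartan_form; under [RHS]eq_bigr do rewrite mulr_sumr.
rewrite [RHS]exchange_big; apply: eq_bigr => w _ /=.
under [RHS]eq_bigr do rewrite mulrCA.
rewrite -mulr_sumr; congr (_ * _); rewrite exchange_big; apply: eq_bigr => i _ /=.
by rewrite mulr_sumr.
Qed.

Lemma cartan_sumr (T : finType) (c : T -> rat) (F : T -> Q0 Q -> rat) x :
  cartan x (fun v => \sum_i c i * F i v) = \sum_i c i * cartan x (F i).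
Proof.
rewrite /cartan_form; under [RHS]eq_bigr do rewrite mulr_sumr.
rewrite [RHS]exchange_big; apply: eq_bigr => w _ /=.
by rewrite mulr_suml; apply: eq_bigr => i _; rewrite mulrA.
Qed.

Lemma cartan_delta v w :
  cartan (fun u => (u == v)%:R) (fun u => (u == w)%:R) =
  (count (fun p => psrc p == v) (good_paths I m w))%:R.
Proof.
rewrite /cartan_form (bigD1 w) //= eqxx mul1r [X in _ + X]big1 ?addr0; last first.
  by move=> u /negPf ->; rewrite mul0r.
rewrite -sum1_count natr_sum [RHS]big_mkcond; apply: eq_bigr => p _.
by case: eqP.
Qed.

Lemma fun_delta (x : Q0 Q -> rat) : x = (fun v => \sum_w x w * (v == w)%:R).
Proof.
apply: functional_extensionality_dep => v.
by rewrite (bigD1 v) //= eqxx mulr1 big1 ?addr0 // => w /negPf wv; rewrite eq_sym wv mulr0.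
Qed.

Lemma euler_cartan (x y : K0 A) : (euler_form x y)%:~R = cartan (ranks x) (ranks y).
Proof.
rewrite {1}(K0vtx_expand pb x) {1}(K0vtx_expand pb y) euler_form_suml rmorph_sum.
rewrite [ranks x]fun_delta cartan_suml; apply: eq_bigr => v _ /=.
rewrite intrM; congr (_ * _).
rewrite euler_form_sumr rmorph_sum [ranks y]fun_delta cartan_sumr.
apply: eq_bigr => w _ /=; rewrite intrM euler_K0vtx cartan_delta.
by congr (_ * _); rewrite -pmulrn.
Qed.

Lemma q_form_ge0 (x : K0 A) : 0 <= q_form x.
Proof.
rewrite -(ler0z rat) /q_form euler_cartan.
exact: (cartan_form_ge0 hI gI hm pol).
Qed.

Lemma K0_vertex_basis :
  K0_basis (fun i : 'I_#|Q0 Q| => b0 (enum_val i)).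
Proof.
move=> x; exists (\row_i rk (enum_val i) x); split.
  rewrite {1}(K0vtx_expand pb x) (reindex (@enum_val (Q0 Q) predT)) /=; last exact: onW_bij (@enum_val_bij _).
  by apply: eq_bigr => i _; rewrite mxE.
move=> c e; apply/rowP => i; rewrite mxE e.
have -> : \sum_i b0 (enum_val i) *~ c 0 i = \sum_v b0 v *~ c 0 (enum_rank v).
  rewrite [RHS](reindex (@enum_val (Q0 Q) predT)) /=; last exact: onW_bij (@enum_val_bij _).
  by apply: eq_bigr => j _; rewrite enum_valK.
by rewrite (vtx_rank_sum pb (fun v => c 0 (enum_rank v))) enum_valK.
Qed.

Section Basis.
Variables (n : nat) (b : 'I_n -> K0 A).
Hypothesis bb : K0_basis b.

Lemma gramE i j : gram b i j =
  cartan (ranks (b i)) (ranks (b j)) + cartan (ranks (b j)) (ranks (b i)).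
Proof. by rewrite mxE polarE intrD !euler_cartan. Qed.

(** Two mutually inverse integer matrices relate b to the vertex basis: [vtx_rank] in one direction,
    the coordinates V of the vertex classes in the other. *)
Lemma basis_change : exists V : Q0 Q -> 'I_n -> int,
  (forall v w, \sum_j V w j * rk v (b j) = (w == v)) /\
  (forall i j, \sum_v rk v (b j) * V v i = (i == j)).
Proof.
have /choice[c hc] : forall v, exists c : 'rV[int]_n, b0 v = \sum_(i < n) b i *~ c 0 i.
  by move=> v; have [c [hc _]] := bb (b0 v); exists c.
exists (fun v i => c v 0 i); split=> [v w|i j].
  rewrite -(vtx_rank_K0vtx pb w v) {1}(hc w) raddf_sum; apply: eq_bigr => j _ /=.
  by rewrite raddfMz -mulrzl intz.
(* The unique coordinates of b j are the unit row, and also the row found by expanding b j over the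
   vertex classes and these over b. *)
have [d [_ ud]] := bb (b j).
have d1 : d = delta_mx 0 j.
  apply: ud; rewrite (bigD1 j) //= mxE !eqxx mulr1z big1 ?addr0 // => l /negPf lj.
  by rewrite mxE lj mulr0z.
have d2 : d = \row_i \sum_v rk v (b j) * c v 0 i.
  apply: ud; rewrite {1}(K0vtx_expand pb (b j)).
  transitivity (\sum_v \sum_(l < n) b l *~ (rk v (b j) * c v 0 l)).
    apply: eq_bigr => v _; rewrite {1}(hc v) mulrz_suml; apply: eq_bigr => l _.
    by rewrite -mulrzA mulrC.
  rewrite exchange_big; apply: eq_bigr => l _ /=; rewrite mxE.
  by rewrite mulrz_sumr.
by have := congr1 (fun u : 'rV[int]_n => u 0 i) (etrans (esym d2) d1); rewrite !mxE /= => ->; rewrite natz.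
Qed.

Definition combine (u : 'rV[rat]_n) : fspace rat (Q0 Q) := fun v => \sum_i u 0 i * ranks (b i) v.

Lemma combine_linear : linear combine.
Proof.
move=> c u w; apply: dprod_ext => v; rewrite dprodP /combine.
rewrite -[_ *: \sum_(_ <- _) _]/(c * _) mulr_sumr -big_split; apply: eq_bigr => i _ /=.
by rewrite !mxE mulrDl mulrA.
Qed.

HB.instance Definition _ :=
  GRing.isLinear.Build rat 'rV[rat]_n (fspace rat (Q0 Q)) _ combine combine_linear.

Lemma combine_surj (x : fspace rat (Q0 Q)) : exists u, x = combine u.
Proof.
have [V [hV _]] := basis_change; exists (\row_j \sum_w x w * (V w j)%:~R).
apply: dprod_ext => v; rewrite /combine.
under eq_bigr do rewrite mxE mulr_suml.
rewrite exchange_big {1}[x]fun_delta; apply: eq_bigr => w _ /=.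
under eq_bigr do rewrite -mulrA.
rewrite -mulr_sumr; congr (_ * _); rewrite eq_sym.
have /(congr1 (fun z : int => z%:~R : rat)) := hV v w; rewrite rmorph_sum /=.
rewrite -pmulrn => <-; apply: eq_bigr => j _; exact: intrM.
Qed.

Lemma combine_inj u : combine u = 0 -> u = 0.
Proof.
have [V [_ hV]] := basis_change => h; apply/rowP => i; rewrite mxE.
have <- : \sum_v combine u v * (V v i)%:~R = 0 by rewrite h big1 // => v _; rewrite dprod0 mul0r.
rewrite /combine; under eq_bigr do rewrite mulr_suml.
rewrite exchange_big (bigD1 i) //= [X in _ + X]big1 ?addr0 => [|j /negPf ji].
  under eq_bigr do rewrite -mulrA; rewrite -mulr_sumr.
  have /(congr1 (fun z : int => z%:~R : rat)) := hV i i; rewrite rmorph_sum /= eqxx => e.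
  by under eq_bigr do rewrite -intrM; rewrite e mulr1.
under eq_bigr do rewrite -mulrA; rewrite -mulr_sumr.
have /(congr1 (fun z : int => z%:~R : rat)) := hV i j; rewrite rmorph_sum /= eq_sym ji => e.
by under eq_bigr do rewrite -intrM; rewrite e mulr0.
Qed.

Lemma gram_combine u j : (u *m gram b) 0 j =
  cartan (combine u) (ranks (b j)) + cartan (ranks (b j)) (combine u).
Proof.
rewrite mxE /combine cartan_suml cartan_sumr -big_split; apply: eq_bigr => i _ /=.
by rewrite gramE mulrDr.
Qed.

(** Vanishing against all b j is vanishing against every rational vector, since the b j span over
    the rationals; then [cartan_kernel] applies. *)
Lemma gram_kernel u : u *m gram b = 0 <-> pass_kernel I m ts tt (combine u).
Proof.
have ck := cartan_kernel hI gI hm pol (combine u).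
split=> [h|/ck h]; last by apply/rowP => j; rewrite gram_combine mxE h.
apply/ck => x'; have [c ->] := combine_surj x'.
rewrite {2 3}/combine cartan_sumr cartan_suml -big_split big1 // => j _ /=.
by rewrite -mulrDr -gram_combine h mxE mulr0.
Qed.

Lemma gram_corank : #|Q0 Q| = #|Q1 Q| -> \rank (kermx (gram b)) = nabla I.
Proof.
move=> e; have [[cQ Q1pos] _] := gQ.
apply: (pass_kernel_dim hI gI hm pol (R := rat)) => //.
apply: (reldim_transfer (F := combine)) (reldim_kermx (gram b)).
- by split=> [|c x y hx hy]; rewrite ?mul0mx // mulmxDl -scalemxAl hx hy scaler0 addr0.
- exact: subspace_eq0.
- by move=> u /gram_kernel.
- by move=> u _; split=> [->|/combine_inj]; first rewrite linear0.
- move=> x; have [u ->] := combine_surj x => hu.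
  by exists u; [exact/gram_kernel | rewrite subrr].
Qed.

End Basis.
End Corank.

Theorem corollary4p36 (k : fieldType) (Q : quiver) (I : set (pathalg k Q))
    (A : algType k) (pi : {rmorphism pathalg k Q -> A}) :
  gentle I -> presents I pi -> one_cycle Q ->
  (forall x : K0 A, 0 <= q_form x) /\
  corank_eq A (nabla I) /\ nabla I \in [:: 0; 1]%N.
Proof.
move=> gQ hpi oc.
have [_ [[[hI [m _ [hm _]]] gI] _]] := gQ.
have [ts [tt pol]] := gentle_polarization gQ.
have e : #|Q0 Q| = #|Q1 Q| by move: oc; rewrite /one_cycle; lia.
split; first by move=> x; apply: (q_form_ge0 hpi hI gI hm pol).
split; last by rewrite /nabla; case: ifP.
split; first by eexists; eexists; exact: (K0_vertex_basis hpi hI gI hm).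
by move=> n b bb; apply: (gram_corank gQ hpi hI gI hm pol bb e).
Qed.
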